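(* Let $p\ge1$, let $\mathcal{M}$ be the induced mesh described in the context, satisfying the $K$-mesh assumption there, and let $\mathbb{V}_p(\mathcal{M})=\Pi_{K\in\mathcal{M}}Q_p(K)$. There exists an interpolation operator $\pi_h:\mathbb{V}_p(\mathcal{M})\to\mathbb{V}_p(\mathcal{M})\cap H^1(\Omega)$ such that for any $v\in\mathbb{V}_p(\mathcal{M})$ and any $K\in\mathcal{M}$, $$\|v-\pi_hv\|_{L^2(K)}\le C\|p^{-1}h^{1/2}[[v]]\|_{L^2(\sigma(K))},$$ $$\|\nabla(v-\pi_hv)\|_{L^2(K)}\le C\|p\,h^{-1/2}[[v]]\|_{L^2(\sigma(K))},$$ where $\sigma(K)=\{e\in\mathcal{E}^{\rm side}:e\subset\widetilde\omega(K)\}$ and $\widetilde\omega(K)$ is a set of elements of $\mathcal{M}$ including $K$ such that $\mathrm{diam}(\widetilde\omega(K))\le Ch_K$. The constant $C$ is independent of $h_K$ and $p$. Moreover, $\pi_hv\in H_0^1(\Omega)$ if $v=0$ on $\partial\Omega$.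
   Context: $Q_p(K)$ is the set of polynomials on $K$ of degree at most $p$ in each variable. $\mathbb{V}_p(\mathcal M)$ is the space of piecewise $Q_p$ functions on $\mathcal{M}$, with no interelement continuity. $\mathcal{E}^{\rm side}=\{e=\partial K\cap\partial K':K,K'\in\mathcal{M}\}$ (since hanging nodes are allowed, $e$ may be only part of a side of an adjacent element); $[[v]]$ on $e\in\mathcal{E}^{\rm side}$ is the difference of the traces of $v$ from the two sides of $e$; $h|_e=(h_K+h_{K'})/2$ for $e=\partial K\cap\partial K'$; $\|\cdot\|_{L^2(\sigma(K))}^2=\sum_{e\in\sigma(K)}\|\cdot\|_{L^2(e)}^2$. Setting. $\Omega\subset\mathbb{R}^2$ is a bounded Lipschitz domain which is a union of bounded axis-parallel rectangles. $\Gamma$ is a Lipschitz and piecewise $C^2$-smooth interface dividing $\Omega$ into $\Omega_1,\Omega_2$ with $\bar\Omega_1\subset\Omega$, $\Omega_2=\Omega\setminus\bar\Omega_1$, $\Gamma=\partial\Omega_1\cap\partial\Omega_2$. Points where $\Gamma$ is not $C^2$ are called singular points. Mesh. $\mathcal{T}$ is a Cartesian mesh of $\Omega$: its elements are open rectangles with sides parallel to the coordinate axes; hanging nodes are allowed; it is obtained from a conforming initial Cartesian mesh by successive local quad-refinements (subdividing an element into four congruent rectangles). $h_K$ is the diameter of $K$. $\Gamma$ intersects the boundary of each element it meets at most twice, at different (open) sides, and each element contains at most one singular point of $\Gamma$. Large elements. Fix $\delta_0\in(0,1/2)$. A rectangle $K$ is large with respect to $\Omega_i$ if $K\subset\Omega_i$,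 or if $K\cap\Gamma\ne\emptyset$ and $|e\cap\Omega_i|\ge\delta_0|e|$ for each side $e$ of $K$ with $e\cap\Omega_i\neq\emptyset$ and, if moreover $K$ has only one vertex $A_K^i$ in $\Omega_i$ and contains a singular point $Q_K$ of $\Gamma$, then $\mathrm{dist}(Q_K,e_j)\ge\frac12\delta_0\min(|e_1|,|e_2|)$, $j=1,2$, where $e_1,e_2$ are the sides of $K$ with end point $A_K^i$. Large elements with respect to $\Omega_i$ having only one vertex in $\Omega_i$ and containing a singular point are called irregular; other large elements are called regular. Interface deviation. For $K\cap\Gamma\ne\emptyset$, $\Gamma_K=\Gamma\cap K$ and $\Gamma_K^h$ is the open segment joining the two points of $\Gamma\cap\partial K$. If $K$ contains a singular point $Q_K$, $\Gamma_K$ is the union of two $C^2$ curves $\Gamma_{1K},\Gamma_{2K}$ and $\Gamma_{jK}^h$ is the open segment joining $Q_K$ and the point $\Gamma_{jK}\cap\partial K$. Set $\eta_K=\max(\eta_K^1,\eta_K^2)$, where $\eta_K^i=\mathrm{dist}_{\rm H}(\Gamma_K,\Gamma_K^h)/\mathrm{dist}(A_K^i,\Gamma_K^h)$ if $K$ is a regular large element with respect to $\Omega_i$, with $A_K^i\in\Omega_i$ the vertex of $K$ in $\Omega_i$ of maximum distance to $\Gamma_K^h$, and $\eta_K^i=\max_{j=1,2}\mathrm{dist}_{\rm H}(\Gamma_{jK},\Gamma_{jK}^h)/\mathrm{dist}(A_K^i,\Gamma_{jK}^h)$ if $K$ is an irregular large element with respect to $\Omega_i$ with vertex $A_K^i\in\Omega_i$.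 Here $\mathrm{dist}_{\rm H}(\Gamma_1,\Gamma_2)=\max_{x\in\Gamma_1}\min_{y\in\Gamma_2}|x-y|$. Induced mesh. $\mathcal{M}$ is a Cartesian mesh of $\Omega$ obtained from $\mathcal{T}$ by merging interface elements $K$ with neighboring elements into rectangular macro-elements of size comparable to $h_K$ (ratio of diameters bounded by a fixed constant), such that every element of $\mathcal{M}$ meeting $\Gamma$ is large with respect to both $\Omega_1$ and $\Omega_2$ and satisfies $\eta_K\le\max(1/2,(1-\delta_0)/(1+\delta_0))$. $K$-mesh assumption. A node of $\mathcal{M}$ is conforming if it lies on $\partial\Omega$ or is shared by the four elements to which it belongs; $\mathcal{N}^0$ is the set of conforming nodes. For $P\in\mathcal{N}^0$, $\psi_P\in H^1(\Omega)$ is the continuous function, bilinear on each element, with $\psi_P(Q)=\delta_{PQ}$ for $Q\in\mathcal{N}^0$; these functions form a basis of the continuous piecewise bilinear functions on $\mathcal M$ and $\sum_{P\in\mathcal{N}^0}\psi_P=1$. There is a constant $C$, uniform in the level of discretization, with $\mathrm{diam}(\mathrm{supp}\,\psi_P)\le C\min\{h_K:K\in\mathcal{M},K\subset\mathrm{supp}\,\psi_P\}$ for all $P\in\mathcal{N}^0$.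
   Formalization: With C independent of p the claim fails if sides of two elements of the induced mesh overlap only partially (brick pattern); the formal statement therefore requires each nondegenerate common part of the boundaries of two elements of the mesh to be a whole side of one of them. *)

(* Defs.v *)
(* Written with MathComp-Analysis, over an arbitrary R : realType. *)
From HB Require Import structures.
From mathcomp Require Import all_boot all_order all_algebra.
From mathcomp Require Import all_classical all_reals all_analysis.

Set Implicit Arguments.
Unset Strict Implicit.
Unset Printing Implicit Defensive.

Import Order.TTheory GRing.Theory Num.Theory.
Import numFieldNormedType.Exports.

Local Open Scope classical_set_scope.
Local Open Scope ring_scope.

Section Plane.
Variable R : realType.
Local Notation pt := (R * R)%type.
Implicit Types (x y P Q : pt) (A B : set pt).

(* The norm of R * R in the library is the sup norm: it gives the topology, but
   all distances below are Euclidean. *)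
Definition edist x y : R := Num.sqrt ((x.1 - y.1) ^+ 2 + (x.2 - y.2) ^+ 2).

Definition pdist x A : R := inf [set edist x y | y in A].

(* One-sided, as in the definition of the interface deviation. *)
Definition distH A B : R := sup [set pdist x B | x in A].

Definition diam A : R := sup [set edist z.1 z.2 | z in A `*` A].

Definition bd A : set pt := closure A `\` interior A.

Definition seg_pt (s : pt * pt) (t : R) : pt := (1 - t) *: s.1 + t *: s.2.

Definition seg (s : pt * pt) : set pt := seg_pt s @` [set t | 0 <= t <= 1].

Definition oseg (s : pt * pt) : set pt := seg_pt s @` [set t | 0 < t < 1].

Definition seg_int (s : pt * pt) A (f : pt -> R) : R :=
  edist s.1 s.2 *
  \int[@lebesgue_measure R]_(t in [set t | 0 <= t <= 1 /\ A (seg_pt s t)])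
     f (seg_pt s t).

Definition seg_len (s : pt * pt) A : R := seg_int s A (fun=> 1).

End Plane.

(* A rectangle is given by its lower left and its upper right corner. *)
Notation rect R := ((R * R) * (R * R))%type.

Section Rectangles.
Variable R : realType.
Local Notation pt := (R * R)%type.
Local Notation rect := (rect R).


Definition is_rect (K : rect) : Prop := K.1.1 < K.2.1 /\ K.1.2 < K.2.2.

Definition box (K : rect) : set pt :=
  [set x | K.1.1 < x.1 < K.2.1 /\ K.1.2 < x.2 < K.2.2].

Definition hK (K : rect) : R := diam (box K).

Definition vertices (K : rect) : seq pt :=
  [:: K.1; (K.2.1, K.1.2); (K.1.1, K.2.2); K.2].

(* Oriented towards increasing coordinates, so that a side common to two
   rectangles is the same pair of points for both. *)
Definition sides (K : rect) : seq (pt * pt) :=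
  [:: (K.1, (K.2.1, K.1.2)); ((K.1.1, K.2.2), K.2);
      (K.1, (K.1.1, K.2.2)); ((K.2.1, K.1.2), K.2)].

(* Arc-length integral over the part of the boundary of K which lies in A; the
   corners, counted twice, have measure zero. *)
Definition bd_int (K : rect) (A : set pt) (f : pt -> R) : R :=
  \sum_(s <- sides K) seg_int s A f.

Definition quad (K : rect) : seq rect :=
  let m : pt := ((K.1.1 + K.2.1) / 2, (K.1.2 + K.2.2) / 2) in
  [:: (K.1, m); ((m.1, K.1.2), (K.2.1, m.2));
      ((K.1.1, m.2), (m.1, K.2.2)); (m, K.2)].

(* The last clause fixes the kind of hanging nodes: a nondegenerate common part
   of the boundaries of two elements may be only a part of a side of one of
   them, but it is then a whole side of the other one. *)
Definition cartesian_mesh (Om : set pt) (T : seq rect) : Prop :=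
  [/\ uniq T,
      forall K, K \in T -> is_rect K /\ box K `<=` Om,
      forall K K', K \in T -> K' \in T -> K <> K' -> box K `&` box K' = set0,
      closure Om = [set x | exists2 K, K \in T & closure (box K) x]
    & forall K K', K \in T -> K' \in T -> K <> K' ->
        (forall x y, (bd (box K) `&` bd (box K')) x ->
                     (bd (box K) `&` bd (box K')) y -> x = y) \/
        (exists2 s, s \in sides K ++ sides K' &
                    bd (box K) `&` bd (box K') = seg s)].

Definition conforming (T : seq rect) : Prop :=
  forall K K', K \in T -> K' \in T -> K <> K' ->
  [\/ bd (box K) `&` bd (box K') = set0,
      exists P, [/\ P \in vertices K, P \in vertices K' &
                    bd (box K) `&` bd (box K') = [set P]]
    | exists s, [/\ s \in sides K, s \in sides K' &
                    bd (box K) `&` bd (box K') = seg s]].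

Inductive refinement (T0 : seq rect) : seq rect -> Prop :=
| refinement_refl : refinement T0 T0
| refinement_step s1 K s2 :
    refinement T0 (s1 ++ K :: s2) -> refinement T0 (s1 ++ quad K ++ s2).

End Rectangles.

Section Interface.
Variable R : realType.
Local Notation pt := (R * R)%type.

Definition rot (c s : R) (x : pt) : pt := (c * x.1 + s * x.2, c * x.2 - s * x.1).

(* Near each boundary point, A is the strict epigraph of a Lipschitz function in
   some rotated orthonormal coordinates. *)
Definition lipschitz_boundary (A : set pt) : Prop :=
  forall x, bd A x -> exists (r c s L : R) (phi : R -> R),
    [/\ 0 < r, c ^+ 2 + s ^+ 2 = 1,
        forall t u, `|phi t - phi u| <= L * `|t - u|
      & forall y, edist x y < r ->
          (A y <-> phi (rot c s y).1 < (rot c s y).2)].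

Definition lipschitz_domain (A : set pt) : Prop :=
  [/\ open A, A !=set0, connected A & lipschitz_boundary A].

Definition C2_fun (f : R -> R) : Prop :=
  [/\ forall t, derivable f t 1, forall t, derivable (derive1 f) t 1
    & continuous (derive1 (derive1 f))].

(* Parametrized on [0, 1]; the C^2 regularity up to the end points is expressed
   by a C^2 extension to R. *)
Definition C2_arc (g : R -> pt) : Prop :=
  [/\ C2_fun (fst \o g), C2_fun (snd \o g),
      forall t, 0 <= t <= 1 ->
        derive1 (fst \o g) t != 0 \/ derive1 (snd \o g) t != 0
    & forall t u, 0 <= t <= 1 -> 0 <= u <= 1 -> g t = g u -> t = u].

(* Distinct arcs may only meet at their end points. *)
Definition piecewise_C2 (G : set pt) : Prop :=
  exists (m : nat) (g : 'I_m -> R -> pt),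
    [/\ forall k, C2_arc (g k),
        G = [set x | exists k, (g k @` [set t | 0 <= t <= 1]) x]
      & forall k l t u, k != l -> 0 <= t <= 1 -> 0 <= u <= 1 ->
          g k t = g l u -> (t = 0 \/ t = 1) /\ (u = 0 \/ u = 1)].

Definition C2_at (G : set pt) (x : pt) : Prop :=
  exists (r c s : R) (phi : R -> R),
    [/\ 0 < r, c ^+ 2 + s ^+ 2 = 1, C2_fun phi
      & forall y, edist x y < r ->
          (G y <-> (rot c s y).2 = phi (rot c s y).1)].

Definition singular (G : set pt) (x : pt) : Prop := G x /\ ~ C2_at G x.

Definition outer (Om Om1 : set pt) : set pt := Om `\` closure Om1.

Definition interface (Om Om1 : set pt) : set pt := bd Om1 `&` bd (outer Om Om1).

Definition rectangular_domain (Om : set pt) : Prop :=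
  lipschitz_domain Om /\
  exists B : seq (rect R), (forall K, K \in B -> is_rect K) /\
    Om = [set x | exists2 K, K \in B & box K x].

Definition interface_setting (Om Om1 : set pt) : Prop :=
  [/\ open Om1, Om1 !=set0, closure Om1 `<=` Om, lipschitz_boundary Om1
    & piecewise_C2 (interface Om Om1)].

Definition meets_iface (G : set pt) (K : rect R) : Prop := box K `&` G !=set0.

Definition interface_resolved (G : set pt) (T : seq (rect R)) : Prop :=
  forall K, K \in T ->
    (meets_iface G K ->
      [/\ forall x y z, (G `&` bd (box K)) x -> (G `&` bd (box K)) y ->
            (G `&` bd (box K)) z -> [\/ x = y, y = z | x = z],
          forall x, (G `&` bd (box K)) x -> exists2 s, s \in sides K & oseg s x
        & forall x y s, (G `&` bd (box K)) x -> (G `&` bd (box K)) y ->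
            s \in sides K -> oseg s x -> oseg s y -> x = y]) /\
    (forall Q Q', box K Q -> singular G Q -> box K Q' -> singular G Q' -> Q = Q').

Definition only_vertex (K : rect R) (O : set pt) (A : pt) : Prop :=
  [/\ A \in vertices K, O A & forall B, B \in vertices K -> O B -> B = A].

Definition end_of (A : pt) (s : pt * pt) : Prop := A = s.1 \/ A = s.2.

Definition large (d0 : R) (G O : set pt) (K : rect R) : Prop :=
  box K `<=` O \/
  [/\ meets_iface G K,
      forall s, s \in sides K -> seg s `&` O !=set0 ->
        d0 * edist s.1 s.2 <= seg_len s O
    & forall A Q, only_vertex K O A -> box K Q -> singular G Q ->
        forall e1 e2, e1 \in sides K -> e2 \in sides K -> e1 <> e2 ->
          end_of A e1 -> end_of A e2 ->
          2^-1 * d0 * Num.min (edist e1.1 e1.2) (edist e2.1 e2.2)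
            <= pdist Q (seg e1)].

(* For large elements, this is the notion of irregular element; the other large
   elements are regular. *)
Definition irregular (G O : set pt) (K : rect R) : Prop :=
  (exists A, only_vertex K O A) /\ (exists2 Q, box K Q & singular G Q).

Definition regular_deviation (G O : set pt) (K : rect R) (r : R) : Prop :=
  exists a b A : pt,
    [/\ a <> b, G `&` bd (box K) = [set a; b],
        A \in vertices K /\ O A,
        forall B, B \in vertices K -> O B ->
          pdist B (oseg (a, b)) <= pdist A (oseg (a, b))
      & r = distH (G `&` box K) (oseg (a, b)) / pdist A (oseg (a, b))].

Definition half_open_arc (g : R -> pt) : set pt := g @` [set t | 0 <= t < 1].

(* The arcs g1 and g2 run from the singular point Q to the boundary of K. *)
Definition irregular_deviation (G O : set pt) (K : rect R) (r : R) : Prop :=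
  exists (A Q : pt) (g1 g2 : R -> pt),
    [/\ only_vertex K O A, box K Q /\ singular G Q,
        [/\ C2_arc g1, C2_arc g2, g1 0 = Q & g2 0 = Q],
        [/\ g1 1 <> g2 1, G `&` bd (box K) = [set g1 1; g2 1],
            G `&` box K = half_open_arc g1 `|` half_open_arc g2
          & half_open_arc g1 `&` half_open_arc g2 = [set Q]]
      & r = Num.max
              (distH (half_open_arc g1) (oseg (Q, g1 1)) / pdist A (oseg (Q, g1 1)))
              (distH (half_open_arc g2) (oseg (Q, g2 1)) / pdist A (oseg (Q, g2 1)))].

(* r is the value of eta_K^i, where O stands for Omega_i *)
Definition deviation (G O : set pt) (K : rect R) (r : R) : Prop :=
  (~ irregular G O K /\ regular_deviation G O K r) \/
  (irregular G O K /\ irregular_deviation G O K r).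

(* Each element of M is an element of T or a macro-element, i.e. the union of an
   interface element of T and of other elements of T; the macro-element
   containing an interface element K of T has size comparable to h_K. *)
Definition merged (G : set pt) (C0 : R) (T M : seq (rect R)) : Prop :=
  [/\ forall K', K' \in M ->
        closure (box K') =
        [set x | exists K, [/\ K \in T, box K `<=` box K' & closure (box K) x]],
      forall K', K' \in M ->
        K' \in T \/ exists K, [/\ K \in T, meets_iface G K & box K `<=` box K']
    & forall K, K \in T -> meets_iface G K ->
        exists K', [/\ K' \in M, box K `<=` box K' & hK K' <= C0 * hK K]].

Definition induced_mesh (Om Om1 : set pt) (d0 C0 : R) (T M : seq (rect R)) : Prop :=
  let G := interface Om Om1 in
  [/\ cartesian_mesh Om M, merged G C0 T M
    & forall K, K \in M -> meets_iface G K ->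
        [/\ large d0 G Om1 K, large d0 G (outer Om Om1) K
          & exists r1 r2, [/\ deviation G Om1 K r1, deviation G (outer Om Om1) K r2
              & Num.max r1 r2 <= Num.max 2^-1 ((1 - d0) / (1 + d0))]]].

End Interface.

Section FunctionSpaces.
Variable R : realType.
Local Notation pt := (R * R)%type.

Definition mu2 := (@lebesgue_measure R \x @lebesgue_measure R)%E.

(* The partial derivative in x1 (b = false) or x2 (b = true). *)
Definition dir (b : bool) : pt := if b then (0, 1) else (1, 0).

Definition pderiv (b : bool) (f : pt -> R) : pt -> R := fun x => 'D_(dir b) f x.

Definition smooth (f : pt -> R) : Prop :=
  forall s : seq bool, let g := foldr pderiv f s in
    continuous g /\ forall x b, derivable g x (dir b).

Definition test_function (Om : set pt) (phi : pt -> R) : Prop :=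
  [/\ smooth phi, compact (closure [set x | phi x != 0])
    & closure [set x | phi x != 0] `<=` Om].

Definition L2 (Om : set pt) (u : pt -> R) : Prop :=
  measurable_fun Om u /\ mu2.-integrable Om (fun x => (u x ^+ 2)%:E).

Definition L2norm (A : set pt) (f : pt -> R) : R :=
  Num.sqrt (\int[mu2]_(x in A) (f x ^+ 2)).

Definition L2norm_grad (A : set pt) (f : pt -> R) : R :=
  Num.sqrt (\int[mu2]_(x in A) (pderiv false f x ^+ 2 + pderiv true f x ^+ 2)).

Definition weak_deriv (Om : set pt) (b : bool) (u g : pt -> R) : Prop :=
  forall phi, test_function Om phi ->
    \int[mu2]_(x in Om) (u x * pderiv b phi x) =
    - \int[mu2]_(x in Om) (g x * phi x).

Definition H1_grad (Om : set pt) (u : pt -> R) (g : bool -> pt -> R) : Prop :=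
  L2 Om u /\ forall b, L2 Om (g b) /\ weak_deriv Om b u (g b).

Definition H1 (Om : set pt) (u : pt -> R) : Prop := exists g, H1_grad Om u g.

(* The closure of the test functions in the norm of H^1(Om). *)
Definition H10 (Om : set pt) (u : pt -> R) : Prop :=
  exists g, H1_grad Om u g /\
    exists phi : nat -> pt -> R,
      [/\ forall k, test_function Om (phi k),
          L2norm Om (fun x => phi k x - u x) @[k --> \oo] --> (0 : R)
        & forall b,
          L2norm Om (fun x => pderiv b (phi k) x - g b x) @[k --> \oo] --> (0 : R)].

(* Polynomials are extended from K to the plane, so that the trace of an element
   of Qp on a side of K is its restriction. *)
Definition Qp (p : nat) : set (pt -> R) :=
  [set f | exists c : 'M[R]_p.+1, forall x,
     f x = \sum_(i < p.+1) \sum_(j < p.+1) c i j * x.1 ^+ i * x.2 ^+ j].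

(* The product of the spaces Q_p(K) over the n elements K of a mesh. *)
Definition Vp (n p : nat) : set ('I_n -> pt -> R) := [set v | forall i, Qp p (v i)].

(* The function on Om, up to a null set, defined by an element of Vp. *)
Definition broken_fun (n : nat) (M : n.-tuple (rect R)) (v : 'I_n -> pt -> R) : pt -> R :=
  fun x => \sum_(i < n) \1_(box (tnth M i)) x * v i x.

(* The trace of v on the boundary of Om vanishes: it is tested on nondegenerate
   segments, a boundary vertex of an element being negligible. *)
Definition vanishes_on_bd (Om : set pt) (n : nat) (M : n.-tuple (rect R))
    (v : 'I_n -> pt -> R) : Prop :=
  forall i s, s.1 <> s.2 -> seg s `<=` bd (box (tnth M i)) `&` bd Om ->
    forall x, seg s x -> v i x = 0.

Section Meshes.
Variables (Om : set pt) (n : nat) (M : n.-tuple (rect R)).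

Definition is_node : set pt := [set P | exists i, P \in vertices (tnth M i)].

Definition conforming_node : set pt :=
  [set P | is_node P /\
    (bd Om P \/
     let S := [set i : 'I_n | `[< closure (box (tnth M i)) P >]]%SET in
     #|S| = 4%N /\ forall i, i \in S -> P \in vertices (tnth M i))].

Definition cont_pw_bilinear (w : pt -> R) : Prop :=
  {within closure Om, continuous w} /\
  forall i, exists2 q, Qp 1 q &
    forall x, closure (box (tnth M i)) x -> w x = q x.

Definition supp (w : pt -> R) : set pt := closure [set x | Om x /\ w x != 0].

(* The basis property is stated as generation: independence follows from the
   values at the conforming nodes. *)
Definition k_mesh (CK : R) : Prop :=
  exists psi : pt -> pt -> R,
    [/\ forall P, conforming_node P ->
          [/\ H1 Om (psi P), cont_pw_bilinear (psi P)
            & forall Q, conforming_node Q -> psi P Q = (P == Q)%:R],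
        forall w, cont_pw_bilinear w -> exists c : pt -> R,
          forall x, closure Om x -> w x = \sum_(P \in conforming_node) c P * psi P x,
        forall x, closure Om x -> \sum_(P \in conforming_node) psi P x = 1
      & forall P, conforming_node P ->
          forall i, box (tnth M i) `<=` supp (psi P) ->
            diam (supp (psi P)) <= CK * hK (tnth M i)].

Definition union_of (W : {set 'I_n}) : set pt :=
  [set x | exists2 i, i \in W & closure (box (tnth M i)) x].

Definition mside (i j : 'I_n) : set pt :=
  bd (box (tnth M i)) `&` bd (box (tnth M j)).

Definition mside_h (i j : 'I_n) : R := (hK (tnth M i) + hK (tnth M j)) / 2.

(* The norm of wt(h) [[v]] in L^2(sigma), where sigma consists of the mesh sides
   contained in the region union_of M W; each unordered pair of distinct elements is counted
   once, and empty or one-point intersections contribute zero. *)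
Definition jump_norm (W : {set 'I_n}) (wt : R -> R) (v : 'I_n -> pt -> R) : R :=
  Num.sqrt
    (\sum_(i < n) \sum_(j < n | (i < j)%N && `[< mside i j `<=` union_of W >])
       bd_int (tnth M i) (mside i j)
         (fun x => (wt (mside_h i j) * (v i x - v j x)) ^+ 2)).

End Meshes.

End FunctionSpaces.

(* Main.v *)
Require Import Defs.
From mathcomp Require Import all_boot all_order all_algebra.
From mathcomp Require Import all_classical all_reals all_analysis.
From mathcomp Require Import ring lra zify measurable_realfun.

Set Implicit Arguments.
Unset Strict Implicit.
Unset Printing Implicit Defensive.

Import Order.TTheory GRing.Theory Num.Theory.
Import numFieldNormedType.Exports.

Local Open Scope classical_set_scope.
Local Open Scope ring_scope.

(** The interpolant adds two corrections to [v] on each element. Tensor products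
    of one-dimensional boundary layers, attached to the corners, move the values
    at the nodes to common targets; then, on a side which is contained in a side
    of another element, the remaining jump is lifted with a layer normal to this
    side. The layer of degree [p] is a square of a Dirichlet kernel: its L^2 norm
    is O(1/p), and O(p) bounds its H^1 seminorm by Markov's inequality, while the
    values of a jump at the ends of a side cost a factor O(p) in terms of its
    L^2 norm.

    At a hanging node the target has to be the value of the corrected trace of
    the larger element, so the targets solve a linear system. The layer lies
    below the hat function; hence comparison with a quadratic barrier, strictly
    concave along the sides, bounds the solution by the jumps on the chains of
    hanging nodes issued from a node. Each such chain stays in the support of a
    single nodal function, so the K-mesh assumption makes the bound local.

    The result is continuous across the sides, thus in H^1 by Fubini's theorem.
    If [v] vanishes on the boundary, so does the interpolant; its compositions
    with smooth maps which are constant near the grid lines and equal to the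
    identity away from them are then test functions converging to it. *)

(** * Polynomials and boundary layers *)

(** The powers of [p] balance as follows. On a side of length h an inverse inequality bounds the
    value of a jump at an end by p h^(-1/2) times its L^2 norm, while the product of two layers has
    L^2 norm of order h p^(-2); a corner correction thus has size h^(1/2) p^(-1) relative to the
    jump. A lift, one layer of norm h^(1/2) p^(-1) times the jump, has the same size; hat functions
    in place of the layers would lose powers of p. The error on an element is a sum of eight tensor
    products of polynomials, and Markov's inequality turns each L^2 bound into one for the gradient
    at the price p^2 / h.

    The targets at hanging nodes are computed simultaneously because the ends of the side that
    carries a hanging node may hang themselves, a priori even in a circular way. Their bound must
    not depend on the number of nodes involved. The metric input of the maximum principle is that a
    chain stays within a distance comparable to the local mesh size and that a hanging node keeps
    such a distance from the ends of its side. *)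

Section PolynomialIntegral.
Variable R : realType.
Implicit Types (f g q : {poly R}) (a b : R).

(** Integrals are differences of formal primitives until [integral_horner] identifies them with
    Lebesgue integrals; this keeps the one-dimensional estimates free of measure theory. The
    constant term is a division by 0, hence 0. *)
Definition primp f : {poly R} := \poly_(i < (size f).+1) (f`_i.-1 / i%:R).

Definition intp f a b : R := (primp f).[b] - (primp f).[a].

Lemma coef_primp f i : (primp f)`_i = f`_i.-1 / i%:R.
Proof.
rewrite coef_poly; case: ltnP => // h; case: i h => [|i] //= h.
by rewrite nth_default ?mul0r // -ltnS.
Qed.

Lemma deriv_primp f : (primp f)^`() = f.
Proof.
apply/polyP => i; rewrite coef_deriv coef_primp /= -[_ *+ i.+1]mulr_natr divfK // pnatr_eq0.
Qed.

Lemma intpD f g a b : intp (f + g) a b = intp f a b + intp g a b.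
Proof.
have -> : intp (f + g) a b = (primp f + primp g).[b] - (primp f + primp g).[a].
  rewrite /intp; suff -> : primp (f + g) = primp f + primp g by [].
  by apply/polyP => i; rewrite coefD !coef_primp coefD mulrDl.
by rewrite !hornerD /intp; ring.
Qed.

Lemma intpZ c f a b : intp (c *: f) a b = c * intp f a b.
Proof.
rewrite /intp (_ : primp (c *: f) = c *: primp f) ?hornerZ ?mulrBr //.
by apply/polyP => i; rewrite coefZ !coef_primp coefZ mulrA.
Qed.

Lemma intpB f g a b : intp (f - g) a b = intp f a b - intp g a b.
Proof. by rewrite -scaleN1r intpD intpZ mulN1r. Qed.

Lemma intp0 a b : intp 0 a b = 0.
Proof. by rewrite -(scale0r 0) intpZ mul0r. Qed.

Lemma intp_split f a c b : intp f a b = intp f a c + intp f c b.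
Proof. by rewrite /intp; ring. Qed.

Lemma intp_ge0 f a b : a <= b ->
  (forall x, a <= x <= b -> 0 <= f.[x]) -> 0 <= intp f a b.
Proof.
move=> ab f0; rewrite /intp subr_ge0.
have d x : derive1 (horner (primp f)) x = f.[x].
  by rewrite derive1E (@derive_val _ _ _ _ _ _ _ (is_derive_poly _ _)) deriv_primp.
apply: (@ger0_derive1_ndecr _ _ a b) => //.
- by move=> x; rewrite in_itv /= => /andP[? ?]; rewrite d f0 // !ltW.
- apply: continuous_subspaceT => x; exact: continuous_horner.
Qed.

Lemma intp_le f g a b : a <= b ->
  (forall x, a <= x <= b -> f.[x] <= g.[x]) -> intp f a b <= intp g a b.
Proof.
move=> ab fg; rewrite -subr_ge0 -intpB intp_ge0 // => x /fg.
by rewrite hornerD hornerN subr_ge0.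
Qed.

Lemma intp_deriv f a b : intp f^`() a b = f.[b] - f.[a].
Proof.
rewrite /intp; have : (primp f^`() - f)^`() = 0.
  by rewrite derivB deriv_primp subrr.
move=> h; have [c hc] : exists c, primp f^`() - f = c%:P.
  exists (primp f^`() - f)`_0; apply/polyP => i; rewrite coefC.
  case: i => [|i] //=; have := congr1 (fun r : {poly R} => r`_i) h.
  rewrite coef_deriv coef0 => /eqP; rewrite mulrn_eq0 /= => /eqP //.
have -> : primp f^`() = f + c%:P by rewrite -hc addrC subrK.
by rewrite !hornerD !hornerC; ring.
Qed.

Lemma intp_sqr_ge0 f a b : a <= b -> 0 <= intp (f ^+ 2) a b.
Proof. by move=> ab; apply: intp_ge0 => // x _; rewrite horner_exp sqr_ge0. Qed.

Lemma intp_sub f a b c d : a <= c -> c <= d -> d <= b ->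
  intp (f ^+ 2) c d <= intp (f ^+ 2) a b.
Proof.
move=> ac cd db; rewrite (intp_split _ a c b) (intp_split _ c d b).
by rewrite addrCA lerDl addr_ge0 ?intp_sqr_ge0.
Qed.

Lemma intp_shift f a b l m : l != 0 ->
  intp (f \Po (l *: 'X + m%:P)) a b = intp f (l * a + m) (l * b + m) / l.
Proof.
move=> l0; set s := _ + _; have ds : s^`() = l%:P.
  by rewrite derivD derivZ derivX derivC addr0 alg_polyC.
have sE x : s.[x] = l * x + m by rewrite hornerD hornerZ hornerX hornerC.
have : intp (primp f \Po s)^`() a b = intp f (l * a + m) (l * b + m).
  by rewrite intp_deriv !horner_comp !sE.
by rewrite deriv_comp ds deriv_primp mulrC mul_polyC intpZ => <-; rewrite mulrC mulKf.
Qed.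

Definition ip f g := intp (f * g) 0 1.

Lemma ipC f g : ip f g = ip g f. Proof. by rewrite /ip mulrC. Qed.
Lemma ipDl f g h : ip (f + g) h = ip f h + ip g h.
Proof. by rewrite /ip mulrDl intpD. Qed.
Lemma ipBl f g h : ip (f - g) h = ip f h - ip g h.
Proof. by rewrite /ip mulrBl intpB. Qed.
Lemma ipZl c f g : ip (c *: f) g = c * ip f g.
Proof. by rewrite /ip -scalerAl intpZ. Qed.
Lemma ipDr f g h : ip h (f + g) = ip h f + ip h g.
Proof. by rewrite ipC ipDl !(ipC h). Qed.
Lemma ipZr c f g : ip f (c *: g) = c * ip f g.
Proof. by rewrite ipC ipZl ipC. Qed.
Lemma ip_ge0 f : 0 <= ip f f.
Proof. by rewrite /ip -expr2 intp_sqr_ge0. Qed.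

Lemma ip_gt0 f : f != 0 -> 0 < ip f f.
Proof.
move=> f0; rewrite lt_neqAle ip_ge0 andbT eq_sym; apply/eqP => h.
have z t : 0 <= t <= 1 -> (primp (f ^+ 2)).[t] = (primp (f ^+ 2)).[0].
  move=> /andP[t0 t1]; apply/eqP; rewrite -subr_eq0 -[X in X == 0]/(intp _ _ _).
  rewrite eq_le intp_sqr_ge0 // andbT.
  apply: le_trans (_ : intp (f ^+ 2) 0 1 <= _); first exact: intp_sub.
  by rewrite expr2 [intp _ _ _]h.
have : primp (f ^+ 2) - (primp (f ^+ 2)).[0]%:P = 0.
  set r := _ - _; apply/eqP; apply: contraT => r0.
  (* The numbers 1/(i+1) lie in [0, 1], where the primitive is constant; there are as many of them
     as the size of [r], one too many for roots of [r]. *)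
  have /= := @max_poly_roots _ r [seq (i.+1%:R)^-1 | i <- iota 0 (size r)] r0.
  rewrite size_map size_iota ltnn; apply.
    apply/allP => _ /mapP[i _ ->]; rewrite /root hornerD hornerN hornerC.
    by rewrite z ?subrr // invr_ge0 ler0n /= invf_le1 ?ltr0n // ler1n.
  rewrite map_inj_uniq ?iota_uniq // => i j /invr_inj /eqP.
  by rewrite eqr_nat => /eqP [].
move=> /(congr1 (@deriv R)); rewrite derivB deriv_primp derivC deriv0 subr0.
by move=> /eqP; rewrite expf_eq0 /= (negbTE f0).
Qed.

Lemma ip_cauchy f g : ip f g ^+ 2 <= ip f f * ip g g.
Proof.
have [->|g0] := eqVneq g 0.
  by rewrite /ip !mulr0 intp0 expr0n mulr0.
have gg := ip_gt0 g0; set c := ip f g / ip g g.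
have := ip_ge0 (f - c *: g).
rewrite ipBl ![ip _ (f - _)]ipC !ipBl !ipZl (ipC g f) ![ip f (c *: g)]ipC !ipZl ipZr (ipC g f) => h.
have cE : c * ip g g = ip f g by rewrite /c divfK ?gt_eqF.
have : 0 <= (ip f f - c * ip f g) by move: h; rewrite cE; lra.
by rewrite subr_ge0 /c mulrAC -expr2 ler_pdivrMr.
Qed.

(** Gram-Schmidt on the monomials: [q], the part of 'X^n orthogonal to lower degrees, is monic of
    degree [n], so subtracting a multiple of [q] from a test polynomial brings it back to the
    previous step. *)
Lemma proj_exists n f : exists2 g : {poly R}, (size g <= n)%N &
  forall h : {poly R}, (size h <= n)%N -> ip (f - g) h = 0.
Proof.
elim: n f => [|n IH] f.
  exists 0; rewrite ?size_poly0 // => h; rewrite leqn0 size_poly_eq0 => /eqP ->.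
  by rewrite ipC -(scale0r 0) ipZl mul0r.
have [g sg hg] := IH f; have [x sx hx] := IH 'X^n.
set q := 'X^n - x; have qm : q`_n = 1.
  by rewrite coefB coefXn eqxx nth_default ?subr0.
have q0 : q != 0.
  by apply/eqP => h; move: qm; rewrite h coef0 => /esym/eqP; rewrite oner_eq0.
have qq := ip_gt0 q0.
have sq : (size q <= n.+1)%N.
  rewrite (leq_trans (size_polyD _ _)) // size_polyN geq_max size_polyXn leqnn.
  exact: leqW.
set c := ip f q / ip q q; exists (g + c *: q).
  rewrite (leq_trans (size_polyD _ _)) // geq_max (leqW sg).
  by rewrite (leq_trans (size_scale_leq _ _)).
move=> h sh; set h' := h - h`_n *: q.
have sh' : (size h' <= n)%N.
  apply/leq_sizeP => j; rewrite leq_eqVlt => /orP[/eqP <-|nj].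
    by rewrite coefB coefZ qm mulr1 subrr.
  by rewrite coefB coefZ (nth_default _ (leq_trans sh nj)) (nth_default _ (leq_trans sq nj)) mulr0 subrr.
have -> : h = h' + h`_n *: q by rewrite subrK.
rewrite ipDr ipZr opprD addrA !(ipBl (f - g)) !ipZl hg // hx // mulr0 subr0 add0r.
rewrite ipBl (ipC g q) hx // subr0 /c mulfVK ?gt_eqF // subrr mulr0 //.
Qed.

(** [q] is a multiple of the Legendre polynomial of degree [n] on [0, 1]. The inverse inequalities
    below are inductions which add one Legendre component at a time. *)
Lemma ortho_split n f : (size f <= n.+1)%N -> exists (q g : {poly R}) (c : R),
  [/\ (size q <= n.+1)%N, (size g <= n)%N, f = c *: q + g,
      forall h : {poly R}, (size h <= n)%N -> ip q h = 0 &
      ip f f = c ^+ 2 * ip q q + ip g g].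
Proof.
move=> sf; have [x sx hx] := proj_exists n f.
exists (f - x), x, 1; split => //.
- rewrite (leq_trans (size_polyD _ _)) // size_polyN geq_max sf.
  exact: leqW.
- by rewrite scale1r subrK.
- have {1}-> : ip f f = ip ((f - x) + x) ((f - x) + x) by rewrite subrK.
  by rewrite expr1n mul1r ipDr !(ipDl (f - x) x) (ipC x (f - x)) !(hx x sx); ring.
Qed.

Lemma size_deriv_leq q n : (size q <= n.+1)%N -> (size q^`() <= n)%N.
Proof.
move=> sq; apply/leq_sizeP => j nj; rewrite coef_deriv nth_default ?mul0rn //.
by rewrite (leq_trans sq).
Qed.

(* Orthogonality applies because 'X * q^`() - n%:R *: q has degree less than n. *)
Lemma ortho_euler q n : (size q <= n.+1)%N ->
  (forall h : {poly R}, (size h <= n)%N -> ip q h = 0) -> ip q ('X * q^`()) = n%:R * ip q q.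
Proof.
move=> sq hq; have -> : 'X * q^`() = n%:R *: q + ('X * q^`() - n%:R *: q).
  by rewrite addrC subrK.
rewrite ipDr ipZr [ip q (_ - _)]hq ?addr0 //.
apply/leq_sizeP => j; rewrite leq_eqVlt => /orP[/eqP <-|nj]; last first.
  rewrite coefB coefXM coefZ coef_deriv (nth_default _ (leq_trans sq nj)) mulr0.
  by case: j nj => //= j nj; rewrite nth_default ?mul0rn ?subrr // (leq_trans sq).
rewrite coefB coefXM coefZ coef_deriv; case: (n) => [|m] /=.
  by rewrite mul0r subrr.
by rewrite -[q`_m.+1 *+ _]mulr_natl subrr.
Qed.

(** The normalization of Legendre polynomials at the end points. The derivative of 'X q^2 integrates
    to q(1)^2, with a cross term known from [ortho_euler]; the derivative of q^2 integrates to 0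
    because q' has lower degree. *)
Lemma ortho_end q n : (size q <= n.+1)%N ->
  (forall h : {poly R}, (size h <= n)%N -> ip q h = 0) ->
  q.[1] ^+ 2 = (2 * n + 1)%:R * ip q q /\ q.[0] ^+ 2 = (2 * n + 1)%:R * ip q q.
Proof.
move=> sq hq; have e := ortho_euler sq hq.
have z : ip q q^`() = 0 by rewrite hq // size_deriv_leq.
have h1 : q.[1] ^+ 2 = intp ('X * q ^+ 2)^`() 0 1.
  by rewrite intp_deriv !hornerM !hornerX !expr2; ring.
have h0 : q.[1] ^+ 2 - q.[0] ^+ 2 = intp (q ^+ 2)^`() 0 1.
  by rewrite intp_deriv !horner_exp.
have d2 : (q ^+ 2)^`() = 2 *: (q * q^`()).
  by rewrite expr2 derivM mulrC -mulr2n -scaler_nat mulrC.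
have h3 : q.[1] ^+ 2 = (2 * n + 1)%:R * ip q q.
  rewrite h1 derivM derivX mul1r d2 -scalerAr intpD intpZ.
  rewrite expr2 -[intp (q * q) _ _]/(ip q q).
  rewrite mulrCA -[intp (q * _) _ _]/(ip q _) e natrD natrM; ring.
split => //; move: h0; rewrite d2 intpZ -/(ip q q^`()) z mulr0.
by move=> /eqP; rewrite subr_eq0 => /eqP <-.
Qed.

(** The inductive step of the inverse inequalities. With [X] and [Y] the squared norms of two
    orthogonal components and [m] a cross term, this is (sqrt(al X) + sqrt(be Y))^2 <= (al + be)(X +
    Y): the constants of the components add up. *)
Lemma sqrD_split (al be X Y X' Y' m : R) : 0 <= al -> 0 <= be -> 0 <= X -> 0 <= Y ->
  m ^+ 2 <= X' * Y' -> 0 <= X' -> 0 <= Y' -> X' <= al * X -> Y' <= be * Y ->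
  X' + Y' + 2 * m <= (al + be) * (X + Y).
Proof.
move=> al0 be0 X0 Y0 hm X'0 Y'0 hX hY.
have h : m ^+ 2 <= (al * X) * (be * Y) by apply: (le_trans hm); apply: ler_pM.
have aY := mulr_ge0 al0 Y0; have bX := mulr_ge0 be0 X0.
suff : 2 * m <= al * Y + be * X by lra.
apply: ler_normlW; rewrite -ler_sqr ?nnegrE ?addr_ge0 ?normr_ge0 //.
rewrite real_normK ?num_real // exprMn.
have := sqr_ge0 (al * Y - be * X); nra.
Qed.

(** Each Legendre component contributes an odd number 2k + 1, and these sum up to n^2. *)
Lemma horner_end_le n f : (size f <= n)%N ->
  f.[0] ^+ 2 <= n%:R ^+ 2 * ip f f /\ f.[1] ^+ 2 <= n%:R ^+ 2 * ip f f.
Proof.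
elim: n f => [|n IH] f sf.
  move: sf; rewrite leqn0 size_poly_eq0 => /eqP ->.
  by rewrite !hornerE expr0n /= mul0r.
have [q [g [c [sq sg fE hq hf]]]] := ortho_split sf.
have [g0 g1] := IH g sg; have [q1 q0] := ortho_end sq hq.
have E : n.+1%:R ^+ 2 = (2 * n + 1)%:R + n%:R ^+ 2 :> R.
  by rewrite -natr1 natrD natrM; ring.
have gen u : q.[u] ^+ 2 = (2 * n + 1)%:R * ip q q ->
    g.[u] ^+ 2 <= n%:R ^+ 2 * ip g g -> f.[u] ^+ 2 <= n.+1%:R ^+ 2 * ip f f.
  move=> qu gu; rewrite hf {1}fE hornerD hornerZ E.
  have -> : (c * q.[u] + g.[u]) ^+ 2 = (c * q.[u]) ^+ 2 + g.[u] ^+ 2 + 2 * (c * q.[u] * g.[u]).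
    by ring.
  apply: sqrD_split => //; rewrite ?sqr_ge0 ?(mulr_ge0 (sqr_ge0 _) (ip_ge0 _)) ?ip_ge0 //.
  - by rewrite exprMn.
  - by rewrite exprMn qu; lra.
by split; apply: gen.
Qed.

(** Since [q] is orthogonal to its second derivative, the squared norm of q' is the boundary term of
    q q'. Its factors are estimated by [ortho_end] and, as q' has lower degree, by
    [horner_end_le]. *)
Lemma ortho_deriv q n : (size q <= n.+1)%N ->
  (forall h : {poly R}, (size h <= n)%N -> ip q h = 0) ->
  ip q^`() q^`() <= 4 * n%:R ^+ 2 * (2 * n + 1)%:R * ip q q.
Proof.
move=> sq hq; have sd := size_deriv_leq sq.
have [d0 d1] := horner_end_le sd; have [q1 q0] := ortho_end sq hq.
have E : ip q^`() q^`() = q.[1] * q^`().[1] - q.[0] * q^`().[0].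
  have := intp_deriv (q * q^`()) 0 1.
  rewrite !hornerM => <-; rewrite derivM intpD -/(ip q^`() q^`()) -/(ip q _).
  by rewrite [ip q _]hq ?addr0 // size_deriv_leq // leqW.
set X := ip q^`() q^`() in E d0 d1 *; set Q := ip q q in q1 q0 *.
have X0 : 0 <= X := ip_ge0 _.
have [->|X1] := eqVneq X 0.
  by rewrite !mulr_ge0 ?sqr_ge0 ?ip_ge0.
have {}X1 : 0 < X by rewrite lt_neqAle eq_sym X1.
rewrite -(ler_pM2r X1).
have b (u v : R) : u ^+ 2 = (2 * n + 1)%:R * Q -> v ^+ 2 <= n%:R ^+ 2 * X ->
   (u * v) ^+ 2 <= n%:R ^+ 2 * (2 * n + 1)%:R * Q * X.
  move=> hu hv; rewrite exprMn hu.
  have := ler_wpM2l (mulr_ge0 (ler0n R (2 * n + 1)) (ip_ge0 q)) hv; rewrite -/Q; nra.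
have b1 := b _ _ q1 d1; have b0 := b _ _ q0 d0.
set u := q.[1] * _ in b1 E; set w := q.[0] * _ in b0 E.
have : X * X = (u - w) ^+ 2 by rewrite -E expr2.
move=> ->; have := sqr_ge0 (u + w); nra.
Qed.

(** The increments of 12 n^4 dominate the constants 4 n^2 (2n + 1) of the Legendre components; 12 is
    not meant to be sharp. *)
Lemma markov01 n f : (size f <= n)%N -> ip f^`() f^`() <= 12 * n%:R ^+ 4 * ip f f.
Proof.
elim: n f => [|n IH] f sf.
  move: sf; rewrite leqn0 size_poly_eq0 => /eqP ->.
  by rewrite deriv0 -(scale0r 0) !ipZl !mul0r mulr0.
have [q [g [c [sq sg fE hq hf]]]] := ortho_split sf.
have hg := IH g sg; have hd := ortho_deriv sq hq.
apply: (@le_trans _ _ ((4 * n%:R ^+ 2 * (2 * n + 1)%:R + 12 * n%:R ^+ 4) * ip f f)).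
  rewrite hf {1 2}fE derivD derivZ ipDr !ipDl !ipZl !ipZr.
  have := @sqrD_split (4 * n%:R ^+ 2 * (2 * n + 1)%:R) (12 * n%:R ^+ 4)
    (c ^+ 2 * ip q q) (ip g g) (c ^+ 2 * ip q^`() q^`()) (ip g^`() g^`()) (c * ip q^`() g^`()).
  move=> h; apply: le_trans (h _ _ _ _ _ _ _ _ _) => //;
    rewrite ?(mulr_ge0 (sqr_ge0 _) (ip_ge0 _)) ?ip_ge0 //.
  - by rewrite (ipC g^`()); lra.
  - by rewrite exprMn -mulrA ler_wpM2l ?sqr_ge0 // ip_cauchy.
  - by rewrite mulrCA ler_wpM2l ?sqr_ge0.
rewrite ler_wpM2r ?ip_ge0 // -natr1 natrD natrM.
have : 0 <= n%:R :> R by []. 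
set x := n%:R : R => x0; have := mulr_ge0 x0 x0; have := mulr_ge0 x0 (mulr_ge0 x0 x0).
nra.
Qed.

Lemma intp_rescale f a b : a < b ->
  intp (f ^+ 2) a b = (b - a) * ip (f \Po ((b - a) *: 'X + a%:P)) (f \Po ((b - a) *: 'X + a%:P)).
Proof.
move=> ab; have l0 : b - a != 0 by rewrite subr_eq0 gt_eqF.
rewrite /ip -comp_polyM -expr2 intp_shift // mulr0 add0r mulr1 subrK.
by rewrite mulrC divfK.
Qed.

Lemma size_comp_aff f n (l m : R) : (size f <= n)%N ->
  (size (f \Po (l *: 'X + m%:P)) <= n)%N.
Proof.
move=> sf; apply: leq_trans sf; case: (eqVneq f 0) => [->|f0].
  by rewrite comp_poly0 size_poly0.
apply: (leq_trans (size_comp_poly_leq _ _)).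
have : (size (l *: 'X + m%:P)%R <= 2)%N.
  apply: (leq_trans (size_polyD _ _)); rewrite geq_max.
  rewrite (leq_trans (size_scale_leq _ _)) ?size_polyX //=.
  by rewrite (leq_trans (size_polyC_leq1 _)).
case: (size _) => [|[|[|]]] //= _; rewrite ?muln0 ?muln1 // ?prednK // ?size_poly_gt0 //.
Qed.

Lemma horner_sqr_le n f a b : (size f <= n)%N -> a < b ->
  f.[a] ^+ 2 <= n%:R ^+ 2 / (b - a) * intp (f ^+ 2) a b /\
  f.[b] ^+ 2 <= n%:R ^+ 2 / (b - a) * intp (f ^+ 2) a b.
Proof.
move=> sf ab; have l0 : b - a != 0 by rewrite subr_eq0 gt_eqF.
rewrite intp_rescale // mulrA divfK //.
have := horner_end_le (size_comp_aff (b - a) a sf).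
by rewrite !horner_comp !(hornerE, mulr0, mulr1, add0r, subrK).
Qed.

Lemma markov_le n f a b : (size f <= n)%N -> a < b ->
  intp (f^`() ^+ 2) a b <= 12 * n%:R ^+ 4 / (b - a) ^+ 2 * intp (f ^+ 2) a b.
Proof.
move=> sf ab; have l0 : b - a != 0 by rewrite subr_eq0 gt_eqF.
have l1 : 0 < b - a by rewrite subr_gt0.
rewrite !intp_rescale //; set s := _ + _.
have := markov01 (size_comp_aff (b - a) a sf).
rewrite deriv_comp -/s derivD derivZ derivX derivC addr0 alg_polyC.
rewrite mulrC mul_polyC ipZl ipZr => h.
rewrite mulrCA ler_pM2l // mulrAC ler_pdivlMr ?exprn_gt0 //.
by apply: le_trans h; rewrite mulrC expr2 mulrA.
Qed.

End PolynomialIntegral.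

(** * The boundary layer, from squares of Chebyshev polynomials *)

Section EndpointLayer.
Variable R : realType.

(** The Chebyshev polynomials of the second kind U_m and U_(m-1) at [c]; for c = cos a, U_m is
    sin((m+1)a) / sin a. *)
Fixpoint chebU (c : R) (m : nat) : R * R :=
  if m is m'.+1 then let: (u, w) := chebU c m' in (2 * c * u - w, u) else (1, 0).

Lemma chebU_quad c m :
  (chebU c m).1 ^+ 2 - 2 * c * (chebU c m).1 * (chebU c m).2 + (chebU c m).2 ^+ 2 = 1.
Proof.
elim: m => [|m /=]; first by rewrite /=; ring.
by case: (chebU c m) => u w /= h; rewrite -[RHS]h; ring.
Qed.

(** The first bound is sin^2 <= 1, read off the quadratic identity. For the second, [c * u - w] is
    the Chebyshev polynomial of the first kind of degree m + 1, bounded by 1, so that each step adds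
    at most 1. *)
Lemma chebU_bound c m : c ^+ 2 <= 1 ->
  (1 - c ^+ 2) * (chebU c m).1 ^+ 2 <= 1 /\ `|(chebU c m).1| <= m.+1%:R.
Proof.
move=> c1; split.
  have := chebU_quad c m; set u := _.1; set w := _.2 => h.
  have := sqr_ge0 (w - c * u); nra.
elim: m => [|m] /=; first by rewrite normr1.
have := chebU_quad c m; case: (chebU c m) => u w /= h IH.
have t1 : `|c * u - w| <= 1.
  have : (c * u - w) ^+ 2 <= 1.
    rewrite -h; have : 0 <= (1 - c ^+ 2) * u ^+ 2 by rewrite mulr_ge0 ?sqr_ge0 // subr_ge0.
    nra.
  by rewrite -real_normK ?num_real // -[X in _ <= X](expr1n R 2) ler_sqr ?nnegrE.
have c1' : `|c| <= 1.
  by move: c1; rewrite -real_normK ?num_real // -[X in _ <= X](expr1n R 2) ler_sqr ?nnegrE.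
have -> : 2 * c * u - w = c * u + (c * u - w) by ring.
rewrite (le_trans (ler_normD _ _)) // -[m.+2%:R]natr1 lerD // normrM.
by apply: le_trans IH; rewrite ler_piMl.
Qed.

(** By [chebU_quad] the squares of the U_m satisfy an affine recurrence with coefficient 2(2c^2 -
    1), which is 2(1 - 2t) for t = 1 - c^2. They are therefore polynomials in t of degree at most m,
    although c is a square root of 1 - t. *)
Fixpoint fejer (m : nat) : {poly R} * {poly R} :=
  if m is m'.+1 then let: (u, w) := fejer m' in
    ((2 *: (1 - 2 *: 'X)) * u - w + 2%:P, u) else (1, 0).

Lemma fejerE m c : (fejer m).1.[1 - c ^+ 2] = (chebU c m).1 ^+ 2 /\
  (fejer m).2.[1 - c ^+ 2] = (chebU c m).2 ^+ 2.
Proof.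
elim: m => [|m] /=; first by rewrite !hornerE expr1n expr0n.
have := chebU_quad c m; case: (fejer m) (chebU c m) => [u w] [x y] /= h [hu hw].
split => //; rewrite -polyC1 !(hornerD, hornerN, hornerM, hornerZ, hornerX, hornerC) hu hw; apply/eqP; rewrite -subr_eq0.
apply/eqP; transitivity (2 * (1 - (x ^+ 2 - 2 * c * x * y + y ^+ 2))); first by ring.
by rewrite h subrr mulr0.
Qed.

Lemma size_fejer m : (size (fejer m).1 <= m.+1)%N /\ (size (fejer m).2 <= m)%N.
Proof.
elim: m => [|m] /=; first by rewrite size_poly1 size_poly0.
case: (fejer m) => u w /= [su sw]; split => //.
have s2 : (size (2 *: (1 - 2 *: 'X) : {poly R})%R <= 2)%N.
  rewrite (leq_trans (size_scale_leq _ _)) // (leq_trans (size_polyD _ _)) //.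
  by rewrite geq_max size_poly1 /= size_polyN (leq_trans (size_scale_leq _ _)) ?size_polyX.
rewrite (leq_trans (size_polyD _ _)) // geq_max (leq_trans (size_polyC_leq1 _)) // andbT.
rewrite (leq_trans (size_polyD _ _)) // geq_max size_polyN.
rewrite (leq_trans sw) ?andbT; last by rewrite -addn2 leq_addr.
rewrite (leq_trans (size_polyMleq _ _)) //.
by rewrite -ltnS; case: (size _) s2 => [|[|[|]]] //= _; rewrite ?addSn ?add0n /= ?ltnS; lia.
Qed.

(* The square of the Dirichlet kernel of degree p, normalized and damped by
   1 - X so that it lies below the hat function 1 - X: it decays like (p^2 t)^-1. *)
Definition layer (p : nat) : {poly R} :=
  (p%:R ^+ 2)^-1 *: ((1 - 'X) * (fejer p.-1).1).

Lemma size_layer p : (0 < p)%N -> (size (layer p) <= p.+1)%N.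
Proof.
move=> p0; rewrite (leq_trans (size_scale_leq _ _)) // (leq_trans (size_polyMleq _ _)) //.
have := (size_fejer p.-1).1; rewrite prednK //.
have : (size (1 - 'X : {poly R})%R <= 2)%N.
  by rewrite (leq_trans (size_polyD _ _)) // size_polyN size_poly1 size_polyX.
lia.
Qed.

Lemma layerE p t : (0 < p)%N -> t <= 1 -> exists2 u : R,
  (layer p).[t] = (1 - t) * (u / p%:R) ^+ 2 &
  (0 <= t -> `|u| <= p%:R /\ t * u ^+ 2 <= 1) /\ (t = 0 -> u ^+ 2 = p%:R ^+ 2).
Proof.
move=> p0 t1; set c := Num.sqrt (1 - t).
have cE : c ^+ 2 = 1 - t by rewrite sqr_sqrtr // subr_ge0.
have tE : t = 1 - c ^+ 2 by rewrite cE; ring.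
exists (chebU c p.-1).1.
  have fE := (fejerE p.-1 c).1; rewrite -tE in fE.
  by rewrite /layer hornerZ hornerM fE hornerD hornerN hornerX -polyC1 hornerC exprMn exprVn; ring.
split=> [t0|t0].
  have c1 : c ^+ 2 <= 1 by rewrite cE; lra.
  by have [] := chebU_bound p.-1 c1; rewrite prednK // -tE.
have c1 : c = 1 by rewrite /c t0 subr0 sqrtr1.
rewrite c1 -(prednK p0) /=; suff -> : chebU 1 p.-1 = (p.-1.+1%:R, p.-1%:R) by [].
elim: (p.-1) => //= m ->; congr (_, _).
by rewrite -[m.+2%:R]natr1 -[m.+1%:R]natr1; ring.
Qed.

Lemma layer0 p : (0 < p)%N -> (layer p).[0] = 1.
Proof.
move=> p0; have [u -> [_ /(_ erefl) hu]] := layerE p0 ler01.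
by rewrite exprMn hu -exprMn divff ?pnatr_eq0 -?lt0n // expr1n subr0 mulr1.
Qed.

Lemma layer1 p : (layer p).[1] = 0.
Proof. by rewrite /layer hornerZ hornerM (_ : (1 - 'X).[1] = 0) ?mul0r ?mulr0 // !hornerE subrr. Qed.

Lemma layer_bound p t : (0 < p)%N -> 0 <= t <= 1 -> 0 <= (layer p).[t] <= 1 - t.
Proof.
move=> p0 /andP[t0 t1]; have [u -> [/(_ t0)[hu _] _]] := layerE p0 t1.
have p1 : 0 < p%:R :> R by rewrite ltr0n.
rewrite mulr_ge0 ?sqr_ge0 ?subr_ge0 //= ler_piMr ?subr_ge0 //.
by rewrite -real_normK ?num_real // exprn_ile1 // normrM normfV normr_nat ler_pdivrMr // mul1r.
Qed.

(** Times 1, the layer is at most 1 because |u| <= p; times p^2 t, it is at most 1 because t u^2 <=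
    1. *)
Lemma layer_sqr_le p t : (0 < p)%N -> 0 <= t <= 1 ->
  (layer p).[t] ^+ 2 * (1 + p%:R ^+ 2 * t) ^+ 2 <= 4.
Proof.
move=> p0 /andP[t0 t1]; have /andP[l0 l1] := layer_bound p0 (introT andP (conj t0 t1)).
have p1 : 0 < p%:R :> R by rewrite ltr0n.
have [u h [/(_ t0)[hu hu2] _]] := layerE p0 t1.
have : (layer p).[t] * (1 + p%:R ^+ 2 * t) <= 2.
  rewrite mulrDr mulr1 (_ : 2 = 1 + 1) // lerD //; first lra.
  rewrite h exprMn exprVn.
  have -> : (1 - t) * (u ^+ 2 * (p%:R ^+ 2)^-1) * (p%:R ^+ 2 * t) = (1 - t) * (t * u ^+ 2).
    by field; rewrite gt_eqF.
  have : 0 <= t * u ^+ 2 by rewrite mulr_ge0 ?sqr_ge0. 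
  nra.
rewrite -exprMn (_ : 4 = 2 ^+ 2); last by ring.
by rewrite ler_sqr ?nnegrE // mulr_ge0 // addr_ge0 // mulr_ge0 ?exprn_ge0.
Qed.

(** Comparison with 4 / (1 + p^2 t)^2, whose integral over [0, 1] is below 4 / p^2: the difference
    [G] of the two primitives is nondecreasing. *)
Lemma layer_ip p : (0 < p)%N -> ip (layer p) (layer p) <= 4 / p%:R ^+ 2.
Proof.
move=> p0; set k : R := p%:R ^+ 2.
have k0 : 0 < k by rewrite exprn_gt0 // ltr0n.
set F := primp (layer p * layer p).
pose G (t : R) := - (4 / k) * (1 + k * t)^-1 - F.[t].
have dG (t : R) : 0 <= t -> is_derive t (1:R) G (4 / (1 + k * t) ^+ 2 - (layer p).[t] ^+ 2).
  move=> t0; have n0 : 1 + k * t != 0 by rewrite gt_eqF // ltr_pwDl // mulr_ge0 // ltW.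
  have d1 : is_derive t (1 : R) (fun s => 1 + k * s) k.
    have -> : (fun s => 1 + k * s) = horner (1 + k *: 'X) :> (R -> R).
      by apply/funext => s; rewrite !hornerE.
    have := is_derive_poly (1 + k *: 'X) t.
    by rewrite derivD derivC add0r derivZ derivX hornerZ hornerC mulr1.
  have d2 := @is_deriveV R (fun s : R => 1 + k * s) t k 1 n0 d1.
  have d3 := is_derive_poly F t; rewrite deriv_primp hornerM in d3.
  have d4 := is_deriveB (is_deriveZ (- (4 / k)) d2) d3.
  apply: (is_derive_eq d4); rewrite /GRing.scale /= -expr2.
  by field; rewrite n0 gt_eqF.
have : G 0 <= G 1.
  apply: (@ger0_derive1_ndecr R G 0 1 _ _ _ 0 1 (lexx _) ler01 (lexx _)).
  - by move=> x; rewrite in_itv /= => /andP[x0 _]; have := dG x (ltW x0); case.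
  - move=> x; rewrite in_itv /= => /andP[x0 x1].
    rewrite derive1E (@derive_val _ _ _ _ _ _ _ (dG x (ltW x0))) subr_ge0.
    rewrite ler_pdivlMr; first by apply: layer_sqr_le => //; rewrite !ltW.
    by rewrite exprn_gt0 // ltr_pwDl // mulr_ge0 // ltW.
  - apply: derivable_within_continuous => x; rewrite in_itv /= => /andP[x0 _].
    by have := dG x x0; case.
rewrite /G /ip /intp -/F mulr0 addr0 invr1 !mulr1.
have : 0 <= (4 / k) * (1 + k)^-1 by rewrite mulr_ge0 ?invr_ge0 ?divr_ge0 // ?addr_ge0 // ltW.
lra.
Qed.

End EndpointLayer.

(** * Meshes with hanging nodes and the interpolation operator *)

Section Coordinates.
Variable T : Type.

(** A Boolean direction lets one statement serve both axes, [~~ d] being the other axis. *)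
Definition crd (d : bool) (x : T * T) : T := if d then x.2 else x.1.

Definition mk (d : bool) (a b : T) : T * T := if d then (b, a) else (a, b).

Lemma crd_mk d a b : crd d (mk d a b) = a. Proof. by case: d. Qed.
Lemma crdN_mk d a b : crd (~~ d) (mk d a b) = b. Proof. by case: d. Qed.
Lemma mkE d x : mk d (crd d x) (crd (~~ d) x) = x.
Proof. by case: d x => [] []. Qed.
Lemma mkN d a b : mk (~~ d) a b = mk d b a. Proof. by case: d. Qed.

Definition upd d (x : T * T) t := mk d t (crd (~~ d) x).

End Coordinates.

Definition crdE := (crd_mk, crdN_mk, negbK).

Lemma sum_pair (R : nmodType) d (F : bool * bool -> R) :
  \sum_c F c = \sum_e \sum_e' F (mk d e e').
Proof.
have -> : \sum_c F c = \sum_a \sum_b F (a, b).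
  by rewrite pair_big /=; apply: eq_bigr => -[].
by case: d => //; rewrite exchange_big.
Qed.

Section Mesh.
Variables (R : realType) (n : nat) (M : n.-tuple (rect R)).
Local Notation pt := (R * R)%type.
Implicit Types (i j k : 'I_n) (d e s : bool) (x y : pt) (q c : bool * bool).

Definition ext e d i : R := crd d (if e then (tnth M i).2 else (tnth M i).1).
Local Notation lo := (ext false).
Local Notation hi := (ext true).
Definition width d i : R := hi d i - lo d i.

Definition cl i x := [forall d, lo d i <= crd d x <= hi d i].

(* Points are located by germs: s is the direction of a germ of half-line at t,
   and hasq i x q says that the germ at x of the quadrant q lies in the element i.
   Each point then belongs to at most one element for each of the quadrants. *)
Definition inI s (l u t : R) := if s then l <= t < u else l < t <= u.

Definition hasq i x q := [forall d, inI (crd d q) (lo d i) (hi d i) (crd d x)].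

Definition vert i x := [forall d, (crd d x == lo d i) || (crd d x == hi d i)].

Definition node x := [exists i, vert i x].

Definition hang i x d :=
  ((crd d x == lo d i) || (crd d x == hi d i)) &&
  (lo (~~ d) i < crd (~~ d) x < hi (~~ d) i).

Record quad_mesh : Prop := QuadMesh {
  qm_lt : forall d i, lo d i < hi d i;
  qm_uniq : forall i j x q, hasq i x q -> hasq j x q -> i = j;
  qm_side : forall i j x d q, i != j -> hasq i x q ->
    hasq j x (upd d q (~~ crd d q)) ->
    (lo (~~ d) j <= lo (~~ d) i /\ hi (~~ d) i <= hi (~~ d) j) \/
    (lo (~~ d) i <= lo (~~ d) j /\ hi (~~ d) j <= hi (~~ d) i);
  qm_diag : forall i j x q, hasq i x q -> hasq j x (~~ q.1, ~~ q.2) ->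
    exists d k, hasq k x (upd d q (~~ crd d q)) }.

Hypothesis HM : quad_mesh.
Let lohi d i : lo d i < hi d i := qm_lt HM d i.

Lemma hasqP d i x q : reflect
  (inI (crd d q) (lo d i) (hi d i) (crd d x) /\
   inI (crd (~~ d) q) (lo (~~ d) i) (hi (~~ d) i) (crd (~~ d) x)) (hasq i x q).
Proof.
apply: (iffP forallP) => [h|[h h'] d']; first by split; apply: h.
by case: d d' h h' => [] [].
Qed.

Lemma clP d i x : reflect
  (lo d i <= crd d x <= hi d i /\ lo (~~ d) i <= crd (~~ d) x <= hi (~~ d) i) (cl i x).
Proof.
apply: (iffP forallP) => [h|[h h'] d']; first by split; apply: h.
by case: d d' h h' => [] [].
Qed.

Lemma inI_le s (l u t : R) : inI s l u t -> l <= t <= u.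
Proof. by case: s => /= /andP[h h']; rewrite ?h ?h' ltW. Qed.

Lemma hasq_cl i x q : hasq i x q -> cl i x.
Proof. by move=> /forallP h; apply/forallP => d; apply: (inI_le (h d)). Qed.

Lemma inI_ex (l u t : R) : l < u -> l <= t <= u -> exists s, inI s l u t.
Proof.
move=> lu /andP[lt tu]; case: (ltP t u) => h; first by exists true; rewrite /inI lt.
by exists false; rewrite /inI tu (lt_le_trans lu h).
Qed.

Lemma cl_hasq i x : cl i x -> exists q, hasq i x q.
Proof.
move=> /(clP false)[/(inI_ex (lohi _ _))[s hs] /(inI_ex (lohi _ _))[s' hs']].
by exists (s, s'); apply/(hasqP false).
Qed.

Lemma ext_le e d i : lo d i <= ext e d i <= hi d i.
Proof. by case: e; rewrite lexx /= ?andbT ltW. Qed.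

Lemma width_gt0 d i : 0 < width d i.
Proof. by rewrite subr_gt0. Qed.

Lemma onsideP d i x : reflect (exists e, crd d x = ext e d i)
  ((crd d x == lo d i) || (crd d x == hi d i)).
Proof.
apply: (iffP orP) => [[/eqP h|/eqP h]|[[] ->]]; rewrite ?eqxx; by [exists false|exists true|right|left].
Qed.

Lemma vertP i x : reflect (exists c, x = (ext c.1 false i, ext c.2 true i)) (vert i x).
Proof.
apply: (iffP forallP) => [h|[c ->] d]; last by case: d; case: c => [[] []] /=; rewrite eqxx ?orbT.
have /onsideP[e he] := h false; have /onsideP[e' he'] := h true.
by exists (e, e'); rewrite -he -he' /crd /=; case: (x).
Qed.

Lemma vert_mk i d e e' : vert i (mk d (ext e d i) (ext e' (~~ d) i)).
Proof.
apply/forallP => d'; apply/onsideP.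
by case: d d' => [] []; [exists e|exists e'|exists e'|exists e].
Qed.

Lemma vert_ex i x d : vert i x -> exists e e', x = mk d (ext e d i) (ext e' (~~ d) i).
Proof.
move=> /forallP h; have /onsideP[e he] := h d; have /onsideP[e' he'] := h (~~ d).
by exists e, e'; rewrite -he -he' mkE.
Qed.

Lemma vert_cl i x : vert i x -> cl i x.
Proof.
move=> /(vert_ex false)[e [e' ->]]; apply/(clP false); rewrite !crdE.
by split; apply: ext_le.
Qed.

Lemma node_mk i d e e' : node (mk d (ext e d i) (ext e' (~~ d) i)).
Proof. by apply/existsP; exists i; apply: vert_mk. Qed.

Lemma inI_side e d i : inI (~~ e) (lo d i) (hi d i) (ext e d i).
Proof. by have := lohi d i; case: e => /= h; rewrite h /= ?lexx. Qed.

Lemma inI_strict s (l u t : R) : l < t < u -> inI s l u t.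
Proof. by case: s => /= /andP[h h']; rewrite ?h ?h' ltW. Qed.

Lemma inI_ext s e d i : inI s (lo d i) (hi d i) (ext e d i) -> s = ~~ e.
Proof. by case: s e => [] [] //=; rewrite ltxx ?andbF. Qed.

Lemma hangP i x d : reflect (exists2 e, crd d x = ext e d i &
  lo (~~ d) i < crd (~~ d) x < hi (~~ d) i) (hang i x d).
Proof.
apply: (iffP andP) => [[/onsideP[e h] h']|[e h h']]; first by exists e.
by split => //; apply/onsideP; exists e.
Qed.

Lemma side_hasq i x d e q : crd d x = ext e d i ->
  lo (~~ d) i < crd (~~ d) x < hi (~~ d) i -> crd d q = ~~ e -> hasq i x q.
Proof.
move=> h h' hq; apply/(hasqP d); rewrite h hq inI_side; split => //.
exact: inI_strict.
Qed.

Lemma vert_hang i x d : vert i x -> ~~ hang i x d.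
Proof.
move=> /forallP h; apply/negP => /hangP[e _ /andP[h1 h2]].
by have /orP[] := h (~~ d) => /eqP h3; rewrite h3 ltxx in h1 h2.
Qed.

Lemma hang_uniq i j d d' x : node x -> hang i x d -> hang j x d' -> i = j /\ d = d'.
Proof.
move=> /existsP[k vk] Hi Hj; have /hangP[e he hs] := Hi; have /hangP[e' he' hs'] := Hj.
have [dd|dd] := eqVneq d d'; last first.
  have dE : d' = ~~ d by case: d d' dd {Hi Hj he hs he' hs'} => [] [].
  subst d'; have ij : i = j.
    apply: (@qm_uniq HM i j x (mk d (~~ e) (~~ e'))).
    - by apply: side_hasq he hs _; rewrite crdE.
    - by apply: side_hasq he' hs' _; rewrite crdE.
  subst j; rewrite negbK in hs'; move: hs'; rewrite he.
  by case: (e); rewrite ltxx ?andbF.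
subst d'; split => //; have [ee|ee] := eqVneq e e'.
  subst e'; apply: (@qm_uniq HM i j x (mk d (~~ e) true)).
  - by apply: side_hasq he hs _; rewrite crdE.
  - by apply: side_hasq he' hs' _; rewrite crdE.
have [q hq] := cl_hasq (vert_cl vk).
have [qe|qe] := eqVneq (crd d q) (~~ e).
  have ki := qm_uniq HM hq (side_hasq he hs qe).
  by have := vert_hang d vk; rewrite ki Hi.
have qe' : crd d q = ~~ e' by case: (crd d q) e e' ee qe {he he'} => [] [] [].
have kj := qm_uniq HM hq (side_hasq he' hs' qe').
by have := vert_hang d vk; rewrite kj Hj.
Qed.

Lemma cl_cases i x : cl i x ->
  [\/ vert i x, exists d, hang i x d | forall q, hasq i x q].
Proof.
move=> /(clP false)[/= /andP[a1 a2] /andP[b1 b2]].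
have A : ((crd false x == lo false i) || (crd false x == hi false i)) \/ (lo false i < crd false x < hi false i).
  by case: eqVneq => [|h]; [left|case: eqVneq => [|h']; [left|right; rewrite !lt_neqAle a1 a2 eq_sym h h']].
have B : ((crd true x == lo true i) || (crd true x == hi true i)) \/ (lo true i < crd true x < hi true i).
  by case: eqVneq => [|h]; [left|case: eqVneq => [|h']; [left|right; rewrite !lt_neqAle b1 b2 eq_sym h h']].
case: A B => [A|A] [B|B].
- by constructor 1; apply/forallP => [] [].
- by constructor 2; exists false; rewrite /hang A.
- by constructor 2; exists true; rewrite /hang B.
- by constructor 3 => q; apply/(hasqP false); split; apply: inI_strict.
Qed.

Lemma node_cl i x : node x -> cl i x -> vert i x \/ exists d, hang i x d.
Proof.
move=> /existsP[k vk] /cl_cases[|h|h]; [by left|by right|left].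
by have [q hq] := cl_hasq (vert_cl vk); rewrite (qm_uniq HM (h q) hq).
Qed.

(* The jump across a side is removed from the element with the smaller side; the
   order of the indices breaks the ties. *)
Definition dom i d e j := [&& i != j, ext e d i == ext (~~ e) d j,
  lo (~~ d) j <= lo (~~ d) i, hi (~~ d) i <= hi (~~ d) j &
  (lo (~~ d) j != lo (~~ d) i) || (hi (~~ d) i != hi (~~ d) j) || (j < i)%N].

Lemma dom_hasq i d e j x q : dom i d e j -> crd d x = ext e d i ->
  lo (~~ d) i < crd (~~ d) x < hi (~~ d) i -> crd d q = e -> hasq j x q.
Proof.
move=> /and5P[_ /eqP h hl hh _] he /andP[h1 h2] hq.
apply: (@side_hasq _ _ d (~~ e)); rewrite ?he ?negbK //.
by rewrite (le_lt_trans hl) // (lt_le_trans h2).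
Qed.

Lemma dom_cl i d e j y : dom i d e j -> cl i y -> crd d y = ext e d i -> cl j y.
Proof.
move=> /and5P[_ /eqP h hl hh _] /(clP d)[_ /andP[h1 h2]] he; apply/(clP d).
by rewrite he h ext_le (le_trans hl) // (le_trans h2).
Qed.

Section Operator.
Variable Phi : R -> R.
Hypotheses (Phi0 : Phi 0 = 1) (Phi1 : Phi 1 = 0).

Definition PhiC i d e t := Phi ((t - ext e d i) / (ext (~~ e) d i - ext e d i)).

Definition PhiV i c x := PhiC i false c.1 x.1 * PhiC i true c.2 x.2.

Definition corner i c : pt := (ext c.1 false i, ext c.2 true i).

Lemma PhiC_on i d e : PhiC i d e (ext e d i) = 1.
Proof. by rewrite /PhiC subrr mul0r. Qed.

Lemma PhiC_off i d e : PhiC i d e (ext (~~ e) d i) = 0.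
Proof.
rewrite /PhiC divff // subr_eq0; have := lohi d i.
by case: e => /= h; [rewrite lt_eqF|rewrite gt_eqF].
Qed.

Lemma PhiC_ext i d e e' : PhiC i d e (ext e' d i) = (e == e')%:R.
Proof.
case: eqVneq => [->|h]; first by rewrite PhiC_on.
have -> : e' = ~~ e by case: e e' h => [] [].
by rewrite PhiC_off.
Qed.

Lemma PhiV_mk i d e e' x :
  PhiV i (mk d e e') x = PhiC i d e (crd d x) * PhiC i (~~ d) e' (crd (~~ d) x).
Proof. by case: d; rewrite /PhiV //= mulrC. Qed.

Lemma corner_mk i d e e' : corner i (mk d e e') = mk d (ext e d i) (ext e' (~~ d) i).
Proof. by case: d. Qed.

Section Values.
Variables (tgt : pt -> R) (v : 'I_n -> pt -> R).

Definition vc i x := v i x +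
  \sum_c (tgt (corner i c) - v i (corner i c)) * PhiV i c x.

(** Only the corners on the side contribute, because the layers attached to the opposite side vanish
    here. *)
Lemma vc_side i d e x : crd d x = ext e d i -> vc i x = v i x +
  \sum_e' (tgt (upd (~~ d) x (ext e' (~~ d) i)) - v i (upd (~~ d) x (ext e' (~~ d) i))) *
     PhiC i (~~ d) e' (crd (~~ d) x).
Proof.
move=> he; rewrite /vc (sum_pair d) (bigD1 e) //= [X in _ + (_ + X)]big1 ?addr0.
  congr (_ + _); apply: eq_bigr => e' _.
  by rewrite PhiV_mk corner_mk he PhiC_on mul1r /upd negbK mkN he.
move=> e' ee; apply: big1 => e'' _.
by rewrite PhiV_mk he PhiC_ext (negbTE ee) mul0r mulr0.
Qed.

Lemma vc_vert i x : vert i x -> vc i x = tgt x.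
Proof.
move=> /(vert_ex false)[e [e' ->]]; set y := mk _ _ _.
rewrite (@vc_side i false e) ?crdE // (bigD1 e') //= big1 => [|e'' ee].
  by rewrite PhiC_on mulr1 addr0 addrC subrK.
by rewrite PhiC_ext (negbTE ee) mulr0.
Qed.

Definition balanced := forall i x d, node x -> hang i x d -> vc i x = tgt x.

Hypothesis bal : balanced.

Lemma vc_node i x : node x -> cl i x -> vc i x = tgt x.
Proof. by move=> nx /(node_cl nx)[/vc_vert //|[d /(bal nx)]]. Qed.

(** The jump at the foot of [x] on the side is carried inwards unchanged and damped by the layer. A
    side contained in a side of a neighbour has only one such neighbour, so [pick] involves no
    choice; [interp_dom] checks this. *)
Definition lift i d e x := if [pick j | dom i d e j] is Some j then
  let y := upd d x (ext e d i) in (vc j y - vc i y) * PhiC i d e (crd d x) else 0.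

Definition interp i x := vc i x + \sum_d \sum_e lift i d e x.

Lemma upd_cl i d e x : cl i x -> cl i (upd d x (ext e d i)).
Proof. by move=> /(clP d)[_ h]; apply/(clP d); rewrite /upd !crdE ext_le. Qed.

(** This is what the nodal correction is for: the traces agree at the nodes, so the jump to be
    lifted vanishes at the ends of the side. A lift is then zero on the perpendicular sides, and by
    [lift_off] on the opposite one; lifts do not interfere. *)
Lemma lift_node i d e x : cl i x -> node (upd d x (ext e d i)) -> lift i d e x = 0.
Proof.
move=> ci ny; rewrite /lift; case: pickP => // j dj /=.
have ciy := upd_cl d e ci; have cjy := dom_cl dj ciy (crd_mk _ _ _).
by rewrite !vc_node // subrr mul0r.
Qed.

Lemma lift_off i d e x : crd d x = ext (~~ e) d i -> lift i d e x = 0.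
Proof. by move=> h; rewrite /lift h; case: pickP => // j _; rewrite PhiC_off mulr0. Qed.

Lemma interp_side i x d e : cl i x -> crd d x = ext e d i ->
  interp i x = vc i x + lift i d e x.
Proof.
move=> ci he; rewrite /interp; congr (_ + _).
rewrite (bigD1 d) //= [X in _ + X](_ : _ = 0); last first.
  apply: big1 => d' dd; apply: big1 => e' _; apply: lift_node => //.
  have -> : d' = ~~ d by case: d d' dd {he} => [] [].
  by rewrite /upd negbK mkN he node_mk.
rewrite addr0 (bigD1 e) //= big1 ?addr0 // => e' ee; apply: lift_off.
by rewrite he; congr (ext _ _ _); case: e e' ee {he} => [] [].
Qed.

Lemma upd_id d x t : crd d x = t -> upd d x t = x.
Proof. by move=> <-; rewrite /upd mkE. Qed.

Lemma interp_node i x : node x -> cl i x -> interp i x = tgt x.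
Proof.
move=> nx ci; have [d [e he]] : exists d e, crd d x = ext e d i.
  have [vi|[d /hangP[e he _]]] := node_cl nx ci; last by exists d, e.
  by exists false; have [e [e' ->]] := vert_ex false vi; exists e; rewrite crdE.
by rewrite (interp_side ci he) vc_node // lift_node ?addr0 // upd_id.
Qed.

(** The lift of [i] restores the trace of [j], provided that [j] is not lifted there. Otherwise [j]
    would be dominated by [i], the sides would coincide and the tie-breaking indices would
    contradict each other. *)
Lemma interp_dom i j x d e : dom i d e j -> crd d x = ext e d i ->
  lo (~~ d) i < crd (~~ d) x < hi (~~ d) i -> interp i x = interp j x.
Proof.
move=> dj he hs; have /andP[hs1 hs2] := hs; have := dj => /and5P[ij /eqP exj hl hh tie].
have ci : cl i x by apply/(clP d); rewrite he ext_le !ltW.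
have cj : cl j x := dom_cl dj ci he.
have hej : crd d x = ext (~~ e) d j by rewrite he.
rewrite (interp_side ci he) (interp_side cj hej) /lift.
case: pickP => [k dk /=|/(_ j)]; last by rewrite dj.
have -> : k = j.
  by apply: (qm_uniq HM (q := mk d e true)); apply: dom_hasq he hs _; rewrite ?crdE.
rewrite upd_id // he PhiC_on mulr1 addrC subrK.
case: pickP => [l dl /=|_]; last by rewrite addr0.
have hsj : lo (~~ d) j < crd (~~ d) x < hi (~~ d) j.
  by rewrite (le_lt_trans hl) // (lt_le_trans hs2).
have li : l = i.
  apply: (qm_uniq HM (q := mk d (~~ e) true)); last by apply: side_hasq he hs _; rewrite crdE.
  by apply: (dom_hasq dl hej hsj); rewrite crdE.
subst l; move: dl => /and5P[_ _ hl' hh' tie'].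
have E1 : lo (~~ d) i = lo (~~ d) j by apply/le_anti; rewrite hl'.
have E2 : hi (~~ d) i = hi (~~ d) j by apply/le_anti; rewrite hh hh'.
move: tie tie'; rewrite E1 E2 !eqxx /= => h1 h2.
by have := ltn_trans h1 h2; rewrite ltnn.
Qed.

(** A common point of two distinct elements which is not a node lies inside a side of each. The
    germs only allow opposite normals, the sides are nested by [qm_side], and [interp_dom] applies
    in one of the two orders. *)
Lemma interp_conform i j x : cl i x -> cl j x -> interp i x = interp j x.
Proof.
move=> ci cj; have [nx|nx] := boolP (node x); first by rewrite !interp_node.
have [->//|ij] := eqVneq i j.
have H k l : cl k x -> cl l x -> k != l -> exists2 d, hang k x d & forall q, hasq l x q -> ~~ hasq k x q.
  move=> ck cl' kl; have U q : hasq l x q -> ~~ hasq k x q.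
    by move=> h1; apply/negP => h2; rewrite (qm_uniq HM h1 h2) eqxx in kl.
  have [vk|[d h]|h] := cl_cases ck; last 2 first.
  - by exists d.
  - by have [q hq] := cl_hasq cl'; have := U q hq; rewrite h.
  - by case/negP: nx; apply/existsP; exists k.
have [d Hi U] := H i j ci cj ij.
rewrite eq_sym in ij; have [d' Hj _] := H j i cj ci ij; rewrite eq_sym in ij.
have /hangP[e he hs] := Hi; have /hangP[e' he' hs'] := Hj.
have dd : d' = d.
  apply/eqP; apply: contraT => dd; have dE : d' = ~~ d by case: d d' dd {Hi Hj he hs he' hs'} => [] [].
  subst d'; have := U (mk d (~~ e) (~~ e')).
  rewrite (side_hasq he hs) ?crdE // (side_hasq he' hs') ?crdE //.
  by move=> /(_ isT).
subst d'; have ee : e' = ~~ e.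
  apply/eqP; apply: contraT => ee; have eE : e' = e by case: e e' ee {he he'} => [] [].
  subst e'; have := U (mk d (~~ e) true).
  rewrite (side_hasq he hs) ?crdE // (side_hasq he' hs') ?crdE //.
  by move=> /(_ isT).
subst e'; have exE : ext e d i = ext (~~ e) d j by rewrite -he he'.
have hi' : hasq i x (mk d (~~ e) true) by apply: side_hasq he hs _; rewrite crdE.
have hj' : hasq j x (upd d (mk d (~~ e) true) (~~ crd d (mk d (~~ e) true))).
  by apply: side_hasq he' hs' _; rewrite /upd !crdE.
have [dij|ndij] := boolP (dom i d e j); first exact: interp_dom dij he hs.
have [dji|ndji] := boolP (dom j d (~~ e) i); first by rewrite (interp_dom dji he' hs').
exfalso; move: ndij ndji; rewrite /dom negbK exE eqxx ij [j == i]eq_sym ij /=.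
have [[-> ->]|[-> ->]] := qm_side HM ij hi' hj' => /=.
  rewrite !negb_or !negbK => /andP[/andP[/eqP-> /eqP->]]; rewrite !lexx !eqxx /=.
  by rewrite -!leqNgt => h1 h2; move/eqP: ij; apply; apply/val_inj/eqP; rewrite eqn_leq h1 h2.
move=> h; rewrite !negb_or !negbK => /andP[/andP[/eqP E1 /eqP E2]]; move: h.
rewrite E1 E2 !lexx !eqxx /= -!leqNgt => h1 h2.
by move/eqP: ij; apply; apply/val_inj/eqP; rewrite eqn_leq h1 h2.
Qed.

End Values.
End Operator.
End Mesh.

(** * The linear system for the targets *)

Section LinearSystem.
Variables (R : fieldType) (T : eqType) (S : seq T) (A : T -> T -> R).
Hypothesis uS : uniq S.

(** In finite dimension uniqueness gives existence. Linearity of the solution in the data is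
    recorded because the interpolation operator inherits it. *)
Lemma solve_linear :
  (forall f : T -> R, (forall x, x \in S -> f x = \sum_(y <- S) A x y * f y) ->
     forall x, x \in S -> f x = 0) ->
  exists sol : (T -> R) -> T -> R,
    (forall b x, x \in S -> sol b x = b x + \sum_(y <- S) A x y * sol b y) /\
    (forall a b b' x, sol (fun y => a * b y + b' y) x = a * sol b x + sol b' x).
Proof.
move=> inj; pose pnt := tnth (in_tuple S).
(* The matrix is transposed because the unknowns form a row vector; [get] takes the value 0 outside
   [S]. *)
pose B := 1%:M - \matrix_(k < size S, l < size S) A (pnt l) (pnt k).
pose get (r : 'rV[R]_(size S)) x := oapp (r 0) 0 (insub (index x S) : option 'I_(size S)).
have getE r k : get r (pnt k) = r 0 k.
  rewrite /get; have -> : index (pnt k) S = k.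
    have x0 : T := pnt k; rewrite /pnt (tnth_nth x0) /= index_uniq //.
  by rewrite valK.
have pntP x : x \in S -> exists k, x = pnt k.
  by move=> /(tnthP (in_tuple S))[k ->]; exists k.
have mulE (r : 'rV_(size S)) k :
    (r *m B) 0 k = r 0 k - \sum_(y <- S) A (pnt k) y * get r y.
  rewrite mulmxBr mulmx1 !mxE; congr (_ - _).
  rewrite [RHS]big_tnth; apply: eq_bigr => l _; rewrite !mxE mulrC.
  by rewrite -[X in get r X]/(pnt l) getE.
have uB : B \in unitmx.
  rewrite -row_free_unit; apply/inj_row_free => r rB; apply/rowP => k.
  rewrite mxE -getE; apply: inj; last by rewrite /pnt mem_tnth.
  move=> x /pntP[l ->]; have := mulE r l; rewrite rB mxE => /esym/eqP.
  by rewrite subr_eq0 getE => /eqP.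
exists (fun b => get ((\row_k b (pnt k)) *m invmx B)); split=> [b x /pntP[k ->]|a b b' x].
  rewrite getE; have := mulE ((\row_k b (pnt k)) *m invmx B) k.
  by rewrite mulmxKV // mxE => ->; rewrite subrK.
rewrite (_ : \row_k _ = a *: \row_k b (pnt k) + \row_k b' (pnt k)); last first.
  by apply/rowP => k; rewrite !mxE.
rewrite mulmxDl -scalemxAl /get; case: insub => [k|] /=; first by rewrite !mxE.
by rewrite mulr0 addr0.
Qed.

End LinearSystem.

Lemma seq_argmax (R : realDomainType) (T : eqType) (S : seq T) (f : T -> R) :
  S != [::] -> exists2 x, x \in S & forall y, y \in S -> f y <= f x.
Proof.
elim: S => // a S IH _; have [->|S0] := eqVneq S [::].
  by exists a; rewrite ?mem_head // => y; rewrite inE => /eqP ->.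
have [x xS hx] := IH S0; case: (leP (f a) (f x)) => h.
  by exists x => [|y]; rewrite inE ?xS ?orbT // => /orP[/eqP ->|/hx].
exists a => [|y]; first exact: mem_head.
by rewrite inE => /orP[/eqP ->|/hx/le_trans] //; apply; apply: ltW.
Qed.

Section Targets.
Variables (R : realType) (n : nat) (M : n.-tuple (rect R)).
Local Notation pt := (R * R)%type.
Implicit Types (i j k : 'I_n) (d e s : bool) (x y : pt) (q c : bool * bool).
Local Notation ext := (ext M).
Local Notation lo := (ext false).
Local Notation hi := (ext true).
Local Notation hasq := (hasq M).
Local Notation cl := (cl M).
Local Notation node := (node M).
Local Notation hang := (hang M).
Local Notation width := (width M).

Definition endp i d e y : pt := upd (~~ d) y (ext e (~~ d) i).

(** A chain of hanging nodes: each step leads to an end of the side in which the present node hangs,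
    that is, to a node whose target enters the equation at the present one. *)
Inductive reach x : pt -> Prop :=
| reach0 : reach x x
| reachS y i d e : reach x y -> node y -> hang i y d -> reach x (endp i d e y).

(** The metric content of the K-mesh assumption, derived in [graded_kmesh]. By [gr_cover] no
    quadrant is missing at a hanging node, so these nodes avoid the boundary of the domain. *)
Record graded (C : R) : Prop := Graded {
  gr_touch : forall i j x d d', cl i x -> cl j x -> width d i <= C * width d' j;
  gr_reach : forall i j x y d d', node x -> reach x y -> cl i x -> cl j y ->
    width d i <= C * width d' j /\ width d j <= C * width d' i;
  gr_dist : forall i x y d d', node x -> reach x y -> cl i x ->
    `|crd d y - crd d x| <= C * width d' i;
  gr_cover : forall i x d q, node x -> hang i x d -> exists k, hasq k x q }.

Hypothesis HM : quad_mesh M.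
Variable C : R.
Hypothesis HG : graded C.
Variable Phi : R -> R.
Hypothesis Phi_bound : forall t, 0 <= t <= 1 -> 0 <= Phi t <= 1 - t.
Hypotheses (Phi0 : Phi 0 = 1).
Local Notation PhiC := (PhiC M Phi).

Lemma PhiC_bound i d e t : lo d i <= t <= hi d i ->
  0 <= PhiC i d e t <= (t - ext (~~ e) d i) / (ext e d i - ext (~~ e) d i).
Proof.
move=> /andP[t0 t1]; have l := qm_lt HM d i; rewrite /PhiC.
set a := ext e d i; set b := ext (~~ e) d i.
have ab : b - a != 0 by rewrite /a /b subr_eq0; case: (e) => /=; [rewrite lt_eqF|rewrite gt_eqF].
have h : 0 <= (t - a) / (b - a) <= 1.
  rewrite /a /b; case: (e) => /=.
    by rewrite -mulrNN -invrN !opprB divr_ge0 ?subr_ge0 ?(ltW l) //= ler_pdivrMr ?subr_gt0 // mul1r lerD2l lerN2.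
  by rewrite divr_ge0 ?subr_ge0 ?(ltW l) //= ler_pdivrMr ?subr_gt0 // mul1r lerD2r.
have /andP[p0 p1] := Phi_bound h; rewrite p0 /=; apply: le_trans p1 _.
rewrite le_eqVlt; apply/orP; left; apply/eqP; field.
by rewrite ab -opprB oppr_eq0 ab.
Qed.

Lemma hang_cl i x d : hang i x d -> cl i x.
Proof.
move=> /hangP[e he /andP[h1 h2]]; apply/(clP M d); rewrite he (ext_le HM) !ltW //.
Qed.

Lemma endp_node i d e y : hang i y d -> node (endp i d e y).
Proof.
move=> /hangP[e' he _]; rewrite /endp /upd negbK mkN he.
exact: node_mk.
Qed.

Lemma endp_cl i d e y : hang i y d -> cl i (endp i d e y).
Proof. by move=> /hang_cl; apply: (upd_cl HM). Qed.

Lemma reach_node x y : node x -> reach x y -> node y.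
Proof. by move=> nx; elim=> // z i d e _ _ _; apply: endp_node. Qed.

(* The elements on the other side have a vertex at x, hence sides contained in
   one of the two parts into which x cuts the side of i. *)
Lemma hang_gap i x d e : node x -> hang i x d -> exists2 k, cl k x &
  width (~~ d) k <= `|ext e (~~ d) i - crd (~~ d) x|.
Proof.
move=> nx hx; have /hangP[e' he hs] := hx; have /andP[s1 s2] := hs.
have [k hk] := gr_cover HG (mk d e' e) nx hx; exists k; first exact: hasq_cl hk.
have ik : i != k.
  apply/eqP => E; subst k; move/(hasqP M d): hk; rewrite !crdE he => -[h _].
  by have := inI_ext h; case: (e').
have hi' : hasq i x (upd d (mk d e' e) (~~ crd d (mk d e' e))).
  by apply: (side_hasq HM he hs); rewrite /upd !crdE.
rewrite eq_sym in ik.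
have /(hasqP M d)[_] := hk; rewrite !crdE => hq.
have vk : crd (~~ d) x = ext (~~ e) (~~ d) k.
  have [vk|[d' hd]] := node_cl HM nx (hasq_cl hk); last first.
    by have [ki _] := hang_uniq HM nx hd hx; rewrite ki eqxx in ik.
  move/forallP: vk => /(_ (~~ d)) /orP[]/eqP h; rewrite h in hq *.
    by have := inI_ext hq => ->; rewrite negbK.
  by have := inI_ext hq => ->; rewrite negbK.
have W := width_gt0 HM (~~ d) k; rewrite /width in W *.
have [[a b]|[a b]] := qm_side HM ik hk hi'; last first.
  case: (e) vk => /= vk; [have := lt_le_trans s2 b|have := le_lt_trans a s1].
    by move=> h; exfalso; move: a; rewrite -vk leNgt s1.
  by move=> h; exfalso; move: b; rewrite -vk leNgt s2.
rewrite vk in s1 s2 *; case: (e) s1 s2 => /= s1 s2.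
  by rewrite ger0_norm ?subr_ge0 ?(ltW s2) // lerD2r.
by rewrite distrC ger0_norm ?subr_ge0 ?(ltW s1) // lerD2l lerN2.
Qed.

(* A maximum principle: the barrier g is quadratic and drops by at least 1 from
   a hanging node to the interpolation of the values at the ends of its side. *)
Lemma system_bound (e : pt -> R) (D : R) x0 : node x0 -> 0 <= D ->
  (forall y, reach x0 y -> e y = 0 \/ exists i d, hang i y d /\
     `|e y| <= \sum_b `|e (endp i d b y)| * PhiC i (~~ d) b (crd (~~ d) y) + D) ->
  `|e x0| <= (1 + 2 * C ^+ 4) * D.
Proof.
move=> nx0 D0 He; have /existsP[i0 /(vert_cl HM) ci0] := nx0.
set w := width false i0; have w0 : 0 < w := width_gt0 HM _ _.
have C0 : 0 < C.
  by have := gr_touch HG false false ci0 ci0; rewrite -/w; case: ltP => // h; nra.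
(* Chosen so that [K * (w / C) ^+ 2] is 1, where [w / C] bounds the distance of a hanging node to
   the ends of its side from below ([gap]). Along the chain, [g] stays between 1 and
   [1 + 2 * C ^+ 4]. *)
pose K := (C / w) ^+ 2.
have K0 : 0 <= K := sqr_ge0 _.
have KE : K * (C * w) ^+ 2 = C ^+ 4.
  by rewrite /K; field; rewrite gt_eqF.
pose g y := 1 + K * (2 * (C * w) ^+ 2 - (crd false y - crd false x0) ^+ 2 - (crd true y - crd true x0) ^+ 2).
have g1 y : reach x0 y -> 1 <= g y.
  move=> ry; rewrite lerDl mulr_ge0 //.
  have B d : (crd d y - crd d x0) ^+ 2 <= (C * w) ^+ 2.
    rewrite -real_normK ?num_real // ler_sqr ?nnegrE ?mulr_ge0 ?(ltW C0) ?(ltW w0) //.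
    exact: (gr_dist HG d false nx0 ry ci0).
  by have := B false; have := B true; lra.
pose S := [seq y <- [seq (corner M p.1 p.2) | p : 'I_n * (bool * bool)] | `[< reach x0 y >]].
have SP y : reach x0 y -> y \in S.
  move=> ry; rewrite mem_filter asboolT //=.
  have /existsP[i /vertP[c hc]] := reach_node nx0 ry.
  by apply/mapP; exists (i, c); rewrite ?mem_enum.
have S0 : S != [::] by apply/eqP => h; have := SP _ (reach0 x0); rewrite h.
(* [m * g] dominates |e| along the chain and touches it at [y]; the drop of [g] at [y] then forces
   [m <= D]. *)
have [y yS ymax] := @seq_argmax _ _ S (fun y => `|e y| / g y) S0.
have ry : reach x0 y by move: yS; rewrite mem_filter => /andP[/asboolP].
set m := `|e y| / g y in ymax.
have m0 : 0 <= m by rewrite divr_ge0 // (le_trans ler01) ?g1.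
have em z : reach x0 z -> `|e z| <= m * g z.
  move=> rz; have := ymax z (SP z rz); rewrite ler_pdivrMr //.
  by rewrite (lt_le_trans ltr01) ?g1.
suff mD : m <= D.
  apply: le_trans (em _ (reach0 x0)) _; rewrite mulrC ler_pM //; last first.
    by rewrite /g !subrr expr0n /= !subr0 -KE; lra.
  by rewrite (le_trans ler01) // g1 //; apply: reach0.
have [ey|[i [d [hy hle]]]] := He y ry; first by rewrite /m ey normr0 mul0r.
have ny := reach_node nx0 ry.
have /hangP[_ _ /andP[s1 s2]] := hy.
have gap b : w / C <= `|ext b (~~ d) i - crd (~~ d) y|.
  have [k ck hk] := hang_gap b ny hy; apply: le_trans hk.
  by rewrite ler_pdivrMr // mulrC; exact: (gr_reach HG _ _ nx0 ry ci0 ck).1.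
have l0 := gap false; have l1 := gap true.
rewrite distrC ger0_norm ?subr_ge0 ?(ltW s1) // in l0.
rewrite ger0_norm ?subr_ge0 ?(ltW s2) // in l1.
set t := crd (~~ d) y in hle s1 s2 l0 l1.
have lg b : `|e (endp i d b y)| * PhiC i (~~ d) b t <=
    m * (g (endp i d b y) * ((t - ext (~~ b) (~~ d) i) / (ext b (~~ d) i - ext (~~ b) (~~ d) i))).
  have rb := reachS b ry ny hy; rewrite (mulrA m) ler_pM ?em //.
  - by have /andP[] := PhiC_bound b (introT andP (conj (ltW s1) (ltW s2))).
  - by have /andP[] := PhiC_bound b (introT andP (conj (ltW s1) (ltW s2))).
have gE b : g (endp i d b y) = g y + K * (t - crd (~~ d) x0) ^+ 2
    - K * (ext b (~~ d) i - crd (~~ d) x0) ^+ 2.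
  by rewrite /g /endp /upd /t; case: (d); rewrite /=; ring.
have {hle} : `|e y| <= m * (g y - 1) + D.
  apply: le_trans hle _; rewrite lerD2r big_bool /=.
  apply: le_trans (lerD (lg true) (lg false)) _; rewrite !gE /= -mulrDr ler_wpM2l //.
  set l := lo _ _; set h := hi _ _; set z := crd _ x0.
  have lh : h - l != 0 by rewrite subr_eq0 gt_eqF // (lt_trans s1).
  (* For a quadratic function the error of linear interpolation is exactly its leading coefficient
     times the product of the distances to the two ends. *)
  have -> : (g y + K * (t - z) ^+ 2 - K * (h - z) ^+ 2) * ((t - l) / (h - l)) +
      (g y + K * (t - z) ^+ 2 - K * (l - z) ^+ 2) * ((t - h) / (l - h)) =
      g y - K * ((t - l) * (h - t)).
    by field; rewrite lh -opprB oppr_eq0 lh.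
  rewrite lerD2l lerN2.
  have <- : K * ((w / C) * (w / C)) = 1 by rewrite /K; field; rewrite !gt_eqF.
  rewrite ler_wpM2l // ler_pM // ?divr_ge0 ?ltW //.
have -> : `|e y| = m * g y by rewrite /m divfK // gt_eqF // (lt_le_trans ltr01) ?g1.
lra.
Qed.

Definition hdat x := [pick p : 'I_n * bool | node x && hang p.1 x p.2].

(* At a boundary node the reference element has a boundary side at this node. *)
Definition bdq x i := [exists q, exists d, hasq i x q &&
  ~~ [exists k, hasq k x (upd d q (~~ crd d q))]].

Definition refel x : option 'I_n := if hdat x is Some p then Some p.1 else
  if [pick i | bdq x i] is Some i then Some i else [pick i | cl i x].

Lemma refel_cl x : node x -> exists2 i, refel x = Some i & cl i x.
Proof.
move=> nx; rewrite /refel /hdat; case: pickP => [p /andP[_ /hang_cl]|_]; first by exists p.1.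
case: pickP => [i /existsP[q /existsP[d /andP[/hasq_cl ci _]]]|_]; first by exists i.
case: pickP => [i ci|h]; first by exists i.
by have /existsP[i /(vert_cl HM)] := nx; rewrite h.
Qed.

Definition vref (v : 'I_n -> pt -> R) x := oapp (fun i => v i x) 0 (refel x).

(** Uniqueness for the homogeneous system is [system_bound] with [D = 0]; existence and linearity
    then come from [solve_linear]. *)
Lemma targets_exist : exists tgt : ('I_n -> pt -> R) -> pt -> R,
  [/\ forall v i x d, node x -> hang i x d -> tgt v x = v i x +
        \sum_e (tgt v (endp i d e x) - v i (endp i d e x)) * PhiC i (~~ d) e (crd (~~ d) x),
      forall v x, node x -> (forall i d, ~~ hang i x d) -> tgt v x = vref v x &
      forall (a : R) v w x, tgt (fun i y => a * v i y + w i y) x = a * tgt v x + tgt w x].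
Proof.
pose S := undup [seq (corner M p.1 p.2) | p : 'I_n * (bool * bool)].
have SP y : reflect (node y) (y \in S).
  rewrite mem_undup; apply: (iffP mapP) => [[[i c] _ ->]|/existsP[i /vertP[c ->]]].
    by apply/existsP; exists i; apply/vertP; exists c.
  by exists (i, c); rewrite ?mem_enum.
pose A x y := if hdat x is Some p then
   \sum_e (y == endp p.1 p.2 e x)%:R * PhiC p.1 (~~ p.2) e (crd (~~ p.2) x) else 0.
have AE f x p : hdat x = Some p -> \sum_(y <- S) A x y * f y =
    \sum_e f (endp p.1 p.2 e x) * PhiC p.1 (~~ p.2) e (crd (~~ p.2) x).
  move=> hx; have hh : node x && hang p.1 x p.2.
    by move: hx; rewrite /hdat; case: pickP => // ? h [<-].
  rewrite /A hx; under eq_bigr do rewrite mulr_suml.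
  rewrite exchange_big /=; apply: eq_bigr => e _.
  have eS : endp p.1 p.2 e x \in S by apply/SP/endp_node; case/andP: hh.
  rewrite (big_rem _ eS) /= eqxx mul1r mulrC big_seq big1 ?addr0 // => y.
  by rewrite mem_rem_uniq ?undup_uniq // inE => /andP[/negbTE -> _]; rewrite !mul0r.
have A0 f x : hdat x = None -> \sum_(y <- S) A x y * f y = 0.
  by move=> hx; rewrite /A hx big1 // => y _; rewrite mul0r.
have hd x i d : node x -> hang i x d -> hdat x = Some (i, d).
  move=> nx hx; rewrite /hdat; case: pickP => [[j d'] /= /andP[_ h']|/(_ (i, d))].
    by have [-> ->] := hang_uniq HM nx h' hx.
  by rewrite nx hx.
have [|sol [sol1 sol2]] := @solve_linear R _ S A (undup_uniq _).
  move=> f hf x /SP nx; apply/eqP; rewrite -normr_le0.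
  have := @system_bound f 0 x nx (lexx 0); rewrite mulr0; apply=> y ry.
  have ny := reach_node nx ry; have := hf y (introT (SP y) ny).
  case E: (hdat y) => [p|]; last by rewrite A0 //; left.
  rewrite (AE _ _ _ E) => ->; right; exists p.1, p.2; split.
    by move: E; rewrite /hdat; case: pickP => // ? /andP[_ h] [<-].
  rewrite addr0; apply: le_trans (ler_norm_sum _ _ _) _; apply: ler_sum => b _.
  rewrite normrM ler_wpM2l // ger0_norm //.
  have : hang p.1 y p.2 by move: E; rewrite /hdat; case: pickP => // ? /andP[_ h] [<-].
  move=> /hangP[_ _ /andP[s1 s2]].
  by have /andP[] := PhiC_bound b (introT andP (conj (ltW s1) (ltW s2))).
pose rhs (v : 'I_n -> pt -> R) x := if hdat x is Some p then v p.1 x -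
    \sum_e v p.1 (endp p.1 p.2 e x) * PhiC p.1 (~~ p.2) e (crd (~~ p.2) x) else vref v x.
exists (fun v => sol (rhs v)); split => [v i x d nx hx|v x nx hx|a v w x].
- rewrite (sol1 _ _ (introT (SP x) nx)) (AE _ _ _ (hd _ _ _ nx hx)) /rhs (hd _ _ _ nx hx) /=.
  rewrite -addrA; congr (_ + _); rewrite addrC -sumrB.
  by apply: eq_bigr => e _; rewrite mulrBl.
- have E : hdat x = None by rewrite /hdat; case: pickP => // p /andP[_]; rewrite (negbTE (hx _ _)).
  by rewrite (sol1 _ _ (introT (SP x) nx)) A0 // addr0 /rhs E.
- rewrite -sol2; congr (sol _ x); apply/funext => y; rewrite /rhs /vref.
  case: hdat => [p|]; last by case: refel => //=; rewrite mulr0 addr0.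
  rewrite mulrBr addrACA -opprD; congr (_ - _); rewrite mulr_sumr -big_split /=.
  by apply: eq_bigr => e _; ring.
Qed.

(** Two quadrants at [x] are equal, adjacent or opposite. In the last case [qm_diag] supplies an
    element in between, whence the factor 2. *)
Lemma star_bound (f : 'I_n -> R) (D : R) x i j : 0 <= D ->
  (forall k l q d, k != l -> hasq k x q -> hasq l x (upd d q (~~ crd d q)) ->
     `|f k - f l| <= D) -> cl i x -> cl j x -> `|f i - f j| <= 2 * D.
Proof.
move=> D0 H ci cj; have [q hq] := cl_hasq HM ci; have [q' hq'] := cl_hasq HM cj.
have H1 k l p d : hasq k x p -> hasq l x (upd d p (~~ crd d p)) -> `|f k - f l| <= D.
  have [->|kl] := eqVneq k l; first by rewrite subrr normr0.
  exact: H.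
have H2 d : hasq j x (upd d q (~~ crd d q)) -> `|f i - f j| <= 2 * D.
  by move=> /(H1 _ _ _ _ hq); lra.
have [E|n1] := eqVneq q' q; first by rewrite E in hq'; rewrite (qm_uniq HM hq hq') subrr normr0 mulr_ge0.
have [E|n2] := eqVneq q' (upd false q (~~ q.1)); first by apply: (H2 false); rewrite -E.
have [E|n3] := eqVneq q' (upd true q (~~ q.2)); first by apply: (H2 true); rewrite -E.
have E : q' = (~~ q.1, ~~ q.2) by case: q q' {hq hq' H2} n1 n2 n3 => [] [] [] [[] []].
rewrite E in hq'; have [d [k hk]] := qm_diag HM hq hq'.
have a := H1 _ _ _ _ hq hk.
have b : `|f k - f j| <= D.
  apply: (H1 _ _ _ (~~ d) hk); move: hq'; rewrite /upd !crdE.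
  by case: (d) q {E n1 n2 n3 H2 hq hk} => [] [].
have -> : f i - f j = (f i - f k) + (f k - f j) by ring.
by apply: le_trans (ler_normD _ _) _; lra.
Qed.

(** The difference [ee] of target and reference value vanishes at nodes that hang nowhere. Elsewhere
    it solves the system up to a defect 2D, since the weights have sum at most 1 and exchanging
    values at the ends costs 2D by [star_bound]. One more exchange gives 2(1 + 2C^4) + 2. *)
Lemma target_bound (v : 'I_n -> pt -> R) (tg : pt -> R) (D : R) x i :
  (forall i x d, node x -> hang i x d -> tg x = v i x +
     \sum_e (tg (endp i d e x) - v i (endp i d e x)) * PhiC i (~~ d) e (crd (~~ d) x)) ->
  (forall x, node x -> (forall i d, ~~ hang i x d) -> tg x = vref v x) ->
  node x -> 0 <= D -> cl i x ->
  (forall y, reach x y -> forall k l q d, k != l -> hasq k y q ->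
     hasq l y (upd d q (~~ crd d q)) -> `|v k y - v l y| <= D) ->
  `|tg x - v i x| <= (4 + 4 * C ^+ 4) * D.
Proof.
move=> tg1 tg2 nx D0 ci HD.
have D2 : 0 <= 2 * D by rewrite mulr_ge0.
pose ee y := tg y - vref v y.
have hd y k d : node y -> hang k y d -> refel y = Some k.
  move=> ny hy; rewrite /refel /hdat; case: pickP => [[j d'] /= /andP[_ h']|/(_ (k, d))].
    by have [-> _] := hang_uniq HM ny h' hy.
  by rewrite ny hy.
have vr y k : reach x y -> cl k y -> `|vref v y - v k y| <= 2 * D.
  move=> ry ck; have [l hl cl'] := refel_cl (reach_node nx ry); rewrite /vref hl /=.
  by apply: (star_bound (f := fun i => v i y) D0 (HD y ry)).
have E0 : `|ee x| <= (1 + 2 * C ^+ 4) * (2 * D).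
  apply: system_bound => // y ry; have ny := reach_node nx ry.
  have [/existsP[k /existsP[d hy]]|/existsPn h] := boolP [exists k, exists d, hang k y d]; last first.
    left; rewrite /ee tg2 ?subrr // => k d; apply/negP => hk.
    by have := h k; rewrite negb_exists => /forallP/(_ d); rewrite hk.
  right; exists k, d; split => //; rewrite /ee (tg1 _ _ _ ny hy) /vref (hd _ _ _ ny hy) /=.
  rewrite addrC addKr; have /hangP[_ _ /andP[s1 s2]] := hy.
  set t := crd _ _ in s1 s2 *.
  have pb b := PhiC_bound b (introT andP (conj (ltW s1) (ltW s2))).
  have one : \sum_b PhiC k (~~ d) b t <= 1.
    rewrite big_bool /=; have /andP[_ h1] := pb true; have /andP[_ h2] := pb false.
    apply: le_trans (lerD h1 h2) _ => /=.
    have l := qm_lt HM (~~ d) k.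
    rewrite le_eqVlt; apply/orP; left; apply/eqP; field.
    by rewrite !subr_eq0 lt_eqF ?gt_eqF.
  apply: (@le_trans _ _ (\sum_b (`|ee (endp k d b y)| + 2 * D) * PhiC k (~~ d) b t)).
    apply: le_trans (ler_norm_sum _ _ _) _; apply: ler_sum => b _.
    have /andP[p0 _] := pb b; rewrite normrM (ger0_norm p0) ler_wpM2r //.
    set z := endp _ _ _ _; have rz : reach x z by apply: reachS.
    have -> : tg z - v k z = ee z + (vref v z - v k z) by rewrite /ee; ring.
    by rewrite (le_trans (ler_normD _ _)) // lerD2l vr // /z endp_cl.
  rewrite (eq_bigr (fun b => _ * _ + _ * _) (fun b _ => mulrDl _ _ _)).
  by rewrite big_split /= lerD2l -mulr_sumr ler_piMr.
have -> : tg x - v i x = ee x + (vref v x - v i x) by rewrite /ee; ring.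
have := vr _ _ (reach0 x) ci; have := ler_normD (ee x) (vref v x - v i x); lra.
Qed.

End Targets.

(** * Error estimates *)

Section TensorPolynomials.
Variable R : realType.
Implicit Types (p : nat) (f g : R * R -> R) (r : {poly R}).

Lemma Qp_lin p (a : R) f g : Qp p f -> Qp p g -> Qp p (fun x => a * f x + g x).
Proof.
move=> [c hc] [c' hc']; exists (a *: c + c') => x; rewrite hc hc' mulr_sumr -big_split /=.
apply: eq_bigr => i _; rewrite mulr_sumr -big_split /=; apply: eq_bigr => j _.
by rewrite !mxE; ring.
Qed.

Lemma Qp_ext p f g : (forall x, f x = g x) -> Qp p f -> Qp p g.
Proof. by move=> h [c hc]; exists c => x; rewrite -h. Qed.

Lemma Qp0 p : Qp p (fun _ : R * R => 0).
Proof.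
exists 0 => x; rewrite big1 // => i _; rewrite big1 // => j _; rewrite mxE.
by rewrite !mul0r.
Qed.

Lemma Qp_add p f g : Qp p f -> Qp p g -> Qp p (fun x => f x + g x).
Proof. by move=> hf hg; apply: Qp_ext (Qp_lin 1 hf hg) => x; rewrite mul1r. Qed.

Lemma Qp_scale p (a : R) f : Qp p f -> Qp p (fun x => a * f x).
Proof. by move=> hf; apply: Qp_ext (Qp_lin a hf (Qp0 p)) => x; rewrite addr0. Qed.

Lemma Qp_sum p (I : finType) (F : I -> R * R -> R) :
  (forall i, Qp p (F i)) -> Qp p (fun x => \sum_i F i x).
Proof.
move=> h; elim: (index_enum I) => [|i s IH].
  by apply: Qp_ext (Qp0 p) => x; rewrite big_nil.
by apply: Qp_ext (Qp_add (h i) IH) => x; rewrite big_cons.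
Qed.

Lemma Qp_tensor p d (r s : {poly R}) : (size r <= p.+1)%N -> (size s <= p.+1)%N ->
  Qp p (fun x => r.[crd d x] * s.[crd (~~ d) x]).
Proof.
have T (r' s' : {poly R}) : (size r' <= p.+1)%N -> (size s' <= p.+1)%N ->
    Qp p (fun x => r'.[x.1] * s'.[x.2]).
  move=> hr hs; exists (\matrix_(i, j) (r'`_i * s'`_j)) => x.
  rewrite (horner_coef_wide _ hr) (horner_coef_wide _ hs) mulr_suml.
  apply: eq_bigr => i _; rewrite mulr_sumr; apply: eq_bigr => j _.
  by rewrite mxE; ring.
move=> hr hs; case: d => /=; last exact: T.
by apply: Qp_ext (T _ _ hs hr) => x; rewrite mulrC.
Qed.

Lemma Qp_section p f d (a : R) : Qp p f -> exists2 r : {poly R},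
  (size r <= p.+1)%N & forall t, f (mk d a t) = r.[t].
Proof.
move=> [c hc]; case: d.
  exists (\poly_(i < p.+1) (\sum_(j < p.+1) c (inord i) j * a ^+ j)); first exact: size_poly.
  move=> t; rewrite hc horner_poly; apply: eq_bigr => i _; rewrite inord_val mulr_suml.
  by apply: eq_bigr => j _ /=; ring.
exists (\poly_(j < p.+1) (\sum_(i < p.+1) c i (inord j) * a ^+ i)); first exact: size_poly.
move=> t; rewrite hc exchange_big horner_poly; apply: eq_bigr => j _.
by rewrite inord_val mulr_suml.
Qed.

Lemma intp_swap r (a b : R) : intp r b a = - intp r a b.
Proof. by rewrite /intp opprB. Qed.

End TensorPolynomials.

Section Estimates.
Variables (R : realType) (n : nat) (M : n.-tuple (rect R)).
Local Notation pt := (R * R)%type.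
Implicit Types (i j k : 'I_n) (d e s : bool) (x y : pt) (q c : bool * bool).
Local Notation ext := (ext M).
Local Notation lo := (ext false).
Local Notation hi := (ext true).
Local Notation hasq := (hasq M).
Local Notation cl := (cl M).
Local Notation node := (node M).
Local Notation hang := (hang M).
Local Notation width := (width M).
Local Notation dom := (dom M).
Local Notation endp := (endp M).
Local Notation reach := (reach M).

Hypothesis HM : quad_mesh M.
Variable p : nat.
Hypothesis p0 : (0 < p)%N.
Let Phi := horner (layer R p).
Local Notation PhiC := (PhiC M Phi).
Let Phi0 : Phi 0 = 1 := layer0 R p0.
Let Phi1 : Phi 1 = 0 := layer1 R p.
Let Phib t : 0 <= t <= 1 -> 0 <= Phi t <= 1 - t := @layer_bound R p t p0.

Definition PhiP i d e : {poly R} := layer R p \Po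
  ((ext (~~ e) d i - ext e d i)^-1 *: 'X + (- (ext e d i / (ext (~~ e) d i - ext e d i)))%:P).

Lemma PhiPE i d e t : PhiC i d e t = (PhiP i d e).[t].
Proof.
rewrite /PhiC /PhiP; set l := ext (~~ e) d i - ext e d i.
rewrite horner_comp (_ : (l^-1 *: 'X + _).[t] = (t - ext e d i) / l) //.
by rewrite hornerD hornerZ hornerX hornerC mulrBl mulrC.
Qed.

Lemma size_PhiP i d e : (size (PhiP i d e) <= p.+1)%N.
Proof. by apply: size_comp_aff; apply: size_layer. Qed.

Lemma intp_PhiP i d e :
  intp (PhiP i d e ^+ 2) (lo d i) (hi d i) <= width d i * (4 / p%:R ^+ 2).
Proof.
have l := qm_lt HM d i; set L := ext (~~ e) d i - ext e d i.
have L0 : L != 0 by rewrite subr_eq0 /L; case: (e) => /=; [rewrite lt_eqF|rewrite gt_eqF].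
rewrite /PhiP -/L expr2 -comp_polyM intp_shift ?invr_neq0 // invrK.
have -> : intp (layer R p * layer R p) (L^-1 * lo d i + - (ext e d i / L))
    (L^-1 * hi d i + - (ext e d i / L)) * L = ip (layer R p) (layer R p) * width d i.
  rewrite /ip /width; move: L0; rewrite /L; case: (e) => /= L0.
    have -> : (lo d i - hi d i)^-1 * lo d i + - (hi d i / (lo d i - hi d i)) = 1 by field.
    have -> : (lo d i - hi d i)^-1 * hi d i + - (hi d i / (lo d i - hi d i)) = 0 by field.
    by rewrite intp_swap; ring.
  have -> : (hi d i - lo d i)^-1 * lo d i + - (lo d i / (hi d i - lo d i)) = 0 by field.
  by have -> : (hi d i - lo d i)^-1 * hi d i + - (lo d i / (hi d i - lo d i)) = 1 by field.
by rewrite mulrC ler_wpM2l ?(ltW (width_gt0 HM _ _)) // layer_ip.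
Qed.

Section Space.
Variables (tg : pt -> R) (v : 'I_n -> pt -> R).
Hypothesis Vv : Vp p v.

Lemma vc_Qp i : Qp p (vc M Phi tg v i).
Proof.
apply: Qp_add; first exact: Vv.
apply: Qp_sum => c; apply: Qp_scale.
have h := Qp_tensor false (size_PhiP i false c.1) (size_PhiP i true c.2).
by apply: Qp_ext h => x; rewrite /PhiV !PhiPE.
Qed.

Lemma lift_tensor i d e : exists2 r : {poly R}, (size r <= p.+1)%N &
  (forall x, lift M Phi tg v i d e x = (PhiP i d e).[crd d x] * r.[crd (~~ d) x]) /\
  (r = 0 \/ exists2 j, dom i d e j & forall t, r.[t] = vc M Phi tg v j (mk d (ext e d i) t) -
     vc M Phi tg v i (mk d (ext e d i) t)).
Proof.
rewrite /lift; case: pickP => [j dj|_]; last first.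
  by exists 0; [rewrite size_poly0|split=> [x|]; [rewrite horner0 mulr0|left]].
have [r1 s1 h1] := Qp_section d (ext e d i) (vc_Qp j).
have [r2 s2 h2] := Qp_section d (ext e d i) (vc_Qp i).
exists (r1 - r2).
  by rewrite (leq_trans (size_polyD _ _)) // geq_max size_polyN s1.
split=> [x /=|]; first by rewrite /upd h1 h2 PhiPE hornerD hornerN mulrC.
by right; exists j => // t; rewrite hornerD hornerN h1 h2.
Qed.

Lemma interp_Qp i : Qp p (interp M Phi tg v i).
Proof.
apply: Qp_add; first exact: vc_Qp.
apply: Qp_sum => d; apply: Qp_sum => e; have [r sr [h _]] := lift_tensor i d e.
exact: Qp_ext (fun x => esym (h x)) (Qp_tensor d (size_PhiP i d e) sr).
Qed.

End Space.

Lemma inI_end s (l u t : R) : inI s l u t -> ~~ inI (~~ s) l u t ->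
  t = if s then l else u.
Proof.
case: s => /= /andP[a b]; rewrite ?(ltW a) ?(ltW b) ?andbT /= -leNgt => c;
  by apply/le_anti; rewrite ?a ?b ?c.
Qed.

(** Passage from adjacent germs to the relation [dom]: the facing sides are nested by [qm_side], and
    equal sides are ordered by the indices. *)
Lemma adj_dom k l x d q : k != l -> hasq k x q -> hasq l x (upd d q (~~ crd d q)) ->
  exists e, [/\ crd d x = ext e d k, crd d x = ext (~~ e) d l &
    dom k d e l \/ dom l d (~~ e) k].
Proof.
move=> kl hk hl; have /(hasqP M d)[k1 k2] := hk; have /(hasqP M d)[] := hl.
rewrite /upd !crdE => l1 l2.
have [lk ll] := (qm_lt HM d k, qm_lt HM d l).
have xk : crd d x = ext (~~ crd d q) d k.
  have K : ~~ inI (~~ crd d q) (lo d k) (hi d k) (crd d x).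
    apply/negP => h; case/negP: kl; apply/eqP.
    by apply: (qm_uniq HM _ hl); apply/(hasqP M d); rewrite /upd !crdE.
  by rewrite (inI_end k1 K); case: (crd d q).
have xl : crd d x = ext (crd d q) d l.
  have L : ~~ inI (~~ ~~ crd d q) (lo d l) (hi d l) (crd d x).
    apply/negP => h; case/negP: kl; apply/eqP; rewrite negbK in h.
    by apply: (qm_uniq HM hk); apply/(hasqP M d).
  by rewrite (inI_end l1 L); case: (crd d q).
exists (~~ crd d q); rewrite negbK; split => //.
have E : ext (~~ crd d q) d k = ext (crd d q) d l by rewrite -xk -xl.
rewrite /dom kl [l == k]eq_sym kl negbK E eqxx /=.
have lk0 : (l < k)%N || (k < l)%N.
  by rewrite -neq_ltn; apply: contra kl => /eqP/val_inj ->.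
have [[a b]|[a b]] := qm_side HM kl hk hl; rewrite a b /=.
  have [e1|n1] := eqVneq (lo (~~ d) l) (lo (~~ d) k); last by left.
  have [e2|n2] := eqVneq (hi (~~ d) k) (hi (~~ d) l); last by left.
  by rewrite e1 e2 !lexx ?eqxx /=; case/orP: lk0 => ->; [left|right].
have [e1|n1] := eqVneq (lo (~~ d) k) (lo (~~ d) l); last by right.
have [e2|n2] := eqVneq (hi (~~ d) l) (hi (~~ d) k); last by right.
by rewrite e1 e2 !lexx ?eqxx /=; case/orP: lk0 => ->; [left|right].
Qed.

(** A node inside the smaller side would also lie inside the larger one and thus hang in two
    elements, against [hang_uniq]. *)
Lemma dom_adj i d e j x : dom i d e j -> cl i x -> crd d x = ext e d i ->
  cl j x /\ (node x -> vert M i x).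
Proof.
move=> dj ci he; have cj := dom_cl HM dj ci he; split => // nx.
have [//|[d' hd]] := node_cl HM nx ci; exfalso.
have /hangP[e' he' hs] := hd; have [dd|dd] := eqVneq d' d.
  subst d'; have := dj => /and5P[ij /eqP ex a b _]; have /andP[s1 s2] := hs.
  have hj : hang j x d.
    apply/hangP; exists (~~ e); first by rewrite he.
    by rewrite (le_lt_trans a) // (lt_le_trans s2).
  by have [E _] := hang_uniq HM nx hd hj; rewrite E eqxx in ij.
have E : d = ~~ d' by case: d d' dd {hd he' hs he dj} => [] [].
by rewrite -E he in hs; move: hs; case: (e); rewrite ltxx ?andbF.
Qed.

Lemma dom_end_le i d e j y (r : {poly R}) : dom i d e j -> vert M i y ->
  crd d y = ext e d i -> (size r <= p.+1)%N ->
  r.[crd (~~ d) y] ^+ 2 <= p.+1%:R ^+ 2 / width (~~ d) i * intp (r ^+ 2) (lo (~~ d) i) (hi (~~ d) i).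
Proof.
move=> dj vy he sr; have [h1 h2] := horner_sqr_le sr (qm_lt HM (~~ d) i).
by have [e1 [e2 ->]] := vert_ex d vy; rewrite !crdE; case: e2.
Qed.

Section ErrorDecomposition.
Variables (C : R) (tg : pt -> R) (v : 'I_n -> pt -> R) (i0 : 'I_n) (B : R).
Hypothesis HG : graded M C.
Hypothesis Vv : Vp p v.
Hypothesis tg1 : forall i x d, node x -> hang i x d -> tg x = v i x +
  \sum_e (tg (endp i d e x) - v i (endp i d e x)) * PhiC i (~~ d) e (crd (~~ d) x).
Hypothesis tg2 : forall x, node x -> (forall i d, ~~ hang i x d) -> tg x = vref M v x.
Hypothesis B0 : 0 <= B.

(** The elements whose jumps may enter the error on [i0]. The lifts on [i0] involve neighbours [j],
    and the targets at the corners of [j] depend on the chains issued from these corners. *)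
Definition near i0 k := exists j x y z,
  [/\ cl i0 x, cl j x, node y /\ cl j y, reach y z & cl k z].

Hypothesis HB : forall d e i j (r : {poly R}), dom i d e j -> near i0 i -> near i0 j ->
  (size r <= p.+1)%N ->
  (forall t, r.[t] = v i (mk d (ext e d i) t) - v j (mk d (ext e d i) t)) ->
  intp (r ^+ 2) (lo (~~ d) i) (hi (~~ d) i) <= B ^+ 2.

Let w := width false i0.
Let w0 : 0 < w := width_gt0 HM _ _.

Lemma cl_self i : cl i (tnth M i).1.
Proof.
by apply/forallP => d; have := qm_lt HM d i; rewrite /ext /= => h; rewrite lexx ltW.
Qed.

Lemma graded_ge1 : 1 <= C.
Proof.
have := gr_touch HG false false (cl_self i0) (cl_self i0); rewrite -/w => h.
by rewrite -(ler_pM2r w0) mul1r.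
Qed.

Let C1 := graded_ge1.
Let C0 : 0 < C := lt_le_trans ltr01 C1.
Let P0 : 0 < p%:R :> R. Proof. by rewrite ltr0n. Qed.

Lemma near_width k d : near i0 k -> width d k <= C ^+ 2 * w /\ w <= C ^+ 2 * width d k.
Proof.
move=> [j [x [y [z [ci cj [ny cy] ryz ck]]]]].
have a := gr_touch HG false false ci cj; have a' := gr_touch HG false false cj ci.
have [b _] := gr_reach HG false d ny ryz cy ck.
have [_ b'] := gr_reach HG d false ny ryz cy ck.
split; first by apply: le_trans b' _; rewrite expr2 -mulrA ler_wpM2l // ltW.
by apply: le_trans a _; rewrite expr2 -mulrA ler_wpM2l // ltW.
Qed.

Lemma width_self d : width d i0 <= C * w.
Proof. exact: (gr_touch HG _ _ (cl_self i0) (cl_self i0)). Qed.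

Lemma norm_le_sqr (x D : R) : 0 <= D -> x ^+ 2 <= D ^+ 2 -> `|x| <= D.
Proof. by move=> D0 h; rewrite -ler_sqr ?nnegrE // real_normK ?num_real. Qed.

(** The bound on jumps at nodes: a side near [i0] has length at least w / C^2, and the inverse
    inequality costs [p.+1] over the square root of this length. *)
Let D := p.+1%:R * (C * B) / Num.sqrt w.

Lemma D_ge0 : 0 <= D.
Proof. by rewrite divr_ge0 ?sqrtr_ge0 // mulr_ge0 // mulr_ge0 // ltW. Qed.

Lemma D_sqr : D ^+ 2 = p.+1%:R ^+ 2 * C ^+ 2 / w * B ^+ 2.
Proof. by rewrite /D !exprMn exprVn sqr_sqrtr ?(ltW w0) //; ring. Qed.

Lemma near_vertex_jump k l z q d : near i0 k -> near i0 l -> node z -> k != l ->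
  hasq k z q -> hasq l z (upd d q (~~ crd d q)) -> `|v k z - v l z| <= D.
Proof.
move=> nk nl nz kl hk hl; have [e [xk xl]] := adj_dom kl hk hl.
have H i j e' : near i0 i -> near i0 j -> cl i z -> crd d z = ext e' d i ->
    dom i d e' j -> `|v i z - v j z| <= D.
  move=> ni nj ci he dij; have [_ /(_ nz) vi] := dom_adj dij ci he.
  have [ri si hi'] := Qp_section d (ext e' d i) (Vv i).
  have [rj sj hj'] := Qp_section d (ext e' d i) (Vv j).
  have sr : (size (ri - rj)%R <= p.+1)%N.
    by rewrite (leq_trans (size_polyD _ _)) // geq_max size_polyN si.
  have b := HB dij ni nj sr (fun t => _).
  have {}b : intp ((ri - rj) ^+ 2) (lo (~~ d) i) (hi (~~ d) i) <= B ^+ 2.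
    by apply: HB dij ni nj sr _ => t; rewrite hornerD hornerN -hi' -hj'.
  apply: norm_le_sqr; first exact: D_ge0.
  have -> : v i z - v j z = (ri - rj).[crd (~~ d) z].
    by rewrite hornerD hornerN -hi' -hj' -he mkE.
  apply: le_trans (dom_end_le dij vi he sr) _; rewrite D_sqr.
  have [_ ww] := near_width (~~ d) ni; have wi := width_gt0 HM (~~ d) i.
  apply: ler_pM => //; rewrite ?divr_ge0 ?sqr_ge0 ?(ltW wi) //.
    by rewrite intp_sqr_ge0 // ltW // (qm_lt HM).
  rewrite -mulrA ler_wpM2l ?sqr_ge0 // ler_pdivlMr // mulrC ler_pdivrMr //.
case=> dij; first exact: (H k l e nk nl (hasq_cl hk) xk dij).
by rewrite distrC; exact: (H l k (~~ e) nl nk (hasq_cl hl) xl dij).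
Qed.

Definition Kvert : R := 4 + 4 * C ^+ 4.

Lemma vertex_coef j x y : cl i0 x -> cl j x -> vert M j y -> `|tg y - v j y| <= Kvert * D.
Proof.
move=> ci cj vy; have ny : node y by apply/existsP; exists j.
have cy := vert_cl HM vy.
apply: (target_bound HM HG Phib tg1 tg2 ny D_ge0 cy) => z ryz k l q d kl hk hl.
have nz := reach_node ny ryz.
have ck := hasq_cl hk; have cl' := hasq_cl hl.
by apply: (near_vertex_jump _ _ nz kl hk hl); exists j, x, y, z.
Qed.

(** Here the powers of [p] cancel: a squared nodal coefficient is of order p^2, the squared norm of
    a layer of order p^(-2). The factor 16 is 4 from the layer times 4 from ((p+1)/p)^2. *)
Lemma coef_sqr_le j d (b y : R) (s : {poly R}) : `|y| <= Kvert * D -> width d j <= C * w ->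
  intp (s ^+ 2) (lo d i0) (hi d i0) <= width d j * (4 / p%:R ^+ 2) -> b = y ^+ 2 ->
  b * intp (s ^+ 2) (lo d i0) (hi d i0) <= 16 * Kvert ^+ 2 * C ^+ 3 * B ^+ 2.
Proof.
move=> hy hw hs ->.
have s0 : 0 <= intp (s ^+ 2) (lo d i0) (hi d i0) by rewrite intp_sqr_ge0 // ltW // (qm_lt HM).
have y2 : y ^+ 2 <= Kvert ^+ 2 * D ^+ 2.
  by rewrite -exprMn -real_normK ?num_real // ler_sqr ?nnegrE // (le_trans _ hy).
have hs' : intp (s ^+ 2) (lo d i0) (hi d i0) <= C * w * (4 / p%:R ^+ 2).
  by apply: le_trans hs _; rewrite ler_wpM2r // divr_ge0 ?sqr_ge0.
apply: le_trans (ler_pM (sqr_ge0 _) s0 y2 hs') _; rewrite D_sqr.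
have -> : Kvert ^+ 2 * (p.+1%:R ^+ 2 * C ^+ 2 / w * B ^+ 2) * (C * w * (4 / p%:R ^+ 2)) =
   (p.+1%:R / p%:R) ^+ 2 * 4 * (Kvert ^+ 2 * C ^+ 3 * B ^+ 2) by field; rewrite !gt_eqF.
have pp : (p.+1%:R / p%:R) ^+ 2 <= 4 :> R.
  rewrite (_ : 4 = 2 ^+ 2); last by ring.
  by rewrite ler_sqr ?nnegrE ?divr_ge0 // ler_pdivrMr // -natrM ler_nat mul2n -addnn -addn1 leq_add2l.
have : 0 <= Kvert ^+ 2 * C ^+ 3 * B ^+ 2.
  apply: mulr_ge0 (sqr_ge0 _); apply: mulr_ge0 (sqr_ge0 _) _.
  by rewrite exprn_ge0 // ltW.
nra.
Qed.

(** From (a + b + c)^2 <= 3(a^2 + b^2 + c^2), applied to the jump of [v] and to the nodal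
    corrections of the two elements. Each correction is a sum of two layers, so four terms occur
    with factor 6, each estimated by [coef_sqr_le]. *)
Definition Klift : R := 3 + 24 * 16 * Kvert ^+ 2 * C ^+ 3.

Lemma lift_sqr_le d e j (r : {poly R}) : dom i0 d e j ->
  (forall t, r.[t] = vc M Phi tg v j (mk d (ext e d i0) t) - vc M Phi tg v i0 (mk d (ext e d i0) t)) ->
  intp (r ^+ 2) (lo (~~ d) i0) (hi (~~ d) i0) <= Klift * B ^+ 2.
Proof.
move=> dj hr; set a := ext e d i0 in hr *.
have := dj => /and5P[_ /eqP exj hl hh _]; rewrite -/a in exj.
have lt0 := qm_lt HM (~~ d) i0.
pose x := mk d a (lo (~~ d) i0); have ci : cl i0 x by apply: (vert_cl HM); rewrite /x /a; apply: vert_mk.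
have [cj _] := dom_adj dj ci (crd_mk _ _ _).
have ni k : cl k x -> near i0 k.
  move=> ck; exists i0, x, x, x; split => //; last exact: reach0.
  by split => //; apply: node_mk.
have [rj sj hj] := Qp_section d a (Vv j); have [ri si hi'] := Qp_section d a (Vv i0).
have sr : (size (ri - rj)%R <= p.+1)%N.
  by rewrite (leq_trans (size_polyD _ _)) // geq_max size_polyN si.
have b1 : intp ((ri - rj) ^+ 2) (lo (~~ d) i0) (hi (~~ d) i0) <= B ^+ 2.
  by apply: HB dj (ni _ ci) (ni _ cj) sr _ => t; rewrite hornerD hornerN -hi' -hj.
pose cf k b := tg (mk d a (ext b (~~ d) k)) - v k (mk d a (ext b (~~ d) k)).
have vcE k e' t : a = ext e' d k -> vc M Phi tg v k (mk d a t) = v k (mk d a t) +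
    (cf k true * (PhiP k (~~ d) true).[t] + cf k false * (PhiP k (~~ d) false).[t]).
  move=> hk; rewrite (vc_side HM Phi0 Phi1 tg v (d := d) (e := e')) ?crdE //.
  by rewrite big_bool /= !PhiPE /upd negbK !mkN ?crdE.
have cfb k b e' : cl k x -> a = ext e' d k -> `|cf k b| <= Kvert * D.
  by move=> ck hk; apply: vertex_coef ci ck _; rewrite hk; apply: vert_mk.
have T k b e' : cl k x -> a = ext e' d k -> lo (~~ d) k <= lo (~~ d) i0 ->
    hi (~~ d) i0 <= hi (~~ d) k ->
    cf k b ^+ 2 * intp (PhiP k (~~ d) b ^+ 2) (lo (~~ d) i0) (hi (~~ d) i0) <=
      16 * Kvert ^+ 2 * C ^+ 3 * B ^+ 2.
  move=> ck hk h1 h2; apply: (@coef_sqr_le k _ _ (cf k b)) => //.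
  - exact: cfb ck hk.
  - exact: (gr_touch HG _ _ ck ci).
  - apply: le_trans (intp_sub _ h1 (ltW lt0) h2) _; exact: intp_PhiP.
pose s := 3 *: (ri - rj) ^+ 2 +
  6 *: (cf j true ^+ 2 *: PhiP j (~~ d) true ^+ 2 + cf j false ^+ 2 *: PhiP j (~~ d) false ^+ 2 +
   (cf i0 true ^+ 2 *: PhiP i0 (~~ d) true ^+ 2 + cf i0 false ^+ 2 *: PhiP i0 (~~ d) false ^+ 2)).
apply: (@le_trans _ _ (intp s (lo (~~ d) i0) (hi (~~ d) i0))).
  apply: intp_le => [|t _]; first exact: ltW.
  rewrite /s !(hornerD, hornerZ, horner_exp, hornerN) hr (vcE j (~~ e)) // (vcE i0 e) // hj hi'.
  set A := rj.[t]; set A' := ri.[t]; rewrite -!exprMn.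
  set b := cf j true * _; set c := cf j false * _; set f := cf i0 true * _; set g := cf i0 false * _.
  rewrite -subr_ge0.
  have -> : 3 * (A' - A) ^+ 2 + 6 * (b ^+ 2 + c ^+ 2 + (f ^+ 2 + g ^+ 2)) -
      (A + (b + c) - (A' + (f + g))) ^+ 2 =
      3 * (b - c) ^+ 2 + 3 * (f - g) ^+ 2 + ((A - A') - (b + c)) ^+ 2 +
      ((A - A') + (f + g)) ^+ 2 + ((b + c) + (f + g)) ^+ 2 by ring.
  by rewrite !addr_ge0 ?sqr_ge0 // mulr_ge0 ?sqr_ge0.
rewrite /s intpD !intpZ !intpD !intpZ /Klift.
have := T j true _ cj exj hl hh; have := T j false _ cj exj hl hh.
have := T i0 true e ci erefl (lexx _) (lexx _); have := T i0 false e ci erefl (lexx _) (lexx _).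
lra.
Qed.

(** The first summand serves the corner terms, the second one the lifts. *)
Definition Kerr : R := 64 * Kvert ^+ 2 * C ^+ 4 + 4 * C * Klift.

(** One tensor product for each corner and each side. The bounds are kept as products of
    one-dimensional integrals because they serve twice: as they are for the L^2 norm, and after
    Markov's inequality in each variable for the gradient. *)
Lemma interp_error : exists s : seq ({poly R} * {poly R}), [/\ size s = 8,
  forall x, v i0 x - interp M Phi tg v i0 x = \sum_(f <- s) f.1.[x.1] * f.2.[x.2] &
  forall f, f \in s -> [/\ (size f.1 <= p.+1)%N, (size f.2 <= p.+1)%N &
    intp (f.1 ^+ 2) (lo false i0) (hi false i0) * intp (f.2 ^+ 2) (lo true i0) (hi true i0)
      <= Kerr * (w / p%:R ^+ 2) * B ^+ 2]].
Proof.
have KV : 0 <= Kvert by rewrite addr_ge0 // mulr_ge0 // exprn_ge0 // ltW.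
have KL : 0 <= Klift.
  by rewrite addr_ge0 // !mulr_ge0 ?sqr_ge0 ?exprn_ge0 // ltW.
have E0 : 0 <= w / p%:R ^+ 2 * B ^+ 2 by rewrite !mulr_ge0 ?sqr_ge0 ?invr_ge0 ?sqr_ge0 ?(ltW w0).
pose F c : {poly R} * {poly R} :=
  ((- (tg (corner M i0 c) - v i0 (corner M i0 c))) *: PhiP i0 false c.1, PhiP i0 true c.2).
have HF c : intp ((F c).1 ^+ 2) (lo false i0) (hi false i0) * intp ((F c).2 ^+ 2) (lo true i0) (hi true i0)
      <= Kerr * (w / p%:R ^+ 2) * B ^+ 2.
  rewrite /F /= exprZn intpZ sqrrN.
  have cb : `|tg (corner M i0 c) - v i0 (corner M i0 c)| <= Kvert * D.
    by apply: vertex_coef (cl_self i0) (cl_self i0) _; apply/vertP; exists c.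
  have h1 := coef_sqr_le cb (width_self false) (intp_PhiP i0 false c.1) erefl.
  have h2 : intp (PhiP i0 true c.2 ^+ 2) (lo true i0) (hi true i0) <= C * w * (4 / p%:R ^+ 2).
    by apply: le_trans (intp_PhiP _ _ _) _; rewrite ler_wpM2r ?width_self // divr_ge0 ?sqr_ge0.
  have q1 := intp_sqr_ge0 (PhiP i0 false c.1) (ltW (qm_lt HM false i0)).
  have q2 := intp_sqr_ge0 (PhiP i0 true c.2) (ltW (qm_lt HM true i0)).
  apply: le_trans (ler_pM (mulr_ge0 (sqr_ge0 _) q1) q2 h1 h2) _; rewrite /Kerr.
  have -> : 16 * Kvert ^+ 2 * C ^+ 3 * B ^+ 2 * (C * w * (4 / p%:R ^+ 2)) =
      64 * Kvert ^+ 2 * C ^+ 4 * (w / p%:R ^+ 2 * B ^+ 2) by ring.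
  by rewrite -[X in _ <= X]mulrA ler_wpM2r // lerDl !mulr_ge0 // ltW.
pose P de (g : {poly R} * {poly R}) := [/\ (size g.1 <= p.+1)%N, (size g.2 <= p.+1)%N,
  intp (g.1 ^+ 2) (lo false i0) (hi false i0) * intp (g.2 ^+ 2) (lo true i0) (hi true i0)
      <= Kerr * (w / p%:R ^+ 2) * B ^+ 2 &
  forall x, - lift M Phi tg v i0 de.1 de.2 x = g.1.[x.1] * g.2.[x.2]].
have HP (de : bool * bool) : exists g, P de g.
  case: de => d e; have [r sr [hr hd]] := lift_tensor tg Vv i0 d e.
  have S1 := size_PhiP i0 d e.
  have I1 : intp (PhiP i0 d e ^+ 2) (lo d i0) (hi d i0) <= C * w * (4 / p%:R ^+ 2).
    by apply: le_trans (intp_PhiP _ _ _) _; rewrite ler_wpM2r ?width_self // divr_ge0 ?sqr_ge0.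
  have I2 : intp (r ^+ 2) (lo (~~ d) i0) (hi (~~ d) i0) <= Klift * B ^+ 2.
    case: hd => [->|[j dj hj]]; last exact: lift_sqr_le dj hj.
    by rewrite expr0n /= intp0 mulr_ge0 ?sqr_ge0.
  have I3 : intp (PhiP i0 d e ^+ 2) (lo d i0) (hi d i0) *
      intp ((- r) ^+ 2) (lo (~~ d) i0) (hi (~~ d) i0) <= Kerr * (w / p%:R ^+ 2) * B ^+ 2.
    rewrite sqrrN.
    apply: le_trans (ler_pM _ _ I1 I2) _; rewrite ?intp_sqr_ge0 ?(ltW (qm_lt HM _ _)) //.
    have -> : C * w * (4 / p%:R ^+ 2) * (Klift * B ^+ 2) = 4 * C * Klift * (w / p%:R ^+ 2 * B ^+ 2) by ring.
    by rewrite -[X in _ <= X]mulrA ler_wpM2r // /Kerr lerDr !mulr_ge0 ?sqr_ge0 ?exprn_ge0 // ltW.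
  case: d r sr hr hd S1 I1 I2 I3 => r sr hr hd S1 I1 I2 I3.
    exists (- r, PhiP i0 true e); split => //=; rewrite ?size_polyN //; first by rewrite mulrC.
    by move=> x; rewrite hr hornerN /=; ring.
  exists (PhiP i0 false e, - r); split => //=; rewrite ?size_polyN //.
  by move=> x; rewrite hr hornerN /=; ring.
have [G HGd] := choice HP.
exists ([seq F c | c : bool * bool] ++ [seq G de | de : bool * bool]); split.
- by rewrite size_cat !size_image card_prod card_bool.
- move=> x; rewrite big_cat /= !big_image /=.
  rewrite /interp /vc opprD opprD !addrA subrr add0r; congr (_ + _).
    rewrite -sumrN; apply: eq_big => // c _; rewrite hornerZ /PhiV !PhiPE; ring.
  rewrite pair_big /= -sumrN; apply: eq_big => // de _.
  by have [_ _ _ ->] := HGd de.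
- move=> f; rewrite mem_cat => /orP[/mapP[c _ ->]|/mapP[de _ ->]].
    split; [exact: leq_trans (size_scale_leq _ _) (size_PhiP _ _ _)|exact: size_PhiP|exact: HF].
  by have [] := HGd de.
Qed.

End ErrorDecomposition.
End Estimates.

(** * Integrals on rectangles *)

Section PlaneIntegrals.
Variable R : realType.
Local Notation pt := (R * R)%type.
Local Notation mu1 := (@lebesgue_measure R).
Local Notation mpt := (measurableTypeR R * measurableTypeR R)%type.

(** An open set is a countable union of boxes with rational corners, hence belongs to the product
    sigma-algebra. *)
Lemma open_measurable2 (U : set pt) : open U -> measurable (U : set mpt).
Proof.
move=> oU.
pose F a b c d : set mpt := if `[< `]ratr a : R, ratr b[ `*` `]ratr c : R, ratr d[ `<=` U >]
  then `]ratr a : R, ratr b[ `*` `]ratr c : R, ratr d[ else set0.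
have -> : U = \bigcup_(a : rat) \bigcup_(b : rat) \bigcup_(c : rat) \bigcup_(d : rat) F a b c d.
  apply/seteqP; split => [x Ux|x [a _ [b _ [c _ [d _]]]]]; last first.
    by rewrite /F; case: asboolP => // h /h.
  have := oU; rewrite openE => /(_ x Ux); rewrite /interior /= => /nbhs_ballP[e /= e0 he].
  have ex (t : R) : exists a b, [/\ t - e < ratr a, ratr a < t, t < ratr b & ratr b < t + e].
    have [a] := @rat_in_itvoo R (t - e) t (ltac:(by rewrite ltrBlDr ltrDl)).
    rewrite in_itv /= => /andP[a1 a2].
    have [b] := @rat_in_itvoo R t (t + e) (ltac:(by rewrite ltrDl)).
    by rewrite in_itv /= => /andP[b1 b2]; exists a, b.
  have [a [b [a1 a2 b1 b2]]] := ex x.1; have [c [d [c1 c2 d1 d2]]] := ex x.2.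
  exists a => //; exists b => //; exists c => //; exists d => //.
  rewrite /F; case: asboolP => [_|nsub].
    by split; rewrite /= in_itv /= ?a2 ?b1 ?c2 ?d1.
  exfalso; apply: nsub => y [/= ]; rewrite !in_itv /= => /andP[y1 y2] /andP[y3 y4]; apply: he.
  by split; rewrite /ball /= ltr_distlC; lra.
do 4![apply: bigcupT_measurable_rat => ?]; rewrite /F; case: asboolP => _ //.
by apply: measurableX; apply: measurable_itv.
Qed.

Lemma continuous_measurable2 (f : pt -> R) (D : set mpt) : measurable D ->
  continuous f -> measurable_fun D (f : mpt -> R).
Proof.
move=> mD cf; apply: (measurability _ (RGenOpens.measurableE R)).
move=> _ [_ [a [b ->] <-]]; apply: measurableI => //.
by apply: open_measurable2; apply: open_comp => // x _; exact: cf.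
Qed.

Definition crect (K : rect R) : set pt :=
  [set x | K.1.1 <= x.1 <= K.2.1 /\ K.1.2 <= x.2 <= K.2.2].

Lemma boxE (K : rect R) : box K = `]K.1.1, K.2.1[ `*` `]K.1.2, K.2.2[.
Proof. by apply/seteqP; split => x [] /=; rewrite !in_itv. Qed.

Lemma measurable_box (K : rect R) : measurable (box K : set mpt).
Proof. by rewrite boxE; apply: measurableX; apply: measurable_itv. Qed.

Lemma box_finite (K : rect R) : (@mu2 R (box K) < +oo)%E.
Proof.
rewrite boxE /mu2 product_measure1E; [|exact: measurable_itv|exact: measurable_itv].
have h (a b : R) : (mu1 `]a, b[ < +oo)%E.
  by rewrite lebesgue_measure_itv /=; case: ifP => // _; rewrite -EFinB ltry.
by apply: lte_mul_pinfty; rewrite ?measure_ge0 ?ge0_fin_numE ?measure_ge0 //; apply: h.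
Qed.

Lemma box_integrable (K : rect R) (f : pt -> R) (B : R) :
  measurable_fun (box K : set mpt) f -> (forall x, box K x -> `|f x| <= B) ->
  (@mu2 R).-integrable (box K) (EFin \o f).
Proof.
move=> mf fB; apply: measurable_bounded_integrable => //.
- exact: measurable_box.
- exact: box_finite.
- exists B; split => [|y By x Kx /=]; first exact: num_real.
  exact: le_trans (fB _ Kx) (ltW By).
Qed.

(** The bridge from the formal integrals [intp] to the Lebesgue integral. *)
Lemma integral_horner (r : {poly R}) (a b : R) : a < b ->
  \int[mu1]_(x in `]a, b[) r.[x] = intp r a b.
Proof.
move=> ab; have ir : mu1.-integrable `[a, b] (EFin \o horner r).
  apply: continuous_compact_integrable; first exact: segment_compact.
  by apply: continuous_subspaceT => x; exact: continuous_horner.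
rewrite Rintegral_itv_obnd_cbnd; last first.
  by apply: integrableS ir => //; apply: subset_itv; rewrite bnd_simp.
rewrite Rintegral_itv_bndo_bndc; last first.
  by apply: integrableS ir => //; apply: subset_itv; rewrite bnd_simp.
rewrite /Rintegral (@continuous_FTC2 _ _ (horner (primp r))) //.
- by apply: continuous_subspaceT => x; exact: continuous_horner.
- split => [x _||]; [exact: derivable_horner| |].
  + by apply: cvg_at_right_filter; exact: continuous_horner.
  + by apply: cvg_at_left_filter; exact: continuous_horner.
- by move=> x _; rewrite derive1E (@derive_val _ _ _ _ _ _ _ (is_derive_poly _ _)) deriv_primp.
Qed.

Lemma mk_continuous d (s : R) : continuous (mk d s : R -> pt).
Proof.
move=> t; rewrite /continuous_at; case: d => /=.
  exact: (cvg_pair cvg_id (cvg_cst _)).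
exact: (cvg_pair (cvg_cst _) cvg_id).
Qed.

Lemma continuous_box_bound (K : rect R) (f : pt -> R) : continuous f ->
  exists B, forall x, K.1.1 <= x.1 <= K.2.1 -> K.1.2 <= x.2 <= K.2.2 -> `|f x| <= B.
Proof.
move=> cf; have cK : compact ((`[K.1.1, K.2.1] : set R) `*` (`[K.1.2, K.2.2] : set R)).
  by apply: compact_setX; apply: segment_compact.
have [B [_ hB]] := compact_bounded (continuous_compact (continuous_subspaceT cf) cK).
exists (B + 1) => x h1 h2; apply: (hB (B + 1)); first by rewrite ltrDl.
by exists x => //; split; rewrite /= in_itv.
Qed.

Lemma section_integrable d (s a b : R) (f : pt -> R) : continuous f ->
  mu1.-integrable `]a, b[ (EFin \o (fun t => f (mk d s t))).
Proof.
move=> cf; have ir : mu1.-integrable `[a, b] (EFin \o (fun t => f (mk d s t))).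
  apply: continuous_compact_integrable; first exact: segment_compact.
  by apply: continuous_subspaceT => t; apply: (@continuous_comp _ _ _ (mk d s)); [exact: mk_continuous|exact: cf].
by apply: integrableS ir => //; apply: subset_itv; rewrite bnd_simp.
Qed.

(** The order of integration is free because integration by parts in either variable needs that
    variable innermost. *)
Lemma box_fubini d (K : rect R) (f : pt -> R) : continuous f ->
  (@mu2 R).-integrable (box K) (EFin \o f) /\
  \int[@mu2 R]_(x in box K) f x =
  \int[mu1]_(s in `]crd d K.1, crd d K.2[)
    \int[mu1]_(t in `]crd (~~ d) K.1, crd (~~ d) K.2[) f (mk d s t).
Proof.
move=> cf; have [B hB] := continuous_box_bound K cf; have mb := measurable_box K.
have iK : (@mu2 R).-integrable (box K) (EFin \o f).
  apply: (box_integrable (B := B)); first exact: continuous_measurable2.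
  by move=> x [/andP[a b] /andP[a' b']]; apply: hB; rewrite !ltW.
split => //; set A := `]crd d K.1, crd d K.2[%classic; set A' := `]crd (~~ d) K.1, crd (~~ d) K.2[%classic.
have iT : (@mu2 R).-integrable setT (EFin \o (f \_ (box K))).
  by rewrite -restrict_EFin; apply/integrable_restrict => //; rewrite setTI.
rewrite [LHS]Rintegral_mkcond [RHS]Rintegral_mkcond /Rintegral.
set G := fun s => fine _.
have E (s t : R) : (f \_ (box K)) (mk d s t) = if s \in A then ((fun t => f (mk d s t)) \_ A') t else 0.
  rewrite /patch; have -> : (mk d s t \in box K) = (s \in A) && (t \in A').
    rewrite /A /A' boxE in_setX; case: (d) => /=; last by [].
    by rewrite andbC.
  by case: ifP => [/andP[-> ->]|] //; case: (s \in A) => //= ->.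
have I (s : R) : (\int[mu1]_t ((f \_ (box K)) (mk d s t))%:E = ((G \_ A) s)%:E)%E.
  under eq_integral do rewrite E.
  rewrite /(G \_ A) /patch; case: ifP => sA; last by rewrite integral0.
  rewrite /G fineK; last first.
    apply: integrable_fin_num; first exact: measurable_itv.
    exact: (section_integrable d s (crd (~~ d) K.1) (crd (~~ d) K.2) cf).
  rewrite [RHS]integral_mkcond; apply: eq_integral => t _.
  by rewrite /= /patch; case: ifP.
congr fine; transitivity (\int[mu1]_s \int[mu1]_t ((f \_ (box K)) (mk d s t))%:E)%E.
  by case: (d); [rewrite -(integral21_prod_meas1 iT)|rewrite -(integral12_prod_meas1 iT)].
by apply: eq_integral => s _; rewrite I.
Qed.

Lemma tensor_continuous (f g : {poly R}) : continuous (fun x : pt => f.[x.1] * g.[x.2]).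
Proof.
move=> x; apply: cvgM.
  by apply: (@continuous_comp _ _ _ fst (horner f)); [exact: cvg_fst|exact: continuous_horner].
by apply: (@continuous_comp _ _ _ snd (horner g)); [exact: cvg_snd|exact: continuous_horner].
Qed.

Lemma box_tensor (K : rect R) (f g : {poly R}) : is_rect K ->
  (@mu2 R).-integrable (box K) (EFin \o (fun x => f.[x.1] * g.[x.2])) /\
  \int[@mu2 R]_(x in box K) (f.[x.1] * g.[x.2]) = intp f K.1.1 K.2.1 * intp g K.1.2 K.2.2.
Proof.
move=> [h1 h2]; have cf := @tensor_continuous f g.
have [iK ->] := box_fubini false K cf; split => //=.
have ir (r : {poly R}) (a b : R) : mu1.-integrable `]a, b[ (EFin \o horner r).
  have ir : mu1.-integrable `[a, b] (EFin \o horner r).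
    apply: continuous_compact_integrable; first exact: segment_compact.
    by apply: continuous_subspaceT => x; exact: continuous_horner.
  by apply: integrableS ir => //; apply: subset_itv; rewrite bnd_simp.
transitivity (\int[mu1]_(s in `]K.1.1, K.2.1[) (f.[s] * intp g K.1.2 K.2.2)).
  by apply: eq_Rintegral => s _; rewrite RintegralZl //= integral_horner.
by rewrite RintegralZr // integral_horner.
Qed.

Lemma sum_sqr_le (T : Type) (s : seq T) (a : T -> R) :
  (\sum_(f <- s) a f) ^+ 2 <= (size s)%:R * \sum_(f <- s) a f ^+ 2.
Proof.
elim: s => [|f s IH]; first by rewrite !big_nil expr0n mulr0.
have Q0 : 0 <= \sum_(f <- s) a f ^+ 2 by apply: sumr_ge0 => g _; rewrite sqr_ge0.
rewrite !big_cons /= -[(size s).+1%:R]natr1 [_ + 1]addrC; set S := \sum_(g <- s) a g in IH *.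
have -> : (a f + S) ^+ 2 = a f ^+ 2 + S ^+ 2 + 2 * (a f * S) by ring.
by apply: sqrD_split; rewrite ?sqr_ge0 ?mul1r // exprMn.
Qed.

Lemma tensor_sum_continuous (s : seq ({poly R} * {poly R})) :
  continuous (fun x : pt => \sum_(f <- s) f.1.[x.1] * f.2.[x.2]).
Proof.
move=> x; elim: s => [|f r IH].
  have -> : (fun x : pt => \sum_(f <- [::]) f.1.[x.1] * f.2.[x.2]) = (fun _ => 0) :> (pt -> R).
    by apply/funext => y; rewrite big_nil.
  exact: cvg_cst.
have -> : (fun x : pt => \sum_(f <- f :: r) f.1.[x.1] * f.2.[x.2]) =
    (fun x => f.1.[x.1] * f.2.[x.2] + \sum_(f <- r) f.1.[x.1] * f.2.[x.2]) :> (pt -> R).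
  by apply/funext => y; rewrite big_cons.
by apply: cvgD; [exact: tensor_continuous|exact: IH].
Qed.

Lemma L2norm_tensor_sum (K : rect R) (s : seq ({poly R} * {poly R})) (E : R) (F : pt -> R) :
  is_rect K -> 0 <= E ->
  (forall x, F x = \sum_(f <- s) f.1.[x.1] * f.2.[x.2]) ->
  (forall f, f \in s ->
     intp (f.1 ^+ 2) K.1.1 K.2.1 * intp (f.2 ^+ 2) K.1.2 K.2.2 <= E) ->
  (@mu2 R).-integrable (box K) (EFin \o (fun x => F x ^+ 2)) /\
  \int[@mu2 R]_(x in box K) (F x ^+ 2) <= (size s)%:R ^+ 2 * E.
Proof.
move=> rK E0 /funext -> hE; have mb := measurable_box K.
have iS (r : seq ({poly R} * {poly R})) : (forall f, f \in r ->
     intp (f.1 ^+ 2) K.1.1 K.2.1 * intp (f.2 ^+ 2) K.1.2 K.2.2 <= E) ->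
    (@mu2 R).-integrable (box K) (EFin \o (fun x => \sum_(f <- r) (f.1 ^+ 2).[x.1] * (f.2 ^+ 2).[x.2])) /\
    \int[@mu2 R]_(x in box K) (\sum_(f <- r) (f.1 ^+ 2).[x.1] * (f.2 ^+ 2).[x.2]) <= (size r)%:R * E.
  elim: r => [|f r IH] h.
    have -> : (fun x : pt => \sum_(f <- [::]) (f.1 ^+ 2).[x.1] * (f.2 ^+ 2).[x.2]) = (fun _ => 0) :> (pt -> R).
      by apply/funext => x; rewrite big_nil.
    by rewrite Rintegral_cst // mul0r mul0r; split => //; apply: integrable0.
  have [i1 i2] := IH (fun g gr => h g (mem_behead (s := f :: r) gr)).
  have [j1 j2] := box_tensor (f.1 ^+ 2) (f.2 ^+ 2) rK.
  have -> : (fun x : pt => \sum_(f <- f :: r) (f.1 ^+ 2).[x.1] * (f.2 ^+ 2).[x.2]) =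
      (fun x => (f.1 ^+ 2).[x.1] * (f.2 ^+ 2).[x.2] + \sum_(f <- r) (f.1 ^+ 2).[x.1] * (f.2 ^+ 2).[x.2]) :> (pt -> R).
    by apply/funext => x; rewrite big_cons.
  split; first exact: (integrableD mb j1 i1).
  rewrite RintegralD // j2.
  have -> : (size (f :: r))%:R * E = E + (size r)%:R * E by rewrite /= -[(size r).+1%:R]natr1; ring.
  by apply: lerD => //; exact: h (mem_head _ _).
have [i1 i2] := iS s hE.
have -> : (size s)%:R ^+ 2 * E = (size s)%:R * ((size s)%:R * E) by rewrite expr2 mulrA.
have cF : continuous (fun x : pt => (\sum_(f <- s) f.1.[x.1] * f.2.[x.2]) ^+ 2).
  by move=> x; apply: cvgM; exact: tensor_sum_continuous.
split; first exact: (box_fubini false K cF).1.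
apply: (@le_trans _ _ ((size s)%:R * \int[@mu2 R]_(x in box K) (\sum_(f <- s) (f.1 ^+ 2).[x.1] * (f.2 ^+ 2).[x.2]))); last first.
  by rewrite ler_wpM2l.
rewrite -RintegralZl //; apply: le_Rintegral => //.
- exact: (box_fubini false K cF).1.
- exact: (integrableZl mb _ i1).
- move=> x _; apply: le_trans (sum_sqr_le _ _) _; rewrite ler_wpM2l //.
  by rewrite le_eqVlt (eq_bigr _ (fun f _ => exprMn _ _ _)); apply/orP; left; apply/eqP; apply: eq_bigr => f _; rewrite !horner_exp.
Qed.

Lemma dir_section b (f : pt -> R) (x : pt) (h : R) :
  f (h *: dir R b + x) = f (mk b (h + crd b x) (crd (~~ b) x)).
Proof.
have -> : h *: dir R b = mk b h 0.
  by case: b; rewrite /dir /mk; congr pair; rewrite ?scaler0 //; exact: mulr1.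
by congr f; case: b x => -[x1 x2]; congr pair; rewrite ?add0r.
Qed.

Lemma section_quotient b (f : pt -> R) (x : pt) :
  (fun h : R => h^-1 *: ((f \o shift x) (h *: dir R b) - f x)) =
  (fun h : R => h^-1 *: (((fun t => f (mk b t (crd (~~ b) x))) \o shift (crd b x)) (h *: (1 : R)) -
     (fun t => f (mk b t (crd (~~ b) x))) (crd b x))).
Proof.
apply/funext => h; rewrite /= /shift dir_section mkE.
by rewrite /GRing.scale /= mulr1.
Qed.

Lemma pderivE b (f : pt -> R) (x : pt) :
  pderiv b f x = (fun t => f (mk b t (crd (~~ b) x)))^`()%classic (crd b x).
Proof. by rewrite /pderiv derive1E /derive section_quotient. Qed.

Lemma pderivableE b (f : pt -> R) (x : pt) : derivable f x (dir R b) <->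
  derivable (fun t => f (mk b t (crd (~~ b) x))) (crd b x) 1.
Proof. by rewrite /derivable section_quotient. Qed.

Definition dpair b (f : {poly R} * {poly R}) := mk b (crd b f)^`() (crd (~~ b) f).

Lemma tensor_mk b (f : {poly R} * {poly R}) (x : pt) :
  f.1.[x.1] * f.2.[x.2] = (crd b f).[crd b x] * (crd (~~ b) f).[crd (~~ b) x].
Proof. by case: b => //=; rewrite mulrC. Qed.

Lemma tensor_sum_section b (s : seq ({poly R} * {poly R})) (x : pt) :
  (fun t => \sum_(f <- s) f.1.[(mk b t (crd (~~ b) x)).1] * f.2.[(mk b t (crd (~~ b) x)).2]) =
  horner (\sum_(f <- s) (crd (~~ b) f).[crd (~~ b) x] *: crd b f).
Proof.
apply/funext => t; rewrite horner_sum; apply: eq_bigr => f _.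
by rewrite hornerZ (tensor_mk b) !crdE mulrC.
Qed.

Lemma pderiv_tensor_sum b (s : seq ({poly R} * {poly R})) (x : pt) :
  pderiv b (fun x => \sum_(f <- s) f.1.[x.1] * f.2.[x.2]) x =
    \sum_(f <- map (dpair b) s) f.1.[x.1] * f.2.[x.2] /\
  derivable (fun x : pt => \sum_(f <- s) f.1.[x.1] * f.2.[x.2]) x (dir R b).
Proof.
rewrite pderivableE pderivE tensor_sum_section; split; last exact: derivable_horner.
rewrite derive1E (@derive_val _ _ _ _ _ _ _ (is_derive_poly _ _)) raddf_sum horner_sum big_map.
by apply: eq_bigr => f _; rewrite /= derivZ hornerZ (tensor_mk b) /dpair !crdE mulrC.
Qed.

(** Markov's inequality on sides of length at least [m] costs 12 (p+1)^4 / m^2 in the squared norm.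
    The two partial derivatives together give 24 <= 25, whence the factor 5. *)
Lemma L2norm_bounds (K : rect R) (p : nat) (s : seq ({poly R} * {poly R})) (E m : R) (F : pt -> R) :
  is_rect K -> 0 <= E -> 0 < m -> m <= K.2.1 - K.1.1 -> m <= K.2.2 - K.1.2 ->
  (forall x, F x = \sum_(f <- s) f.1.[x.1] * f.2.[x.2]) ->
  (forall f, f \in s -> [/\ (size f.1 <= p.+1)%N, (size f.2 <= p.+1)%N &
     intp (f.1 ^+ 2) K.1.1 K.2.1 * intp (f.2 ^+ 2) K.1.2 K.2.2 <= E]) ->
  L2norm (box K) F <= (size s)%:R * Num.sqrt E /\
  L2norm_grad (box K) F <= 5 * (size s)%:R * (p.+1%:R ^+ 2 / m * Num.sqrt E).
Proof.
move=> rK E0 m0 m1 m2 hF hE; have [r1 r2] := rK; have mb := measurable_box K.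
have N0 : 0 <= (size s)%:R :> R by [].
have E1 : 0 <= 12 * p.+1%:R ^+ 4 / m ^+ 2 * E.
  by rewrite mulr_ge0 // divr_ge0 ?mulr_ge0 ?exprn_ge0 // ltW.
split.
  have [_ h] := L2norm_tensor_sum rK E0 hF (fun f fs => let: And3 _ _ h := hE f fs in h).
  rewrite /L2norm -(ger0_norm N0) -sqrtr_sqr -sqrtrM ?sqr_ge0 // ler_wsqrtr //.
have D b : (@mu2 R).-integrable (box K) (EFin \o (fun x => pderiv b F x ^+ 2)) /\
    \int[@mu2 R]_(x in box K) (pderiv b F x ^+ 2) <= (size s)%:R ^+ 2 * (12 * p.+1%:R ^+ 4 / m ^+ 2 * E).
  have := @L2norm_tensor_sum K (map (dpair b) s) (12 * p.+1%:R ^+ 4 / m ^+ 2 * E) (pderiv b F) rK E1.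
  rewrite size_map; apply => [x|_ /mapP[f fs ->]].
    by rewrite (funext hF) (pderiv_tensor_sum b s x).1.
  have [s1 s2 h] := hE f fs.
  have i1 := intp_sqr_ge0 f.1 (ltW r1); have i2 := intp_sqr_ge0 f.2 (ltW r2).
  have le_m (a b' : R) : a < b' -> m <= b' - a ->
      12 * p.+1%:R ^+ 4 / (b' - a) ^+ 2 <= 12 * p.+1%:R ^+ 4 / m ^+ 2 :> R.
    move=> ab' h'; rewrite ler_wpM2l ?mulr_ge0 ?exprn_ge0 // lef_pV2 ?posrE ?exprn_gt0 ?subr_gt0 //.
    by rewrite ler_sqr // nnegrE ?(ltW m0) // subr_ge0 ltW.
  apply: (@le_trans _ _ (12 * p.+1%:R ^+ 4 / m ^+ 2 * (intp (f.1 ^+ 2) K.1.1 K.2.1 * intp (f.2 ^+ 2) K.1.2 K.2.2))); last first.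
    by rewrite ler_wpM2l // divr_ge0 ?mulr_ge0 ?exprn_ge0 // ltW.
  case: (b) => /=.
    rewrite mulrCA ler_wpM2l // (le_trans (markov_le s2 r2)) // ler_wpM2r // le_m //.
  rewrite mulrA ler_wpM2r // (le_trans (markov_le s1 r1)) // ler_wpM2r // le_m //.
have [d1 e1] := D false; have [d2 e2] := D true.
have -> : 5 * (size s)%:R * (p.+1%:R ^+ 2 / m * Num.sqrt E) =
    Num.sqrt (25 * ((size s)%:R ^+ 2 * (p.+1%:R ^+ 4 / m ^+ 2 * E))).
  have Q0 : 0 <= 5 * (size s)%:R * (p.+1%:R ^+ 2 / m) :> R.
    by rewrite !mulr_ge0 ?exprn_ge0 // invr_ge0 ltW.
  rewrite mulrA -(ger0_norm Q0) -sqrtr_sqr -sqrtrM ?sqr_ge0 //; congr Num.sqrt; field.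
  by rewrite gt_eqF.
rewrite /L2norm_grad ler_wsqrtr // RintegralD //.
apply: le_trans (lerD e1 e2) _.
have : 0 <= (size s)%:R ^+ 2 * (p.+1%:R ^+ 4 / m ^+ 2 * E).
  by rewrite mulr_ge0 ?exprn_ge0 // mulr_ge0 // divr_ge0 ?exprn_ge0 // ltW.
set Z := (size s)%:R ^+ 2 * _.
have -> : (size s)%:R ^+ 2 * (12 * p.+1%:R ^+ 4 / m ^+ 2 * E) = 12 * Z by rewrite /Z; ring.
by move=> Z0; rewrite -mulrDl ler_wpM2r // -natrD ler_nat.
Qed.

End PlaneIntegrals.

Section BoxTopology.
Variable R : realType.
Local Notation pt := (R * R)%type.

Lemma box_open (K : rect R) : open (box K).
Proof.
rewrite boxE openE => x [h1 h2].
by exists (`]K.1.1, K.2.1[, `]K.1.2, K.2.2[)%classic => //=; split; apply: open_nbhs_nbhs; split => //; exact: interval_open.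
Qed.

Lemma crect_closed (K : rect R) : closed (crect K).
Proof.
have -> : crect K = (fst @^-1` `[K.1.1, K.2.1]) `&` (snd @^-1` `[K.1.2, K.2.2]) :> set pt.
  by apply/seteqP; split => x [] /=; rewrite !in_itv.
by apply: closedI; apply: closed_comp => [x _|]; [exact: cvg_fst|exact: interval_closed|exact: cvg_snd|exact: interval_closed].
Qed.

Lemma closure_box (K : rect R) : is_rect K -> closure (box K) = crect K.
Proof.
move=> [h1 h2]; apply/seteqP; split => [x cx|x [/andP[a1 a2] /andP[b1 b2]] B /nbhs_ballP[e /= e0 he]].
  apply: crect_closed; apply: closure_subset cx => y [/andP[a b] /andP[a' b']].
  by split; rewrite !ltW.
pose w := (K.2.1 - K.1.1) + (K.2.2 - K.1.2).
have w0 : 0 < w by rewrite addr_gt0 // subr_gt0.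
(* [x] is moved towards the centre of the box by a fraction [t] so small that the displacement, at
   most [t * w], stays below [e]. *)
pose t := e / (e + w); have t0 : 0 < t by rewrite divr_gt0 // addr_gt0.
have t1 : t < 1.
  have ew : 0 < e + w by rewrite addr_gt0.
  by rewrite /t ltr_pdivrMr //; lra.
have tw : t * w < e.
  have ew : 0 < e + w by rewrite addr_gt0.
  by rewrite /t mulrAC ltr_pdivrMr //; nra.
have I (l u z : R) : l < u -> l <= z <= u -> l < z + t * ((l + u) / 2 - z) < u.
  by move=> lu /andP[lz zu]; nra.
have J (l u z : R) : l < u -> l <= z <= u -> u - l <= w -> `|t * ((l + u) / 2 - z)| < e.
  move=> lu /andP[lz zu] uw; apply: le_lt_trans tw; rewrite normrM (gtr0_norm t0) ler_wpM2l ?(ltW t0) //.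
  by rewrite ler_norml; apply/andP; split; lra.
exists (x.1 + t * ((K.1.1 + K.2.1) / 2 - x.1), x.2 + t * ((K.1.2 + K.2.2) / 2 - x.2)); split.
  by split; apply: I => //; apply/andP.
apply: he; split; rewrite /ball /= opprD addNKr normrN; apply: J; rewrite ?a1 ?a2 ?b1 ?b2 //.
  by rewrite lerDl subr_ge0 ltW.
by rewrite lerDr subr_ge0 ltW.
Qed.

Lemma bd_box (K : rect R) : is_rect K -> bd (box K) = crect K `\` box K.
Proof. move=> rK; rewrite /bd closure_box //; congr (_ `\` _).
apply/seteqP; split => [|x Kx]; first exact: interior_subset.
by apply: open_nbhs_nbhs; split; [exact: box_open|]. Qed.

Lemma seg_ptE d (a l h t : R) : seg_pt (mk d a l, mk d a h) t = mk d a (l + t * (h - l)).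
Proof.
rewrite /seg_pt /=; case: d; apply: injective_projections => /=;
  rewrite /GRing.scale /= ?/GRing.scale /=; ring.
Qed.

Lemma edist_mk d (a l h : R) : l <= h -> Defs.edist (mk d a l) (mk d a h) = h - l.
Proof.
move=> lh; rewrite /Defs.edist; case: d => /=; rewrite subrr expr0n ?add0r ?addr0 sqrtr_sqr;
  by rewrite distrC ger0_norm // subr_ge0.
Qed.

Lemma seg_int_section d (a lo l h hi : R) (A : set pt) (f : pt -> R) (r : {poly R}) :
  lo <= l -> l < h -> h <= hi ->
  (forall t, lo <= t <= hi -> A (mk d a t) <-> l <= t <= h) ->
  (forall t, f (mk d a t) = r.[t]) ->
  seg_int (mk d a lo, mk d a hi) A f = intp r l h.
Proof.
move=> h1 h2 h3 hA hf; have L0 : 0 < hi - lo by lra.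
rewrite /seg_int /= edist_mk; last lra.
set S := [set t | _].
have -> : S = `[(l - lo) / (hi - lo), (h - lo) / (hi - lo)]%classic.
  apply/seteqP; split => t; rewrite /S /= in_itv /= seg_ptE ler_pdivrMr // ler_pdivlMr //.
    move=> [/andP[t0 t1]] /hA H; have /H : lo <= lo + t * (hi - lo) <= hi by nra.
    by move=> /andP[a1 a2]; apply/andP; split; lra.
  move=> /andP[a1 a2]; have t0 : 0 <= t by nra.
  have t1 : t <= 1 by nra.
  by rewrite t0 t1; split => //; apply/hA; apply/andP; split; nra.
pose s := (hi - lo) *: 'X + lo%:P.
have sE t : (r \Po s).[t] = f (seg_pt (mk d a lo, mk d a hi) t).
  by rewrite seg_ptE hf horner_comp /s hornerD hornerZ hornerX hornerC addrC mulrC.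
under eq_Rintegral do rewrite -sE.
have ab : (l - lo) / (hi - lo) < (h - lo) / (hi - lo) by rewrite ltr_pM2r ?invr_gt0 //; lra.
have E := integral_horner (r \Po s) ab.
have ir : (@lebesgue_measure R).-integrable `[(l - lo) / (hi - lo), (h - lo) / (hi - lo)] (EFin \o horner (r \Po s)).
  apply: continuous_compact_integrable; first exact: segment_compact.
  by apply: continuous_subspaceT => x; exact: continuous_horner.
rewrite Rintegral_itv_obnd_cbnd in E; last first.
  by apply: integrableS ir => //; apply: subset_itv; rewrite bnd_simp.
rewrite Rintegral_itv_bndo_bndc in E; last first.
  by apply: integrableS ir => //; apply: subset_itv; rewrite bnd_simp.
rewrite E /s intp_shift ?gt_eqF // mulrC divfK ?gt_eqF //.
by congr intp; rewrite mulrC divfK ?gt_eqF // subrK.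
Qed.

Lemma seg_int_ge0 (s : pt * pt) (A : set pt) (f : pt -> R) :
  (forall x, 0 <= f x) -> 0 <= seg_int s A f.
Proof.
move=> f0; rewrite mulr_ge0 ?sqrtr_ge0 //; apply: Rintegral_ge0 => t _; exact: f0.
Qed.

(** All other summands are nonnegative, so the norm controls a single one. The side of [i] is
    [lo, hi], the part shared with [j] is [l, h]. *)
Lemma jump_norm_ge (n : nat) (M : n.-tuple (rect R)) (W : {set 'I_n}) (wt : R -> R)
    (v : 'I_n -> pt -> R) (i j : 'I_n) d (a lo l h hi : R) (r : {poly R}) :
  (i < j)%N -> mside M i j `<=` union_of M W ->
  (mk d a lo, mk d a hi) \in sides (tnth M i) ->
  lo <= l -> l < h -> h <= hi ->
  (forall t, lo <= t <= hi -> mside M i j (mk d a t) <-> l <= t <= h) ->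
  (forall t, (v i (mk d a t) - v j (mk d a t)) ^+ 2 = (r ^+ 2).[t]) ->
  wt (mside_h M i j) ^+ 2 * intp (r ^+ 2) l h <= jump_norm M W wt v ^+ 2.
Proof.
move=> ij hW hs h1 h2 h3 hA hr; set k := wt _.
have b0 i' j' : 0 <= bd_int (tnth M i') (mside M i' j')
    (fun x => (wt (mside_h M i' j') * (v i' x - v j' x)) ^+ 2).
  by apply: sumr_ge0 => s _; apply: seg_int_ge0 => x; rewrite sqr_ge0.
rewrite /jump_norm sqr_sqrtr; last by apply: sumr_ge0 => ? _; apply: sumr_ge0 => ? _; exact: b0.
rewrite (bigD1 i) //= (bigD1 j) /=; last by rewrite ij; apply/asboolP.
rewrite -addrA; apply: ler_wpDr.
  apply: addr_ge0; first by apply: sumr_ge0 => ? _; exact: b0.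
  by apply: sumr_ge0 => ? _; apply: sumr_ge0 => ? _; exact: b0.
rewrite /bd_int (big_rem _ hs) /=; apply: ler_wpDr.
  by apply: sumr_ge0 => s _; apply: seg_int_ge0 => x; rewrite sqr_ge0.
rewrite (@seg_int_section d a lo l h hi _ _ (k ^+ 2 *: r ^+ 2)) ?intpZ // => t.
by rewrite hornerZ -hr exprMn.
Qed.

End BoxTopology.

(** * Cartesian meshes of Lipschitz domains *)

Section MeshGeometry.
Variables (R : realType) (Om : set (R * R)) (n : nat) (M : n.-tuple (rect R)).
Local Notation pt := (R * R)%type.
Implicit Types (i j k : 'I_n) (d e : bool) (x y z : pt) (q c : bool * bool).
Local Notation ext := (ext M).
Local Notation lo := (ext false).
Local Notation hi := (ext true).
Local Notation hasq := (hasq M).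
Local Notation cl := (cl M).

Hypothesis HC : cartesian_mesh Om M.
Hypothesis oOm : open Om.
Hypothesis HL : lipschitz_boundary Om.

Lemma bool_neq d d' : d' != d -> d' = ~~ d. Proof. by case: d d' => [] []. Qed.

Lemma mesh_rect i : is_rect (tnth M i).
Proof. by case: HC => _ h _ _ _; have [] := h _ (mem_tnth i M). Qed.

Lemma ext_lt d i : lo d i < hi d i.
Proof. by have [h1 h2] := mesh_rect i; case: d. Qed.

Lemma crectP i x : crect (tnth M i) x <-> cl i x.
Proof.
split => [[h1 h2]|/(clP M false)[h1 h2]]; last by split.
by apply/(clP M false).
Qed.

Lemma boxP d i x : box (tnth M i) x <->
  lo d i < crd d x < hi d i /\ lo (~~ d) i < crd (~~ d) x < hi (~~ d) i.
Proof. by case: d => /=; split => -[]. Qed.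

Lemma closureP i x : closure (box (tnth M i)) x <-> cl i x.
Proof. by rewrite closure_box ?crectP //; exact: mesh_rect. Qed.

Lemma bdP i x : bd (box (tnth M i)) x <-> cl i x /\ ~ box (tnth M i) x.
Proof. by rewrite bd_box; [split => -[/crectP]|exact: mesh_rect]. Qed.

Lemma closureOmP x : closure Om x <-> exists i, cl i x.
Proof.
have [_ _ _ -> _] := HC; split => [[K /tnthP[i ->] /closureP]|[i ci]]; first by exists i.
by exists (tnth M i); [exact: mem_tnth|apply/closureP].
Qed.

Lemma tnth_inj i j : tnth M i = tnth M j -> i = j.
Proof.
by have [/tuple_uniqP inj _ _ _ _] := HC; apply: inj.
Qed.

Lemma germ_overlap s (l u l' u' t : R) : inI s l u t -> inI s l' u' t ->
  exists e : R, 0 < e /\ forall a, 0 < a <= e ->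
    l < t + (if s then a else - a) < u /\ l' < t + (if s then a else - a) < u'.
Proof.
case: s => /= /andP[a1 a2] /andP[b1 b2].
  exists (Num.min (u - t) (u' - t) / 2); rewrite divr_gt0 ?lt_min ?subr_gt0 ?a2 ?b2 //; split => // a.
  rewrite ler_pdivlMr // le_min => /andP[a0 /andP[h1 h2]].
  by split; apply/andP; split; lra.
exists (Num.min (t - l) (t - l') / 2); rewrite divr_gt0 ?lt_min ?subr_gt0 ?a1 ?b1 //; split => // a.
rewrite ler_pdivlMr // le_min => /andP[a0 /andP[h1 h2]].
by split; apply/andP; split; lra.
Qed.

Lemma mesh_uniq i j x q : hasq i x q -> hasq j x q -> i = j.
Proof.
move=> /(hasqP M false)[h1 h2] /(hasqP M false)[h1' h2']; apply/eqP/contraT => ij.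
have [_ _ H _ _] := HC; have := H _ _ (mem_tnth i M) (mem_tnth j M).
have [a [a0 ha]] := germ_overlap h1 h1'; have [b [b0 hb]] := germ_overlap h2 h2'.
have [a1 a2] := ha a (introT andP (conj a0 (lexx _))).
have [b1 b2] := hb b (introT andP (conj b0 (lexx _))).
move=> /(_ (fun E => elimN eqP ij (tnth_inj E))) E0; exfalso.
pose z : pt := mk false (crd false x + (if crd false q then a else - a))
  (crd true x + (if crd true q then b else - b)).
have : (box (tnth M i) `&` box (tnth M j)) z.
  by split; apply/(boxP false).
by rewrite E0.
Qed.

Lemma sidesP i s : s \in sides (tnth M i) <-> exists d e,
  s = (mk d (ext e d i) (lo (~~ d) i), mk d (ext e d i) (hi (~~ d) i)).
Proof.
rewrite /sides !inE; split.
  case/or4P => /eqP ->; [exists true, false|exists true, true|exists false, false|exists false, true];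
    by rewrite /ext /=; case: (tnth M i) => -[? ?] [? ?].
move=> [[] [[] ->]]; rewrite /ext /=; case: (tnth M i) => -[? ?] [? ?] /=; by rewrite eqxx ?orbT.
Qed.

Lemma segP d (a l h : R) x : l <= h -> seg (mk d a l, mk d a h) x <->
  crd d x = a /\ l <= crd (~~ d) x <= h.
Proof.
move=> lh; split => [[t /andP[t0 t1] <-]|[<- /andP[h1 h2]]].
  by rewrite seg_ptE !crdE; split => //; apply/andP; split; nra.
have [E|N] := eqVneq l h.
  exists 0; first by apply/andP; split.
  rewrite seg_ptE mul0r addr0; have -> : l = crd (~~ d) x by apply/le_anti; rewrite h1 E h2.
  by rewrite mkE.
have L0 : 0 < h - l by rewrite subr_gt0 lt_neqAle N.
exists ((crd (~~ d) x - l) / (h - l)).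
  by rewrite /= divr_ge0 ?subr_ge0 //= ler_pdivrMr // mul1r lerD2r.
by rewrite seg_ptE divfK ?gt_eqF // addrC subrK mkE.
Qed.

(** Next to [x] the two elements share the boundary points [y t] for all small t. Two of them
    exclude an intersection of at most one point and show that the common segment is perpendicular
    to [d]; being a whole side of one of the elements, it is contained in the facing side of the
    other. *)
Lemma mesh_side i j x d q : i != j -> hasq i x q -> hasq j x (upd d q (~~ crd d q)) ->
  (lo (~~ d) j <= lo (~~ d) i /\ hi (~~ d) i <= hi (~~ d) j) \/
  (lo (~~ d) i <= lo (~~ d) j /\ hi (~~ d) j <= hi (~~ d) i).
Proof.
move=> ij hq hq'; have /(hasqP M d)[h1 h2] := hq; have /(hasqP M d)[] := hq'.
rewrite /upd !crdE => h1' h2'.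
have xi : crd d x = ext (~~ crd d q) d i.
  have K : ~~ inI (~~ crd d q) (lo d i) (hi d i) (crd d x).
    apply/negP => h; case/negP: ij; apply/eqP.
    by apply: (mesh_uniq _ hq'); apply/(hasqP M d); rewrite /upd !crdE.
  by rewrite (inI_end h1 K); case: (crd d q).
have xj : crd d x = ext (crd d q) d j.
  have K : ~~ inI (~~ ~~ crd d q) (lo d j) (hi d j) (crd d x).
    apply/negP => h; case/negP: ij; apply/eqP; rewrite negbK in h.
    by apply: (mesh_uniq hq); apply/(hasqP M d).
  by rewrite (inI_end h1' K); case: (crd d q).
have [b [b0 hb]] := germ_overlap h2 h2'.
have B (t : R) k e : lo (~~ d) k < t < hi (~~ d) k -> crd d x = ext e d k ->
    bd (box (tnth M k)) (mk d (crd d x) t).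
  move=> /andP[t1 t2] hx; apply/bdP; split.
    apply/(clP M d); rewrite !crdE hx (ltW t1) (ltW t2); split => //.
    by have := ext_lt d k; case: (e) => h; rewrite lexx ?andbT /= ltW.
  by move=> /(boxP d)[]; rewrite !crdE hx; case: (e); rewrite ltxx ?andbF.
pose y t : pt := mk d (crd d x) (crd (~~ d) x + (if crd (~~ d) q then t else - t)).
have Y t : 0 < t <= b -> (bd (box (tnth M i)) `&` bd (box (tnth M j))) (y t).
  by move=> /hb[t1 t2]; split; apply: B; eauto.
have Yb : 0 < b <= b by rewrite b0 lexx.
have Yb2 : 0 < b / 2 <= b by apply/andP; split; lra.
have yy : y b <> y (b / 2).
  move=> /(congr1 (crd (~~ d))); rewrite !crdE; case: (crd (~~ d) q); lra.
have [_ _ _ _ H] := HC.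
have := H _ _ (mem_tnth i M) (mem_tnth j M) (fun E => elimN eqP ij (tnth_inj E)).
case=> [u|[s]]; first by case: yy; apply: u; apply: Y.
have S k l : k != l -> bd (box (tnth M k)) `&` bd (box (tnth M l)) = seg s ->
    s \in sides (tnth M k) -> seg s (y b) -> seg s (y (b / 2)) ->
    lo (~~ d) l <= lo (~~ d) k /\ hi (~~ d) k <= hi (~~ d) l.
  move=> kl E /sidesP[d' [e sE]] s1 s2; have l1 := ext_lt (~~ d') k.
  have dd : d' = d.
    apply/eqP; apply: contraT => dd; have dE := bool_neq dd.
    subst d'; move: s1 s2; rewrite sE => /segP-/(_ (ltW l1))[a1 _] /segP-/(_ (ltW l1))[a2 _].
    by case: yy; rewrite -(mkE d (y b)) -(mkE d (y (b / 2))) a1 a2 !crdE.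
  subst d'; have P t : lo (~~ d) k <= t <= hi (~~ d) k -> lo (~~ d) l <= t <= hi (~~ d) l.
    move=> ht; have : seg s (mk d (ext e d k) t) by rewrite sE; apply/segP; [exact: ltW|rewrite !crdE].
    by rewrite -E => -[_ /bdP[/(clP M d)[_ ]]]; rewrite !crdE.
  have /andP[-> _] := P (lo (~~ d) k) (introT andP (conj (lexx _) (ltW l1))).
  by have /andP[_ ->] := P (hi (~~ d) k) (introT andP (conj (ltW l1) (lexx _))).
have [Y1 Y2] := (Y _ Yb, Y _ Yb2).
rewrite mem_cat => /orP[si|sj] E; rewrite E in Y1 Y2; first by left; apply: (S i j).
by right; apply: (S j i) => //; rewrite 1?eq_sym // setIC.
Qed.

Lemma seq_gap (s : seq R) (x : R) : exists2 e : R, 0 < e &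
  forall y : R, y \in s -> y != x -> e < `|y - x|.
Proof.
elim: s => [|a s [e e0 he]]; first by exists 1.
have [->|ax] := eqVneq a x.
  by exists e => // y; rewrite inE => /orP[/eqP ->|]; [rewrite eqxx|exact: he].
have a0 : 0 < `|a - x| by rewrite normr_gt0 subr_eq0.
exists (Num.min e (`|a - x| / 2)); first by rewrite lt_min e0 divr_gt0.
move=> y; rewrite inE => /orP[/eqP ->|/he h /h]; rewrite gt_min; last by move=> ->.
by move=> _; apply/orP; right; lra.
Qed.

(** Within this distance, points lie on the same side as [x] of every grid line that misses [x];
    thus the germs at [x] and the elements at nearby points determine each other. *)
Lemma grid_gap x : exists2 e : R, 0 < e &
  forall d b i, ext b d i != crd d x -> e < `|ext b d i - crd d x|.
Proof.
have [e1 e10 h1] := seq_gap [seq ext p.1 false p.2 | p : bool * 'I_n] (crd false x).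
have [e2 e20 h2] := seq_gap [seq ext p.1 true p.2 | p : bool * 'I_n] (crd true x).
exists (Num.min e1 e2); first by rewrite lt_min e10.
move=> [] b i hb; rewrite gt_min; apply/orP; [right; apply: h2|left; apply: h1] => //;
  by apply/mapP; exists (b, i); rewrite ?mem_enum.
Qed.

Definition in_quadrant x q z := forall d, if crd d q then crd d x <= crd d z else crd d z <= crd d x.

Lemma quadrant_cl x q z (g : R) k : (forall d b i, ext b d i != crd d x -> g < `|ext b d i - crd d x|) ->
  in_quadrant x q z -> (forall d, `|crd d z - crd d x| < g) -> hasq k x q -> cl k z.
Proof.
move=> hg hz hd /forallP hq; apply/forallP => d; have := hq d; have := hz d; have := hd d.
have G b : ext b d k = crd d x \/ g < `|ext b d k - crd d x|.
  by have [->|/hg] := eqVneq (ext b d k) (crd d x); [left|right].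
case: (crd d q) => /= h h' /andP[a1 a2].
  apply/andP; split; first lra.
  case: (G true) => [E|]; first by rewrite E ltxx in a2.
  rewrite ger0_norm in h; last lra.
  by rewrite ger0_norm; lra.
apply/andP; split; last lra.
case: (G false) => [E|]; first by rewrite E ltxx in a1.
rewrite ler0_norm in h; last lra.
by rewrite ler0_norm; lra.
Qed.

Lemma quadrant_hasq x q z (g : R) k : (forall d b i, ext b d i != crd d x -> g < `|ext b d i - crd d x|) ->
  in_quadrant x q z -> (forall d, `|crd d z - crd d x| < g) -> hasq k z q -> hasq k x q.
Proof.
move=> hg hz hd /forallP hq; apply/forallP => d; have := hq d; have := hz d; have := hd d.
have G b : ext b d k = crd d x \/ g < `|ext b d k - crd d x|.
  by have [->|/hg] := eqVneq (ext b d k) (crd d x); [left|right].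
case: (crd d q) => /= h h' /andP[a1 a2].
  rewrite ger0_norm in h; last lra.
  apply/andP; split; last lra.
  case: (G false) => [->//|]; case: (lerP (lo d k) (crd d x)) => // h2.
  by move=> h3; exfalso; lra.
rewrite ler0_norm in h; last lra.
apply/andP; split; first lra.
case: (G true) => [->//|]; case: (lerP (crd d x) (hi d k)) => // h2.
by move=> h3; exfalso; lra.
Qed.

Definition qpt x q (t : R) : pt :=
  (x.1 + (if q.1 then t else - t), x.2 + (if q.2 then t else - t)).

Lemma qpt_crd d x q t : crd d (qpt x q t) = crd d x + (if crd d q then t else - t).
Proof. by case: d. Qed.

Lemma qpt_hasq x q (g t : R) k : (forall d b i, ext b d i != crd d x -> g < `|ext b d i - crd d x|) ->
  0 < t < g -> cl k (qpt x q t) -> hasq k x q.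
Proof.
move=> hg /andP[t0 tg] /forallP hk; apply/forallP => d; have := hk d; rewrite qpt_crd.
have G b : ext b d k = crd d x \/ g < `|ext b d k - crd d x|.
  by have [->|/hg] := eqVneq (ext b d k) (crd d x); [left|right].
case: (crd d q) => /= /andP[a1 a2].
  apply/andP; split; last lra.
  case: (G false) => [->//|]; case: (lerP (lo d k) (crd d x)) => // h2.
  by move=> h3; exfalso; lra.
apply/andP; split; first lra.
case: (G true) => [->//|]; case: (lerP (crd d x) (hi d k)) => // h2.
by move=> h3; exfalso; lra.
Qed.

Lemma Om_covered x q : Om x -> exists k, hasq k x q.
Proof.
move=> Ox; have [g g0 hg] := grid_gap x.
have := oOm; rewrite openE => /(_ x Ox)/nbhs_ballP[e /= e0 he].
pose t := Num.min e g / 2; have t0 : 0 < t by rewrite divr_gt0 // lt_min e0 g0.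
have [te tg] : t < e /\ t < g.
  by apply/andP; rewrite -lt_min /t ltr_pdivrMr // ltr_pMr ?lt_min ?e0 ?g0 // ltr1n.
have Oy : Om (qpt x q t).
  apply: he; split; rewrite /ball /= opprD addNKr normrN; case: ifP => _;
    by rewrite ?normrN gtr0_norm.
have /closureOmP[k ck] := subset_closure Oy.
by exists k; apply: (qpt_hasq hg _ ck); rewrite t0.
Qed.

Lemma not_Om_bd x : (exists k, cl k x) -> ~ Om x <-> bd Om x.
Proof.
move=> hx; have iO : interior Om = Om.
  apply/seteqP; split => [|y Oy]; first exact: interior_subset.
  by apply: open_nbhs_nbhs.
by rewrite /bd iO; split => [nO|[]//]; split => //; apply/closureOmP.
Qed.

(* u is the vertical direction of the local graph. *)
Lemma lipschitz_cone x : bd Om x -> exists (u : pt) (t0 : R), [/\ u.1 ^+ 2 + u.2 ^+ 2 = 1, 0 < t0 &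
  forall t, 0 < t < t0 -> Om (x.1 + t * u.1, x.2 + t * u.2) /\
     ~ closure Om (x.1 - t * u.1, x.2 - t * u.2)].
Proof.
move=> bx; have [r [c [s [L [phi [r0 cs hphi hO]]]]]] := HL bx.
have [cx nx] := bx; have nO : ~ Om x by apply/(not_Om_bd _).2 => //; apply/closureOmP.
pose h (y : pt) := (x.1 - y.1) ^+ 2 + (x.2 - y.2) ^+ 2.
have hE y : (Defs.edist x y < r) = (h y < r ^+ 2).
  by rewrite -[r in LHS](ger0_norm (ltW r0)) -sqrtr_sqr ltr_sqrt // exprn_gt0.
pose F (y : pt) := phi (c * y.1 + s * y.2) - (c * y.2 - s * y.1).
have hOF y : h y < r ^+ 2 -> Om y <-> F y < 0 by rewrite -hE /F subr_lt0 => /hO.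
have cphi : continuous phi.
  move=> t; apply/cvgrPdist_lt => e e0; near=> y.
  have L1 : 0 < `|L| + 1 by rewrite ltr_wpDl.
  have : `|t - y| < e / (`|L| + 1) by near: y; apply: cvgr_dist_lt; rewrite ?divr_gt0.
  rewrite ltr_pdivlMr // => h1; apply: le_lt_trans (hphi t y) _; apply: le_lt_trans h1.
  rewrite mulrC ler_wpM2l // (le_trans (ler_norm L)) // lerDl //.
have c1 : continuous (fst : pt -> R) by move=> y; exact: cvg_fst.
have c2 : continuous (snd : pt -> R) by move=> y; exact: cvg_snd.
have cF : continuous F.
  move=> y; apply: cvgB.
    apply: (@continuous_comp _ _ _ (fun y : pt => c * y.1 + s * y.2) phi); last exact: cphi.
    by apply: cvgD; apply: cvgMr; [exact: c1|exact: c2].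
  by apply: cvgB; apply: cvgMr; [exact: c2|exact: c1].
have ch : continuous h.
  move=> y; apply: cvgD; rewrite /=.
    by apply: (cvgM (f := fun y : pt => x.1 - y.1)); apply: cvgB; [exact: cvg_cst|exact: c1|exact: cvg_cst|exact: c1].
  by apply: (cvgM (f := fun y : pt => x.2 - y.2)); apply: cvgB; [exact: cvg_cst|exact: c2|exact: cvg_cst|exact: c2].
have clF z : closure Om z -> h z < r ^+ 2 -> F z <= 0.
  move=> cz hz; rewrite leNgt; apply/negP => Fz.
  have [y [Oy [/= y1 y2]]] : Om `&` [set y | h y < r ^+ 2 /\ 0 < F y] !=set0.
    apply: cz; apply: filterI.
      by apply: open_nbhs_nbhs; split => //; apply: (open_comp (f := h)) (@open_lt _ _) => y _; exact: ch.
    by apply: open_nbhs_nbhs; split => //; apply: (open_comp (f := F)) (@open_gt _ _) => y _; exact: cF.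
  by have := (hOF y y1).1 Oy; rewrite ltNge (ltW y2).
have hx : h x < r ^+ 2 by rewrite /h !subrr expr0n addr0 exprn_gt0.
have Fx : F x = 0.
  apply/le_anti; rewrite clF //= leNgt; apply/negP => H; apply: nO; exact/(hOF x hx).
exists (- s, c), r; split => [||t /andP[t0 tr]] //=; first by rewrite sqrrN addrC.
have E1 : h (x.1 + t * - s, x.2 + t * c) = t ^+ 2 by rewrite /h /= -[RHS]mulr1 -cs; ring.
have E2 : h (x.1 - t * - s, x.2 - t * c) = t ^+ 2 by rewrite /h /= -[RHS]mulr1 -cs; ring.
have tr2 : t ^+ 2 < r ^+ 2 by rewrite ltr_sqr // nnegrE ltW.
have F1 : F (x.1 + t * - s, x.2 + t * c) = F x - t.
  rewrite /F /= -[t in RHS]mulr1 -cs.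
  have -> : c * (x.1 + t * - s) + s * (x.2 + t * c) = c * x.1 + s * x.2 by ring.
  ring.
have F2 : F (x.1 - t * - s, x.2 - t * c) = F x + t.
  rewrite /F /= -[t in RHS]mulr1 -cs.
  have -> : c * (x.1 - t * - s) + s * (x.2 - t * c) = c * x.1 + s * x.2 by ring.
  ring.
split; first by apply/hOF; rewrite ?E1 // F1 Fx sub0r oppr_lt0.
move=> /clF; rewrite E2 F2 Fx add0r => /(_ tr2); by rewrite leNgt t0.
Unshelve. all: by end_near.
Qed.

Lemma compatible_quadrant (u : pt) : exists q, forall d, if crd d q then 0 <= crd d u else crd d u <= 0.
Proof.
by exists (0 <= u.1, 0 <= u.2) => -[] /=; case: (lerP 0) => // /ltW.
Qed.

Definition oppq q := (~~ q.1, ~~ q.2).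

Lemma crd_oppq d q : crd d (oppq q) = ~~ crd d q. Proof. by case: d. Qed.

(** A quadrant containing the inward direction of the local graph is covered, and the opposite one,
    containing the outward direction, is not. *)
Lemma bd_quadrant x : bd Om x -> exists q, (exists k, hasq k x q) /\ (forall k, ~~ hasq k x (oppq q)).
Proof.
move=> bx; have [u [t0 [hu t00 hc]]] := lipschitz_cone bx.
have [g g0 hg] := grid_gap x; have [q hq] := compatible_quadrant u.
pose t := Num.min t0 g / 2; have tp : 0 < t by rewrite divr_gt0 // lt_min t00.
have [tt tg] : t < t0 /\ t < g.
  by apply/andP; rewrite -lt_min /t ltr_pdivrMr // ltr_pMr ?lt_min ?t00 ?g0 // ltr1n.
have [OP ON] := hc t (introT andP (conj tp tt)).
have ub d : `|crd d u| <= 1.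
  apply: norm_le_sqr => //; rewrite expr1n -hu.
  by case: d => /=; rewrite ?lerDl ?lerDr sqr_ge0.
have tu d : `|t * crd d u| < g.
  by apply: le_lt_trans tg; rewrite normrM (gtr0_norm tp) ler_piMr // ltW.
exists q; split.
  have [k hk] := Om_covered q OP; exists k; apply: (quadrant_hasq hg _ _ hk).
    by move=> d; have := hq d; case: (crd d q); case: (d) => /= h; nra.
  by move=> d; have := tu d; case: (d) => /=; rewrite addrC addKr.
move=> k; apply/negP => hk; apply: ON; apply/closureOmP; exists k.
apply: (quadrant_cl hg _ _ hk) => d.
  by have := hq d; rewrite crd_oppq; case: (crd d q); case: (d) => /= h; nra.
by have := tu d; case: (d) => /=; rewrite opprD addrC addKr normrN || rewrite addrC addKr normrN.
Qed.

(** Inside [Om] every quadrant is covered. At a boundary point, [bd_quadrant] gives a covered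
    quadrant with uncovered opposite; it is neither [q] nor its opposite, both being covered, hence
    it is adjacent to [q]. *)
Lemma mesh_diag i j x q : hasq i x q -> hasq j x (oppq q) ->
  exists d k, hasq k x (upd d q (~~ crd d q)).
Proof.
move=> hi hj; have [Ox|nO] := pselect (Om x).
  by exists false; apply: Om_covered.
have bx : bd Om x by apply/not_Om_bd => //; exists i; exact: hasq_cl hi.
have [p [[k hk] np]] := bd_quadrant bx.
have [E|n1] := eqVneq p q; first by have := np j; rewrite E hj.
have [E|n2] := eqVneq p (oppq q).
  have := np i; rewrite E; have -> : oppq (oppq q) = q by case: (q) => a b; rewrite /oppq /= !negbK.
  by rewrite hi.
have [E|n3] := eqVneq p (upd false q (~~ q.1)); first by exists false, k; rewrite -E.
exists true, k; suff -> : upd true q (~~ crd true q) = p by [].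
by case: p q n1 n2 n3 {hi hj np hk} => [] [] [] [[] []].
Qed.

Lemma quad_mesh_of : quad_mesh M.
Proof.
split; [exact: ext_lt|exact: mesh_uniq|exact: mesh_side|exact: mesh_diag].
Qed.

Lemma bd_uncovered x : (exists k, cl k x) -> bd Om x <-> exists q, forall k, ~~ hasq k x q.
Proof.
move=> hx; split => [/bd_quadrant[q [_ h]]|[q h]]; first by exists (oppq q).
apply/not_Om_bd => // Ox; have [k hk] := Om_covered q Ox.
by have := h k; rewrite hk.
Qed.

End MeshGeometry.

(** * Shape regularity, uniformly in the level of refinement *)

Section Sizes.
Variable R : realType.
Local Notation pt := (R * R)%type.
Implicit Types (K : rect R) (d : bool).

Definition side_len d K : R := crd d K.2 - crd d K.1.

Lemma edist_le (x y : pt) : Defs.edist x y <= `|x.1 - y.1| + `|x.2 - y.2|.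
Proof.
rewrite /Defs.edist -[leRHS]ger0_norm ?addr_ge0 // -sqrtr_sqr ler_wsqrtr //.
have h1 := real_normK (num_real (x.1 - y.1)); have h2 := real_normK (num_real (x.2 - y.2)).
have := mulr_ge0 (normr_ge0 (x.1 - y.1)) (normr_ge0 (x.2 - y.2)); rewrite -h1 -h2.
set a := `|_|; set b := `|_|; have -> : (a + b) ^+ 2 = a ^+ 2 + b ^+ 2 + 2 * (a * b) by ring.
lra.
Qed.

Lemma edist_ge d (x y : pt) : `|crd d x - crd d y| <= Defs.edist x y.
Proof.
rewrite /Defs.edist -sqrtr_sqr ler_wsqrtr //.
by case: d => /=; rewrite ?lerDl ?lerDr sqr_ge0.
Qed.

Lemma diam_has_sup (A : set pt) (B : R) : A !=set0 -> (forall x y, A x -> A y -> Defs.edist x y <= B) ->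
  has_sup [set Defs.edist z.1 z.2 | z in A `*` A].
Proof.
move=> [x Ax] h; split; first by exists (Defs.edist x x), (x, x).
by exists B => _ [[y z] [/= Ay Az] <-]; exact: h.
Qed.

Lemma diam_le (A : set pt) (B : R) : A !=set0 -> (forall x y, A x -> A y -> Defs.edist x y <= B) ->
  diam A <= B.
Proof.
move=> [x Ax] h; apply: ge_sup => [|_ [[y z] [/= Ay Az] <-]]; last exact: h.
by exists (Defs.edist x x), (x, x).
Qed.

Lemma le_diam (A : set pt) (B : R) x y : (forall x y, A x -> A y -> Defs.edist x y <= B) ->
  A x -> A y -> Defs.edist x y <= diam A.
Proof.
move=> h Ax Ay; apply: ub_le_sup; last by exists (x, y).
by have [] := diam_has_sup (ex_intro _ x Ax) h.
Qed.

Lemma le_diam_sub (A A' : set pt) (B : R) : (forall x y, A x -> A y -> Defs.edist x y <= B) ->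
  A' `<=` A -> A' !=set0 -> diam A' <= diam A.
Proof.
move=> h AA A0; apply: diam_le => // x y /AA Ax /AA Ay; exact: le_diam h Ax Ay.
Qed.

Lemma box_ne K : is_rect K -> box K !=set0.
Proof.
move=> [h1 h2]; exists ((K.1.1 + K.2.1) / 2, (K.1.2 + K.2.2) / 2).
by split => /=; apply/andP; split; lra.
Qed.

Lemma box_edist K x y : crect K x -> crect K y -> Defs.edist x y <= side_len false K + side_len true K.
Proof.
move=> [/andP[a1 a2] /andP[b1 b2]] [/andP[c1 c2] /andP[d1 d2]].
apply: le_trans (edist_le x y) _; rewrite /side_len /= lerD // ler_norml; apply/andP; split; lra.
Qed.

Lemma box_crect K : box K `<=` crect K.
Proof. by move=> x [/andP[a b] /andP[c d]]; split; rewrite !ltW. Qed.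

Lemma hK_le K : is_rect K -> hK K <= side_len false K + side_len true K.
Proof.
move=> rK; apply: diam_le (box_ne rK) _ => x y /box_crect a /box_crect b; exact: box_edist.
Qed.

Lemma hK_ge K d : is_rect K -> side_len d K <= hK K.
Proof.
move=> rK; have [r1 r2] := rK; rewrite leNgt; apply/negP => h.
have L (a b : R) : a < b -> (a + b) / 2 < b /\ a < (a + b) / 2 by move=> ?; split; lra.
pose h0 := hK K; have h00 : 0 <= h0.
  have [x Kx] := box_ne rK; apply: (@le_trans _ _ (Defs.edist x x)); first exact: sqrtr_ge0.
  by apply: (le_diam _ Kx Kx) => y z a b; exact: box_edist (box_crect a) (box_crect b).
(* A quarter of the presumed deficit: points this close to the two ends are already farther apart
   than the diameter. *)
pose e := (side_len d K - h0) / 4; have e0 : 0 < e by rewrite divr_gt0 // subr_gt0.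
have ew : e * 4 <= side_len d K by rewrite /e divfK // lerBlDr lerDl.
have ew' : e * 4 = side_len d K - h0 by rewrite /e divfK.
pose m := (crd (~~ d) K.1 + crd (~~ d) K.2) / 2.
have B t : crd d K.1 < t < crd d K.2 -> box K (mk d t m).
  move=> ht; have hm : crd (~~ d) K.1 < m < crd (~~ d) K.2.
    have : crd (~~ d) K.1 < crd (~~ d) K.2 by case: (d).
    by rewrite /m => ?; apply/andP; split; lra.
  by rewrite /box; case: (d) ht hm.
have := @le_diam (box K) _ (mk d (crd d K.2 - e) m) (mk d (crd d K.1 + e) m)
  (fun x y a b => box_edist (box_crect a) (box_crect b)).
rewrite -/(hK K) -/h0 => H; rewrite /side_len in ew ew' e0.
have : Defs.edist (mk d (crd d K.2 - e) m) (mk d (crd d K.1 + e) m) <= h0.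
  by apply: H; apply: B; apply/andP; split; lra.
have := edist_ge d (mk d (crd d K.2 - e) m) (mk d (crd d K.1 + e) m); rewrite !crdE => h1 h2.
have := le_trans (ler_norm _) (le_trans h1 h2); lra.
Qed.

Definition shape (k : R) K := forall d d', side_len d K <= k * side_len d' K.

Lemma quad_shape k K K' : is_rect K -> shape k K -> K' \in quad K -> is_rect K' /\ shape k K'.
Proof.
move=> [r1 r2] sK hK'; have S : is_rect K' /\ forall d, side_len d K' = side_len d K / 2.
  move: hK'; rewrite !inE => /or4P[]/eqP ->; (split; [split => /=; lra|case; rewrite /side_len /=; lra]).
by case: S => rK' S; split => // d d'; rewrite !S mulrA ler_pM2r ?invr_gt0.
Qed.

(** Quad-refinement halves both sides, so the aspect ratios of the initial mesh bound those of all
    its refinements. *)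
Lemma refinement_shape k (T0 T : seq (rect R)) : (forall K, K \in T0 -> is_rect K /\ shape k K) ->
  refinement T0 T -> forall K, K \in T -> is_rect K /\ shape k K.
Proof.
move=> h0; elim=> [//|s1 K s2 _ IH K'].
rewrite !mem_cat => /or3P[h|h|h].
- by apply: IH; rewrite mem_cat h.
- have [rK sK] : is_rect K /\ shape k K by apply: IH; rewrite mem_cat mem_head orbT.
  exact: quad_shape sK h.
- by apply: IH; rewrite mem_cat inE h !orbT.
Qed.

Lemma shape_exists (T0 : seq (rect R)) : (forall K, K \in T0 -> is_rect K) ->
  exists2 k : R, 0 <= k & forall K, K \in T0 -> shape k K.
Proof.
elim: T0 => [|K T IH] h; first by exists 0.
have [k k0 hk] := IH (fun K' h' => h K' (mem_behead (s := K :: T) h')).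
have [r1 r2] := h K (mem_head _ _).
have S d : 0 < side_len d K by rewrite /side_len subr_gt0; case: d.
pose a := side_len false K / side_len true K + side_len true K / side_len false K + 1.
have a0 : 0 <= a by rewrite !addr_ge0 // divr_ge0 // ltW.
exists (k + a); first by rewrite addr_ge0.
move=> K' K'T; have [q1 q2] := h K' K'T.
have S' d : 0 < side_len d K' by rewrite /side_len subr_gt0; case: d.
move: K'T; rewrite inE => /orP[/eqP ->|/hk h'] d d'; last first.
  apply: le_trans (h' d d') _; rewrite ler_wpM2r ?(ltW (S' _)) // lerDl //.
rewrite -ler_pdivrMr //.
have Q e e' : 0 <= side_len e K / side_len e' K by rewrite divr_ge0 // ltW.
have := Q false true; have := Q true false; rewrite /a.
by case: d d' => [] []; rewrite ?divff ?gt_eqF //; lra.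
Qed.

Lemma box_sub_side K K' d : is_rect K -> is_rect K' -> box K `<=` box K' -> side_len d K <= side_len d K'.
Proof.
move=> rK rK' KK; have [r1 r2] := rK.
have : crect K `<=` crect K' by rewrite -!closure_box //; exact: closure_subset.
move=> H; have K1 : crect K K.1 by split; rewrite lexx ltW.
have K2 : crect K K.2 by split; rewrite lexx ltW.
have [/andP[a1 a2] /andP[b1 b2]] := H _ K1; have [/andP[c1 c2] /andP[d1 d2]] := H _ K2.
by rewrite /side_len; case: d => /=; lra.
Qed.

(** A macro-element contains an interface element of [T] whose diameter is comparable to its own,
    hence its shorter side cannot degenerate. *)
Lemma merged_shape (G : set pt) (Om : set pt) (k C0 : R) (T M : seq (rect R)) :
  0 <= k -> (forall K, K \in T -> is_rect K /\ shape k K) -> cartesian_mesh Om M -> merged G C0 T M ->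
  forall K, K \in M -> shape (k + `|C0| * (1 + k)) K.
Proof.
move=> k0 hT [_ hM hd _ _] [_ h2 h3] K' KM; have [rK' _] := hM _ KM.
have S d : 0 < side_len d K' by rewrite /side_len subr_gt0; case: rK'; case: d.
case: (h2 _ KM) => [KT|[K [KT Ki KK]]] d d'.
  have := (hT _ KT).2 d d'; move/le_trans; apply; rewrite ler_wpM2r ?(ltW (S _)) // lerDl.
  by rewrite mulr_ge0 // addr_ge0.
have [K'' [KM' KK' hC]] := h3 _ KT Ki; have [rK sK] := hT _ KT.
(* The size bound is stated for some element containing [K]; as distinct elements are disjoint, it
   is the one at hand. *)
have E : K' = K''.
  apply: contrapT => ne; have [x Kx] := box_ne rK.
  have : (box K' `&` box K'') x by split; [exact: KK|exact: KK'].
  by rewrite (hd _ _ KM KM' ne).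
subst K''; apply: le_trans (hK_ge d rK') _; apply: le_trans hC _.
apply: le_trans (ler_wpM2r _ (ler_norm C0)) _.
  by apply: le_trans (hK_ge false rK); rewrite /side_len subr_ge0 ltW //; case: rK.
have h : hK K <= (1 + k) * side_len d' K'.
  apply: le_trans (hK_le rK) _; have := box_sub_side d' rK rK' KK.
  have := sK false d'; have := sK true d'; case: (d') => h1 h2'; nra.
apply: le_trans (ler_wpM2l (normr_ge0 C0) h) _.
by rewrite mulrA ler_wpM2r ?(ltW (S _)) // lerDr.
Qed.

End Sizes.

(** * From the K-mesh assumption to the grading of the mesh *)

Section KMesh.
Variables (R : realType) (Om : set (R * R)) (n : nat) (M : n.-tuple (rect R)).
Variables (CK kap : R).
Local Notation pt := (R * R)%type.
Implicit Types (i j k : 'I_n) (d e : bool) (x y z P Q : pt) (q c : bool * bool).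
Local Notation ext := (ext M).
Local Notation lo := (ext false).
Local Notation hi := (ext true).
Local Notation hasq := (hasq M).
Local Notation cl := (cl M).
Local Notation node := (node M).
Local Notation hang := (hang M).
Local Notation width := (width M).
Local Notation endp := (endp M).
Local Notation reach := (reach M).

Hypothesis HC : cartesian_mesh Om M.
Hypothesis oOm : open Om.
Hypothesis HL : lipschitz_boundary Om.
Hypothesis Hkap : forall i, shape kap (tnth M i).
Hypothesis HK : k_mesh Om M CK.

Let HM : quad_mesh M := quad_mesh_of HC oOm HL.

Definition free x := node x /\ forall i d, ~~ hang i x d.

Lemma vertE i x : (x \in vertices (tnth M i)) = vert M i x.
Proof.
apply/idP/vertP; rewrite /vertices !inE.
  case/or4P => /eqP ->; [exists (false, false)|exists (true, false)|exists (false, true)|exists (true, true)];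
    by rewrite /ext /=; case: (tnth M i) => -[? ?] [? ?].
by move=> [[[] []] ->]; rewrite /ext /=; case: (tnth M i) => -[? ?] [? ?] /=; rewrite eqxx ?orbT.
Qed.

(** At a node of this kind inside [Om] all quadrants are covered, by elements with a vertex there;
    such an element holds a single quadrant, so exactly four elements meet. *)
Lemma free_conforming x : free x -> conforming_node Om M x.
Proof.
move=> [nx fx]; have /existsP[i0 v0] := nx; have c0 := vert_cl HM v0.
split; first by exists i0; rewrite vertE.
have [Ox|nO] := pselect (Om x); last first.
  by left; apply/(not_Om_bd HC oOm) => //; exists i0.
right; have vS i : cl i x -> vert M i x.
  by move=> /(node_cl HM nx)[//|[d hd]]; have := fx i d; rewrite hd.
set S := [set i | _]%SET; have SE i : (i \in S) = cl i x.
  by rewrite inE; apply/asboolP/idP => /(closureP HC).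
split; last by move=> i; rewrite SE vertE => /vS.
have [f hf] := choice (fun q => Om_covered HC oOm q Ox).
have fi : injective f.
  move=> q q' E; have h1 := hf q; have h2 := hf q'; rewrite -E in h2.
  have /vS/forallP vv := hasq_cl h1.
  have D d : crd d q = crd d q'.
    have /(hasqP M d)[g1 _] := h1; have /(hasqP M d)[g2 _] := h2.
    by case/orP: (vv d) => /eqP h; rewrite h in g1 g2; rewrite (inI_ext g1) (inI_ext g2).
  by rewrite -(mkE false q) -(mkE false q') !D.
have -> : S = [set f q | q in [set: bool * bool]]%SET.
  apply/setP => i; rewrite SE; apply/idP/imsetP => [ci|[q _ ->]]; last exact: hasq_cl (hf q).
  by have [q hq] := cl_hasq HM ci; exists q; rewrite ?inE //; apply: (qm_uniq HM hq (hf q)).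
by rewrite card_imset // cardsT card_prod card_bool.
Qed.

(** The consequence of bilinearity that the maximum principle uses: affine behaviour along a side
    that carries a hanging node. *)
Definition pwlin (w : pt -> R) := forall i x d, hang i x d -> exists l : R, [/\ 0 < l, l < 1 &
  w x = (1 - l) * w (endp i d false x) + l * w (endp i d true x)].

Lemma bilinear_pwlin w : cont_pw_bilinear Om M w -> pwlin w.
Proof.
move=> [_ h] i x d hx; have [q qQ hq] := h i; have [r sr hr] := Qp_section d (crd d x) qQ.
have /hangP[e he /andP[s1 s2]] := hx; have ci := hang_cl HM hx.
set a := lo (~~ d) i; set b := hi (~~ d) i; have ab : b - a != 0 by rewrite subr_eq0 gt_eqF // (lt_trans s1).
have ab0 : 0 < b - a by rewrite subr_gt0 (lt_trans s1).
exists ((crd (~~ d) x - a) / (b - a)); split.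
- by rewrite divr_gt0 // subr_gt0.
- by rewrite ltr_pdivrMr // mul1r ltrD2r.
have E y : cl i y -> crd d y = crd d x -> w y = r.[crd (~~ d) y].
  by move=> cy hy; rewrite hq; [rewrite -hr -hy mkE|apply/(closureP HC)].
have cE e' : crd d (endp i d e' x) = crd d x by rewrite /endp /upd negbK mkN crdE.
have cE' e' : crd (~~ d) (endp i d e' x) = ext e' (~~ d) i by rewrite /endp /upd crdE.
rewrite !E ?cE' ?cE //; try exact: (endp_cl HM).
rewrite (horner_coef_wide _ sr) (horner_coef_wide _ sr) (horner_coef_wide _ sr) !big_ord_recl !big_ord0 /=.
by rewrite -/a -/b /bump /= !expr0 !expr1; field.
Qed.

Lemma reach_trans x y z : reach x y -> reach y z -> reach x z.
Proof. by move=> h; elim=> // u i d e _ IH nu hu; apply: reachS. Qed.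

Lemma reach_finite x : node x -> exists S : seq pt, forall y, reach x y <-> y \in S.
Proof.
move=> nx; exists [seq y <- [seq (corner M p.1 p.2) | p : 'I_n * (bool * bool)] | `[< reach x y >]].
move=> y; rewrite mem_filter; split => [ry|/andP[/asboolP //]].
rewrite asboolT //=; have /existsP[i /vertP[c hc]] := reach_node nx ry.
by apply/mapP; exists (i, c); rewrite ?mem_enum.
Qed.

(* x1 + x2 increases strictly towards one end of each side, which excludes cycles
   of hanging nodes. *)
Let f (x : pt) : R := x.1 + x.2.

Lemma f_endp i x d : hang i x d -> f x < f (endp i d true x).
Proof.
move=> /hangP[e _ /andP[_ s2]]; move: s2; rewrite /f /endp /upd; case: d => /= h; lra.
Qed.

Lemma reach_free x : node x -> exists2 y, reach x y & free y.
Proof.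
move=> nx; have [S hS] := reach_finite nx.
have S0 : S != [::] by apply/eqP => h; have /hS := reach0 M x; rewrite h.
have [y /hS ry ym] := @seq_argmax _ _ S f S0.
exists y => //; split; first exact: reach_node ry.
move=> i d; apply/negP => hy; have := ym _ ((hS _).1 (reachS true ry (reach_node nx ry) hy)).
by rewrite leNgt f_endp.
Qed.

(** Among the maximum points of [w] on the chain, take one where [f] is largest. If it were hanging,
    [w] would be maximal at both ends of its side as well, and [f] is larger at one of them. *)
Lemma max_principle w m x : pwlin w -> node x ->
  (forall y, reach x y -> free y -> w y <= m) -> w x <= m.
Proof.
move=> hw nx hm; have [S hS] := reach_finite nx.
have S0 : S != [::] by apply/eqP => h; have /hS := reach0 M x; rewrite h.
have [y yS ym] := @seq_argmax _ _ S w S0.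
suff wy : w y <= m by apply: le_trans wy; apply: ym; apply/hS; exact: reach0.
pose S' := [seq z <- S | w z == w y].
have S'0 : S' != [::] by apply/eqP => h; have : y \in S'; [rewrite mem_filter eqxx|rewrite h].
have [z] := @seq_argmax _ _ S' f S'0; rewrite mem_filter => /andP[/eqP wz zS] zm.
rewrite -wz; have /hS rz := zS; have nz := reach_node nx rz; apply: hm => //; split => // i d.
apply/negP => hz; have [l [l0 l1 E]] := hw _ _ _ hz.
have r1 := (hS _).1 (reachS true rz nz hz); have r2 := (hS _).1 (reachS false rz nz hz).
have w1 := ym _ r1; have w2 := ym _ r2; rewrite -wz in w1 w2.
have wt : w (endp i d true z) = w y by rewrite -wz; apply/le_anti; rewrite w1 /=; nra.
have := zm (endp i d true z); rewrite mem_filter wt eqxx r1 => /(_ isT).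
by rewrite leNgt f_endp.
Qed.

Lemma bilinear_line (q : pt -> R) x z : Qp 1 q -> exists r : {poly R}, forall t,
  q (z.1 + t * (x.1 - z.1), z.2 + t * (x.2 - z.2)) = r.[t].
Proof.
move=> [c hc]; pose l1 := (x.1 - z.1) *: 'X + z.1%:P; pose l2 := (x.2 - z.2) *: 'X + z.2%:P.
exists (\sum_(i < 2) \sum_(j < 2) c i j *: (l1 ^+ i * l2 ^+ j)) => t.
rewrite hc horner_sum; apply: eq_bigr => i _; rewrite horner_sum; apply: eq_bigr => j _ /=.
rewrite hornerZ hornerM !horner_exp /l1 /l2 !hornerD !hornerZ !hornerX !hornerC.
by rewrite (mulrC t) (addrC z.1) (mulrC t) (addrC z.2) mulrA.
Qed.

(** On the segment from a point [z] of the element to [x] the function is a polynomial in one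
    variable. If it vanished near [z], it would have too many roots and vanish at [x]. *)
Lemma supp_box w i x : cont_pw_bilinear Om M w -> cl i x -> w x != 0 -> box (tnth M i) `<=` supp Om w.
Proof.
move=> [_ h] ci wx z bz; have [q qQ hq] := h i; have cz : cl i z.
  by apply/crectP; apply: box_crect.
move=> B /nbhs_ballP[e /= e0 he]; have [r hr] := bilinear_line x z qQ.
have bOm : box (tnth M i) `<=` Om by case: HC => _ h' _ _ _; have [] := h' _ (mem_tnth i M).
pose L t : pt := (z.1 + t * (x.1 - z.1), z.2 + t * (x.2 - z.2)).
have LB t : 0 <= t -> t < 1 -> box (tnth M i) (L t).
  move=> t0 t1; have /crectP[/andP[a1 a2] /andP[b1 b2]] := ci.
  case: bz => /andP[c1 c2] /andP[d1 d2]; split; apply/andP; split; rewrite /L /=; nra.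
have wL t : 0 <= t -> t < 1 -> w (L t) = r.[t].
  by move=> t0 t1; rewrite hq ?hr //; apply: subset_closure; exact: LB.
apply: contrapT => no.
have rt t : 0 <= t -> t < 1 -> t * (`|x.1 - z.1| + `|x.2 - z.2|) < e -> r.[t] = 0.
  move=> t0 t1 te; rewrite -wL //; apply/eqP; apply: contraT => nz; case: no; exists (L t); split.
    by split => //; apply: bOm; exact: LB.
  apply: he; split; rewrite /ball /= /L /= opprD addNKr normrN normrM ger0_norm //;
    apply: le_lt_trans te; rewrite ler_wpM2l // ?lerDl ?lerDr //.
pose D := `|x.1 - z.1| + `|x.2 - z.2| + 1.
have D0 : 0 < D by rewrite ltr_wpDl // addr_ge0.
pose tau := e / (e + D); have ed : 0 < e + D by rewrite addr_gt0.
have tau0 : 0 < tau by rewrite divr_gt0.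
have r0 : r = 0.
  apply/eqP; apply: contraT => nz.
  have /= := @max_poly_roots _ r [seq tau * (m.+1%:R)^-1 | m <- iota 0 (size r)] nz.
  rewrite size_map size_iota ltnn; apply.
    apply/allP => _ /mapP[m _ ->]; set u := m.+1%:R^-1.
    have u0 : 0 < u by rewrite invr_gt0 ltr0n.
    have u1 : u <= 1 by rewrite invf_le1 ?ltr0n // ler1n.
    have tu : tau * u <= tau by rewrite ler_piMr // ltW.
    apply/eqP/rt; first by rewrite mulr_ge0 // ltW.
      by apply: le_lt_trans tu _; rewrite /tau ltr_pdivrMr // mul1r ltrDl.
    apply: (@le_lt_trans _ _ (tau * (`|x.1 - z.1| + `|x.2 - z.2|))).
      by rewrite ler_wpM2r // addr_ge0.
    rewrite /tau mulrAC ltr_pdivrMr // /D; set a := `|_| + _.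
    have : 0 <= a by rewrite addr_ge0.
    nra.
  rewrite map_inj_uniq ?iota_uniq // => a b /(mulfI (lt0r_neq0 tau0)) /invr_inj /eqP.
  by rewrite eqr_nat => /eqP [].
have := hr 1; rewrite r0 horner0 !mul1r (addrC z.1) (addrC z.2) !subrK -surjective_pairing => E.
by move: wx; rewrite hq ?E ?eqxx //; apply/(closureP HC).
Qed.

Lemma supp_bounded (w : pt -> R) : exists B, forall x y, supp Om w x -> supp Om w y -> Defs.edist x y <= B.
Proof.
pose F b d : seq R := [seq `|ext b d i| | i : 'I_n].
pose S := \sum_i (`|ext false false i| + `|ext true false i| + `|ext false true i| + `|ext true true i|).
have HS i : `|ext false false i| + `|ext true false i| + `|ext false true i| + `|ext true true i| <= S.
  by rewrite /S (bigD1 i) //= lerDl; apply: sumr_ge0 => j _; rewrite !addr_ge0.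
have G x : supp Om w x -> `|x.1| <= S /\ `|x.2| <= S.
  move=> sx; have : closure Om x by apply: closure_subset sx => y [].
  move=> /(closureOmP HC)[i ci]; have := HS i; have /(clP M false)[/= /andP[a1 a2] /andP[b1 b2]] := ci.
  have := normr_ge0 (ext false false i); have := normr_ge0 (ext true false i).
  have := normr_ge0 (ext false true i); have := normr_ge0 (ext true true i).
  have := ler_norm (ext true false i); have := ler_norm (ext true true i).
  have := ler_norm (- ext false false i); have := ler_norm (- ext false true i); rewrite !normrN.
  by move=> *; split; rewrite ler_norml; apply/andP; split; lra.
exists (S + S + (S + S)) => x y /G[x1 x2] /G[y1 y2]; apply: le_trans (edist_le x y) _.
by rewrite lerD // (le_trans (ler_normB _ _)) // lerD.
Qed.

Lemma hK_width i d : hK (tnth M i) <= (1 + kap) * width d i /\ width d i <= hK (tnth M i).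
Proof.
have rK := mesh_rect HC i; have E d' : side_len d' (tnth M i) = width d' i by [].
split; last by rewrite -E; exact: hK_ge.
apply: le_trans (hK_le rK) _; rewrite !E; have h := Hkap i.
have := h false d; have := h true d; rewrite !E; have := width_gt0 HM d i.
by case: d => ? ? ?; lra.
Qed.

(** A nodal function that is positive along a whole chain has all elements at the nodes of the chain
    in its support, whose diameter is comparable to each of them. The factor [1 + kap] passes from
    diameters to widths. *)
Lemma graded_kmesh : exists2 C, graded M C & C = `|CK| * (1 + kap) .
Proof.
have [psi [h1 h2 h3 h4]] := HK.
have Pw P : conforming_node Om M P -> pwlin (psi P).
  by move=> /h1[_ hb _]; exact: bilinear_pwlin.
have pos P x : conforming_node Om M P -> node x -> 0 <= psi P x.
  move=> cP nx; have [_ _ hd] := h1 _ cP; rewrite -oppr_le0.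
  apply: (max_principle (w := fun y => - psi P y)) => //.
    by move=> i y d /(Pw _ cP)[l [l0 l1 ->]]; exists l; split => //; ring.
  by move=> y _ /free_conforming/hd ->; rewrite oppr_le0 ler0n.
(* A conforming node that hangs would differ from all free nodes of its chain, so its own nodal
   function would be at most 0 there by the maximum principle, instead of 1. *)
have nohang P i d : conforming_node Om M P -> ~~ hang i P d.
  move=> cP; apply/negP => hP; have [_ _ hd] := h1 _ cP.
  have nP : node P by case: cP => -[k hk] _; apply/existsP; exists k; rewrite -vertE.
  have : psi P P <= 0.
    apply: max_principle => //; first exact: Pw.
    move=> y _ fy; rewrite (hd _ (free_conforming fy)); case: eqVneq => // E; subst y.
    by have := fy.2 i d; rewrite hP.
  by rewrite (hd _ cP) eqxx ler10.
(* Positivity travels backwards along the chain: the value at a hanging node is a strict convex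
   combination of nonnegative values at the two ends. *)
have posr P x y : conforming_node Om M P -> reach x y -> node x -> 0 < psi P y -> 0 < psi P x.
  move=> cP rxy nx; elim: rxy => // z i d e rz IH nz hz hp; apply: IH.
  have [l [l0 l1 ->]] := Pw _ cP _ _ _ hz.
  have a := pos _ (endp i d false z) cP (endp_node false hz); have b := pos _ (endp i d true z) cP (endp_node true hz).
  by case: e hp => hp; [rewrite ltr_wpDl ?mulr_ge0 ?mulr_gt0 ?subr_ge0 // ltW|rewrite ltr_wpDr ?mulr_ge0 ?mulr_gt0 ?subr_gt0 // ltW].
have supp_h P i j x y : conforming_node Om M P -> psi P x != 0 -> psi P y != 0 -> cl i x -> cl j y ->
    hK (tnth M i) <= CK * hK (tnth M j) /\ forall d, `|crd d y - crd d x| <= CK * hK (tnth M i).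
  move=> cP px py ci cj; have [_ hb _] := h1 _ cP; have [B hB] := supp_bounded (psi P).
  have bi := supp_box hb ci px; have bj := supp_box hb cj py.
  have di := h4 _ cP _ bi; have dj := h4 _ cP _ bj.
  split; first by apply: le_trans dj; apply: (le_diam_sub hB bi); apply: box_ne; exact: (mesh_rect HC).
  move=> d; apply: le_trans di.
  have S k z : box (tnth M k) `<=` supp Om (psi P) -> cl k z -> supp Om (psi P) z.
    move=> bk ck; have : closure (box (tnth M k)) z by apply/(closureP HC).
    by move=> cz; apply: closed_closure; apply: closure_subset cz.
  apply: le_trans (edist_ge d y x) _; apply: (le_diam hB); [exact: S bj cj|exact: S bi ci].
have fin i j d d' : hK (tnth M i) <= CK * hK (tnth M j) -> width d i <= `|CK| * (1 + kap) * width d' j.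
  move=> h; have [_ a] := hK_width i d; have [b c] := hK_width j d'.
  apply: le_trans a _; apply: le_trans h _; rewrite -mulrA.
  have hj0 : 0 <= hK (tnth M j) by apply: le_trans c; rewrite ltW // (width_gt0 HM).
  by apply: le_trans (ler_wpM2r hj0 (ler_norm CK)) _; rewrite ler_wpM2l.
(* The chain is continued to a free node, whose nodal function is then positive at both [x] and
   [y]. *)
have near_reach x y : node x -> reach x y -> exists P, [/\ conforming_node Om M P, psi P x != 0 & psi P y != 0].
  move=> nx rxy; have ny := reach_node nx rxy; have [P ryP fP] := reach_free ny.
  have cP := free_conforming fP; exists P; have [_ _ hd] := h1 _ cP.
  have p1 : 0 < psi P P by rewrite (hd _ cP) eqxx ltr01.
  by split => //; rewrite gt_eqF //; [apply: posr p1 => //; apply: reach_trans ryP|apply: posr p1].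
exists (`|CK| * (1 + kap)) => //; split.
- move=> i j x d d' ci cj; apply: fin.
  have cx : closure Om x by apply/(closureOmP HC); exists i.
  (* Elements that touch at [x] are comparable because, the nodal functions having sum 1, some
     support contains both. *)
  have [P [cP px]] : exists P, conforming_node Om M P /\ psi P x != 0.
    apply: contrapT => no; have := h3 x cx; rewrite fsbig1; last first.
      move=> P cP; apply: contrapT => /eqP px; apply: no; exists P; split => //.
    by move/esym/eqP; rewrite oner_eq0.
  by have [] := supp_h _ _ _ _ _ cP px px ci cj.
- move=> i j x y d d' nx rxy ci cj; have [P [cP px py]] := near_reach _ _ nx rxy.
  split; apply: fin; first by have [] := supp_h _ _ _ _ _ cP px py ci cj.
  by have [] := supp_h _ _ _ _ _ cP py px cj ci.
- move=> i x y d d' nx rxy ci; have [P [cP px py]] := near_reach _ _ nx rxy.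
  have /existsP[j vj] := reach_node nx rxy; have cj := vert_cl HM vj.
  have [_ h] := supp_h _ _ _ _ _ cP px py ci cj; apply: le_trans (h d) _.
  have [b c] := hK_width i d'; rewrite -mulrA.
  have hj0 : 0 <= hK (tnth M i) by apply: le_trans c; rewrite ltW // (width_gt0 HM).
  by apply: le_trans (ler_wpM2r hj0 (ler_norm CK)) _; rewrite ler_wpM2l.
- move=> i x d q nx hx; apply: contrapT => no.
  have bx : bd Om x.
    apply/(bd_uncovered HC oOm HL); first by exists i; exact: hang_cl hx.
    by exists q => k; apply/negP => hk; apply: no; exists k.
  have cx : conforming_node Om M x.
    by split; [have /existsP[k vk] := nx; exists k; rewrite vertE|left].
  by have := nohang _ i d cx; rewrite hx.
Qed.

End KMesh.

(** * Locality of the estimates and the final constant *)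

Section LocalBounds.
Variables (R : realType) (Om : set (R * R)) (n : nat) (M : n.-tuple (rect R)).
Variables (C kap : R).
Local Notation pt := (R * R)%type.
Implicit Types (i j k : 'I_n) (d e : bool) (x y z : pt).
Local Notation ext := (ext M).
Local Notation lo := (ext false).
Local Notation hi := (ext true).
Local Notation cl := (cl M).
Local Notation node := (node M).
Local Notation hang := (hang M).
Local Notation width := (width M).
Local Notation dom := (dom M).
Local Notation near := (near M).

Hypothesis HC : cartesian_mesh Om M.
Hypothesis oOm : open Om.
Hypothesis HL : lipschitz_boundary Om.
Hypothesis HG : graded M C.
Hypothesis Hh : forall i d, hK (tnth M i) <= (1 + kap) * width d i /\ width d i <= hK (tnth M i).

Let HM : quad_mesh M := quad_mesh_of HC oOm HL.

(** A condition on distances rather than adjacency, so that the diameter bound is immediate. The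
    factor 4C^2 is what [near_patch] needs: three element widths and the extent of a chain, each at
    most C^2 times the width of [i]. *)
Definition patch_of i : {set 'I_n} := [set j | `[< forall x y d, cl j x -> cl i y ->
  `|crd d x - crd d y| <= 4 * C ^+ 2 * width false i >]]%SET.

Lemma cl_dist i x y d : cl i x -> cl i y -> `|crd d x - crd d y| <= width d i.
Proof.
move=> /(clP M d)[/andP[a b] _] /(clP M d)[/andP[a' b'] _]; rewrite /width ler_norml.
by apply/andP; split; lra.
Qed.

Lemma near_patch i k : near i k -> k \in patch_of i.
Proof.
move=> [j [x [y [z [ci cj [ny cy] ryz ck]]]]]; have C1 := graded_ge1 HM i HG.
rewrite inE; apply/asboolP => u t d cu ct.
have w0 := width_gt0 HM false i.
have h1 := gr_touch HG d false cj ci.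
have h2 := (gr_reach HG false d ny ryz cy ck).1.
have h2' := (gr_reach HG false d ny ryz cy ck).2.
have h3 := gr_dist HG d false ny ryz cy.
have h4 := gr_touch HG false false cj ci; have h5 := gr_touch HG d false ci ci.
have h6 := (gr_reach HG d false ny ryz cy ck).2.
have d1 := cl_dist d cu ck; have d2 := cl_dist d cy cj; have d3 := cl_dist d ci ct.
have -> : crd d u - crd d t = (crd d u - crd d z) + (crd d z - crd d y) + (crd d y - crd d x) + (crd d x - crd d t) by ring.
do 3![apply: le_trans (ler_normD _ _) _; rewrite -?lerBrDr].
set w := width false i in w0 h1 h4 h5 *.
have a1 : C * width false j <= C ^+ 2 * w by rewrite expr2 -mulrA ler_wpM2l // (le_trans ler01).
have a2 : C * w <= C ^+ 2 * w.
  by rewrite expr2 -mulrA ler_peMl // mulr_ge0 ?(ltW w0) // (le_trans ler01).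
lra.
Qed.

Lemma near_self i : near i i.
Proof.
have x0 := cl_self HM i; exists i, (tnth M i).1, (mk false (lo false i) (lo true i)), (mk false (lo false i) (lo true i)).
have v : vert M i (mk false (lo false i) (lo true i)) by exact: (@vert_mk _ _ M i false false false).
have nv : node (mk false (lo false i) (lo true i)) by apply/existsP; exists i.
by have cv := vert_cl HM v; split => //; exact: reach0.
Qed.

Lemma patch_diam i : diam (union_of M (patch_of i)) <= 16 * C ^+ 2 * hK (tnth M i).
Proof.
have ii := near_patch (near_self i); have w0 := width_gt0 HM false i.
apply: (@le_trans _ _ (16 * C ^+ 2 * width false i)); last first.
  by apply: ler_wpM2l; [rewrite mulr_ge0 ?exprn_even_ge0|exact: (Hh i false).2].
apply: diam_le => [|x y [j jW /(closureP HC) cx] [k kW /(closureP HC) cy]].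
  by exists (tnth M i).1, i => //; apply/(closureP HC); exact: cl_self.
rewrite !inE in jW kW; move/asboolP: jW => jW; move/asboolP: kW => kW.
have c0 := cl_self HM i; apply: le_trans (edist_le x y) _.
have S d : `|crd d x - crd d y| <= 8 * C ^+ 2 * width false i.
  have := jW x _ d cx c0; have := kW y _ d cy c0; rewrite distrC => h1 h2.
  have -> : crd d x - crd d y = (crd d x - crd d (tnth M i).1) + (crd d (tnth M i).1 - crd d y) by ring.
  by apply: le_trans (ler_normD _ _) _; lra.
by have := S false; have := S true; rewrite /=; lra.
Qed.

Lemma bd_side i d e t : lo (~~ d) i <= t <= hi (~~ d) i -> bd (box (tnth M i)) (mk d (ext e d i) t).
Proof.
move=> ht; apply/(bdP HC); split; first by apply/(clP M d); rewrite !crdE (ext_le HM).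
by move=> /(boxP M d)[]; rewrite !crdE; case: (e); rewrite ltxx ?andbF.
Qed.

Lemma jump_term (W : {set 'I_n}) (wt : R -> R) v i j d e (r : {poly R}) :
  dom i d e j -> i \in W ->
  (forall t, r.[t] = v i (mk d (ext e d i) t) - v j (mk d (ext e d i) t)) ->
  wt (mside_h M i j) ^+ 2 * intp (r ^+ 2) (lo (~~ d) i) (hi (~~ d) i) <= jump_norm M W wt v ^+ 2.
Proof.
move=> dj iW hr; have := dj => /and5P[ij /eqP ex hl hh _].
have lt0 := qm_lt HM (~~ d) i.
have D t : lo (~~ d) i <= t <= hi (~~ d) i -> bd (box (tnth M j)) (mk d (ext e d i) t).
  by move=> /andP[t1 t2]; rewrite ex; apply: bd_side; rewrite (le_trans hl) //= (le_trans _ hh).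
have U k l : i = k \/ i = l -> mside M k l `<=` union_of M W.
  move=> E x [] /(bdP HC)[ck _] /(bdP HC)[cl' _]; exists i => //.
  by apply/(closureP HC); case: E => ->.
move: ij; rewrite neq_ltn => /orP[ij|ji].
  apply: (@jump_norm_ge _ n M W wt v i j d (ext e d i) (lo (~~ d) i) (lo (~~ d) i) (hi (~~ d) i) (hi (~~ d) i)) => //.
  - by apply: U; left.
  - by apply/(sidesP M); exists d, e.
  - by move=> t ht; split => // _; split; [exact: bd_side|exact: D].
  - by move=> t; rewrite horner_exp hr.
(* A pair is counted in the order of the indices, so the roles are exchanged here; the common part
   may then be only a piece of the side of [j]. *)
have -> : mside_h M i j = mside_h M j i by rewrite /mside_h addrC.
apply: (@jump_norm_ge _ n M W wt v j i d (ext e d i) (lo (~~ d) j) (lo (~~ d) i) (hi (~~ d) i) (hi (~~ d) j)) => //.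
- by apply: U; right.
- by apply/(sidesP M); exists d, (~~ e); rewrite ex.
- move=> t ht; split => [[_ /(bdP HC)[/(clP M d)[_ h] _]]|h]; first by move: h; rewrite !crdE.
  by split; [rewrite ex; exact: bd_side|exact: bd_side].
- by move=> t; rewrite horner_exp hr -sqrrN opprB.
Qed.

Definition Kh : R := (1 + kap) * C ^+ 2.

Lemma Kh_ge1 i : 1 <= Kh.
Proof.
have C1 := graded_ge1 HM i HG; have w0 := width_gt0 HM false i.
have [a b] := Hh i false; have k1 : 1 <= 1 + kap.
  by rewrite -(ler_pM2r w0) mul1r (le_trans b).
by rewrite /Kh mulr_ege1 // exprn_ege1.
Qed.

Lemma near_h i j k : near i j -> near i k ->
  mside_h M j k <= Kh * width false i /\ width false i <= Kh * mside_h M j k.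
Proof.
move=> nj nk; have K1 := Kh_ge1 i; have w0 := width_gt0 HM false i.
have H l : near i l -> hK (tnth M l) <= Kh * width false i /\ width false i <= Kh * hK (tnth M l).
  move=> nl; have [a b] := near_width HM HG false nl; have [c c'] := Hh l false.
  have C1 := graded_ge1 HM i HG; have [ai bi] := Hh i false.
  have k1 : 1 <= 1 + kap by rewrite -(ler_pM2r w0) mul1r (le_trans bi).
  have k0 : 0 <= 1 + kap by apply: le_trans k1.
  split.
    by apply: le_trans c _; rewrite /Kh -mulrA ler_wpM2l.
  apply: le_trans b _; apply: (@le_trans _ _ (C ^+ 2 * hK (tnth M l))).
    by rewrite ler_wpM2l ?exprn_even_ge0.
  rewrite /Kh ler_wpM2r ?ler_peMl ?exprn_even_ge0 //.
  by apply: le_trans c'; rewrite ltW // (width_gt0 HM).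
by have [a b] := H j nj; have [c d] := H k nk; rewrite /mside_h; split; lra.
Qed.

Section Space.
Variables (p : nat) (tg : pt -> R) (v : 'I_n -> pt -> R) (i0 : 'I_n).
Hypothesis p0 : (0 < p)%N.
Let Phi := horner (layer R p).
Hypothesis Vv : Vp p v.
Hypothesis tg1 : forall i x d, node x -> hang i x d -> tg x = v i x +
  \sum_e (tg (endp M i d e x) - v i (endp M i d e x)) * PhiC M Phi i (~~ d) e (crd (~~ d) x).
Hypothesis tg2 : forall x, node x -> (forall i d, ~~ hang i x d) -> tg x = vref M v x.

Let w := width false i0.
Let w0 : 0 < w := width_gt0 HM _ _.
Let P0 : 0 < p%:R :> R. Proof. by rewrite ltr0n. Qed.

(** The weights on the nearby sides are at least [b], so the plain L^2 norm of the jump on each of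
    them is at most [J / b], which plays the role of [B] in [interp_error]. *)
Lemma interp_bounds_with (wt : R -> R) (b : R) : 0 < b ->
  (forall j k, near i0 j -> near i0 k -> b <= wt (mside_h M j k)) ->
  let J := jump_norm M (patch_of i0) wt v in
  let E := Kerr C * (w / p%:R ^+ 2) * (J / b) ^+ 2 in
  L2norm (box (tnth M i0)) (fun x => v i0 x - interp M Phi tg v i0 x) <= 8 * Num.sqrt E /\
  L2norm_grad (box (tnth M i0)) (fun x => v i0 x - interp M Phi tg v i0 x) <=
    40 * (p.+1%:R ^+ 2 / (w / C) * Num.sqrt E).
Proof.
move=> b0 hb J E; have C1 := graded_ge1 HM i0 HG; have C0 : 0 < C by apply: lt_le_trans C1.
have J0 : 0 <= J by rewrite sqrtr_ge0.
have B0 : 0 <= J / b by rewrite divr_ge0 // ltW.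
have HB d e i j (r : {poly R}) : dom i d e j -> near i0 i -> near i0 j -> (size r <= p.+1)%N ->
  (forall t, r.[t] = v i (mk d (ext e d i) t) - v j (mk d (ext e d i) t)) ->
  intp (r ^+ 2) (lo (~~ d) i) (hi (~~ d) i) <= (J / b) ^+ 2.
  move=> dj ni nj _ hr; have h := jump_term wt dj (near_patch ni) hr.
  have wb := hb _ _ ni nj; have i0' := intp_sqr_ge0 r (ltW (qm_lt HM (~~ d) i)).
  rewrite exprMn exprVn ler_pdivlMr ?exprn_gt0 //.
  apply: le_trans h; rewrite mulrC ler_wpM2r // ler_sqr ?nnegrE ?(ltW b0) //.
  exact: le_trans (ltW b0) wb.
have [s [ss hs hE]] := interp_error HM p0 HG Vv tg1 tg2 B0 HB.
have KE0 : 0 <= E.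
  have KV : 0 <= Kvert C by rewrite addr_ge0 // mulr_ge0 // exprn_ge0 // ltW.
  have KL : 0 <= Klift C by rewrite addr_ge0 // !mulr_ge0 ?sqr_ge0 ?exprn_ge0 // ltW.
  have KR : 0 <= Kerr C by rewrite addr_ge0 // !mulr_ge0 ?sqr_ge0 ?exprn_ge0 // ltW.
  by rewrite mulr_ge0 ?exprn_even_ge0 // mulr_ge0 // divr_ge0 ?exprn_even_ge0 // ltW.
have wC d : w / C <= width d i0.
  rewrite ler_pdivrMr // mulrC; exact: (gr_touch HG _ _ (cl_self HM i0) (cl_self HM i0)).
have m0 : 0 < w / C by rewrite divr_gt0.
have := L2norm_bounds (mesh_rect HC i0) KE0 m0 (wC false) (wC true) hs hE.
by rewrite ss -natrM.
Qed.

(** The terms serve in turn the diameter of the patch, the L^2 estimate and the gradient estimate,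
    where 160 is 40 times the bound 4 of ((p+1)/p)^2. *)
Definition Kfin : R := 16 * C ^+ 2 + 8 * Num.sqrt (Kerr C * Kh) + 160 * C * Num.sqrt (Kerr C * Kh).

Lemma interp_bounds :
  L2norm (box (tnth M i0)) (fun x => v i0 x - interp M Phi tg v i0 x) <=
    Kfin * jump_norm M (patch_of i0) (fun h => p%:R^-1 * Num.sqrt h) v /\
  L2norm_grad (box (tnth M i0)) (fun x => v i0 x - interp M Phi tg v i0 x) <=
    Kfin * jump_norm M (patch_of i0) (fun h => p%:R * (Num.sqrt h)^-1) v.
Proof.
have C1 := graded_ge1 HM i0 HG; have C0 : 0 < C by apply: lt_le_trans C1.
have K1 := Kh_ge1 i0; have K0 : 0 < Kh by apply: lt_le_trans K1.
have KV : 0 <= Kvert C by rewrite addr_ge0 // mulr_ge0 // exprn_ge0 // ltW.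
have KL : 0 <= Klift C by rewrite addr_ge0 // !mulr_ge0 ?sqr_ge0 ?exprn_ge0 // ltW.
have KR : 0 <= Kerr C by rewrite addr_ge0 // !mulr_ge0 ?sqr_ge0 ?exprn_ge0 // ltW.
have S0 : 0 <= Num.sqrt (Kerr C * Kh) by rewrite sqrtr_ge0.
have sw : 0 < Num.sqrt w by rewrite sqrtr_gt0.
have sK : 0 < Num.sqrt Kh by rewrite sqrtr_gt0.
have sE (J b : R) : 0 <= J -> 0 < b -> Num.sqrt (Kerr C * (w / p%:R ^+ 2) * (J / b) ^+ 2) =
    Num.sqrt (Kerr C) * Num.sqrt w / p%:R * (J / b).
  move=> J0 b0; have Q : 0 <= Num.sqrt (Kerr C) * Num.sqrt w / p%:R * (J / b).
    by rewrite mulr_ge0 // divr_ge0 ?mulr_ge0 ?sqrtr_ge0 // ltW.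
  rewrite -[RHS](ger0_norm Q) -sqrtr_sqr; congr Num.sqrt.
  by rewrite !exprMn !exprVn !sqr_sqrtr ?(ltW w0) //; ring.
split.
  have b0 : 0 < p%:R^-1 * (Num.sqrt w / Num.sqrt Kh) by rewrite mulr_gt0 ?invr_gt0 ?divr_gt0.
  have [|h _] := @interp_bounds_with (fun h => p%:R^-1 * Num.sqrt h) _ b0.
    move=> j k nj nk; rewrite ler_wpM2l ?invr_ge0 ?(ltW P0) // ler_pdivrMr // -sqrtrM; last first.
      have [_ h] := near_h nj nk; have : 0 <= Kh * mside_h M j k by apply: le_trans h; exact: ltW.
      by rewrite pmulr_rge0.
    by rewrite ler_wsqrtr // mulrC; have [] := near_h nj nk.
  move: h; set J := jump_norm _ _ _ _; have J0 : 0 <= J by rewrite sqrtr_ge0.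
  rewrite sE // => /le_trans; apply.
  have -> : 8 * (Num.sqrt (Kerr C) * Num.sqrt w / p%:R * (J / (p%:R^-1 * (Num.sqrt w / Num.sqrt Kh)))) =
      8 * Num.sqrt (Kerr C * Kh) * J.
    by rewrite (sqrtrM Kh KR); field; rewrite !gt_eqF.
  rewrite ler_wpM2r // /Kfin; have := mulr_ge0 (ltW C0) S0; have := sqr_ge0 C; nra.
have b0 : 0 < p%:R * (Num.sqrt w * Num.sqrt Kh)^-1 by rewrite mulr_gt0 ?invr_gt0 ?mulr_gt0.
have [|_ h] := @interp_bounds_with (fun h => p%:R * (Num.sqrt h)^-1) _ b0.
  move=> j k nj nk; have [h1 h2] := near_h nj nk.
  have h0 : 0 < mside_h M j k.
    have : 0 < Kh * mside_h M j k by apply: lt_le_trans h2.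
    by rewrite pmulr_rgt0.
  rewrite ler_wpM2l ?(ltW P0) // lef_pV2 ?posrE ?mulr_gt0 ?sqrtr_gt0 //.
  by rewrite -sqrtrM ?(ltW w0) // ler_wsqrtr // mulrC.
move: h; set J := jump_norm _ _ _ _; have J0 : 0 <= J by rewrite sqrtr_ge0.
rewrite sE // => /le_trans; apply.
have -> : 40 * (p.+1%:R ^+ 2 / (w / C) * (Num.sqrt (Kerr C) * Num.sqrt w / p%:R * (J / (p%:R * (Num.sqrt w * Num.sqrt Kh)^-1)))) =
    40 * (p.+1%:R / p%:R) ^+ 2 * C * Num.sqrt (Kerr C * Kh) * J.
  rewrite (sqrtrM Kh KR) -[w in w / C](sqr_sqrtr (ltW w0)); field.
  by rewrite !gt_eqF.
have pp : (p.+1%:R / p%:R) ^+ 2 <= 4 :> R.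
  rewrite (_ : 4 = 2 ^+ 2); last by ring.
  by rewrite ler_sqr ?nnegrE ?divr_ge0 // ler_pdivrMr // -natrM ler_nat mul2n -addnn -addn1 leq_add2l.
rewrite ler_wpM2r // /Kfin.
have := mulr_ge0 (ltW C0) S0; have := sqr_ge0 C; nra.
Qed.

End Space.
End LocalBounds.

(** * Membership in the Sobolev spaces *)

Section PartialC1.
Variable R : realType.
Local Notation pt := (R * R)%type.
Local Notation mu1 := (@lebesgue_measure R).
Implicit Types (f g : pt -> R) (b d : bool).

Definition C1 b f := [/\ continuous f, forall x, derivable f x (dir R b) & continuous (pderiv b f)].

Lemma Qp_tensor_sum p f : Qp p f -> exists s : seq ({poly R} * {poly R}),
  forall x, f x = \sum_(g <- s) g.1.[x.1] * g.2.[x.2].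
Proof.
move=> [c hc]; exists [seq (c ij.1 ij.2 *: 'X^(nat_of_ord ij.1), 'X^(nat_of_ord ij.2)) | ij : 'I_p.+1 * 'I_p.+1] => x.
rewrite hc big_image /= pair_big /=; apply: eq_big => // -[i j] _ /=.
by rewrite hornerZ !hornerXn.
Qed.

Lemma Qp_C1 p f b : Qp p f -> C1 b f.
Proof.
move=> /Qp_tensor_sum[s /funext ->]; split.
- exact: tensor_sum_continuous.
- by move=> x; have [] := pderiv_tensor_sum b s x.
- have -> : pderiv b (fun x => \sum_(g <- s) g.1.[x.1] * g.2.[x.2]) =
     (fun x => \sum_(g <- map (dpair b) s) g.1.[x.1] * g.2.[x.2]).
    by apply/funext => x; have [] := pderiv_tensor_sum b s x.
  exact: tensor_sum_continuous.
Qed.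

Lemma section_C1 b f (s : R) : C1 b f ->
  [/\ continuous (fun t => f (mk b t s)), forall t, is_derive t (1 : R) (fun t => f (mk b t s)) (pderiv b f (mk b t s))
   & continuous (fun t => pderiv b f (mk b t s))].
Proof.
have cs : continuous (fun t => mk b t s : pt).
  have -> : (fun t => mk b t s : pt) = mk (~~ b) s by apply/funext => t; rewrite mkN.
  exact: mk_continuous.
move=> [cf df cpf]; split.
- by move=> t; apply: (@continuous_comp _ _ _ (fun t => mk b t s : pt)); [exact: cs|exact: cf].
- move=> t; have := df (mk b t s); rewrite pderivableE !crdE => d.
  by apply: DeriveDef => //; rewrite -derive1E pderivE !crdE.
- by move=> t; apply: (@continuous_comp _ _ _ (fun t => mk b t s : pt)); [exact: cs|exact: cpf].
Qed.

Lemma interval_ftc (F f : R -> R) (a c : R) : a < c -> (forall t, is_derive t (1 : R) F (f t)) ->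
  continuous f -> \int[mu1]_(t in `]a, c[) f t = F c - F a.
Proof.
move=> ac dF cf; have ir : mu1.-integrable `[a, c] (EFin \o f).
  apply: continuous_compact_integrable; first exact: segment_compact.
  by apply: continuous_subspaceT => x; exact: cf.
have cF : continuous F.
  move=> t; apply: differentiable_continuous; apply/derivable1_diffP; by have [] := dF t.
rewrite Rintegral_itv_obnd_cbnd; last first.
  by apply: integrableS ir => //; apply: subset_itv; rewrite bnd_simp.
rewrite Rintegral_itv_bndo_bndc; last first.
  by apply: integrableS ir => //; apply: subset_itv; rewrite bnd_simp.
rewrite /Rintegral (@continuous_FTC2 _ f F) //.
- by apply: continuous_subspaceT => x; exact: cf.
- split => [x _||]; [by have [] := dF x| |].
  + by apply: cvg_at_right_filter; exact: cF.
  + by apply: cvg_at_left_filter; exact: cF.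
- by move=> x _; rewrite derive1E (@derive_val _ _ _ _ _ _ _ (dF x)).
Qed.

Lemma box_ibp b (K : rect R) f g : is_rect K -> C1 b f -> C1 b g ->
  \int[@mu2 R]_(x in box K) (f x * pderiv b g x) + \int[@mu2 R]_(x in box K) (pderiv b f x * g x) =
  \int[mu1]_(s in `]crd (~~ b) K.1, crd (~~ b) K.2[)
    (f (mk b (crd b K.2) s) * g (mk b (crd b K.2) s) - f (mk b (crd b K.1) s) * g (mk b (crd b K.1) s)).
Proof.
move=> rK Cf Cg; have [cf df cpf] := Cf; have [cg dg cpg] := Cg; have mb := measurable_box K.
have c1 : continuous (fun x => f x * pderiv b g x) by move=> x; apply: cvgM; [exact: cf|exact: cpg].
have c2 : continuous (fun x => pderiv b f x * g x) by move=> x; apply: cvgM; [exact: cpf|exact: cg].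
have c3 : continuous (fun x => f x * pderiv b g x + pderiv b f x * g x) by move=> x; apply: cvgD; [exact: c1|exact: c2].
rewrite -RintegralD //; [|exact: (box_fubini b K c1).1|exact: (box_fubini b K c2).1].
rewrite (box_fubini (~~ b) K c3).2; apply: eq_Rintegral => s _; rewrite negbK.
have [cfs dfs cpfs] := section_C1 s Cf; have [cgs dgs cpgs] := section_C1 s Cg.
rewrite (_ : (fun t => _) = (fun t => f (mk b t s) * pderiv b g (mk b t s) + pderiv b f (mk b t s) * g (mk b t s))); last first.
  by apply/funext => t; rewrite mkN.
apply: (@interval_ftc (fun t => f (mk b t s) * g (mk b t s))).
- by have [r1 r2] := rK; case: (b).
- move=> t; have h := is_deriveM (dfs t) (dgs t); apply: (is_derive_eq h).
  by rewrite /GRing.scale /= [X in _ + X]mulrC.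
- by move=> t; apply: cvgD; apply: cvgM; [exact: cfs|exact: cpgs|exact: cpfs|exact: cgs].
Qed.

End PartialC1.

(** * Conforming piecewise polynomials belong to H^1 *)

Section BrokenFunctions.
Variables (R : realType) (Om : set (R * R)) (n : nat) (M : n.-tuple (rect R)).
Local Notation pt := (R * R)%type.
Local Notation mpt := (measurableTypeR R * measurableTypeR R)%type.
Local Notation mu1 := (@lebesgue_measure R).
Implicit Types (i j k : 'I_n) (d b : bool) (x y : pt).
Local Notation ext := (ext M).
Local Notation lo := (ext false).
Local Notation hi := (ext true).
Local Notation hasq := (hasq M).
Local Notation cl := (cl M).

Hypothesis HC : cartesian_mesh Om M.
Hypothesis oOm : open Om.

Lemma box_sub i : box (tnth M i) `<=` Om.
Proof. by case: HC => _ h _ _ _; have [] := h _ (mem_tnth i M). Qed.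

Lemma mesh_box_uniq i j x : box (tnth M i) x -> box (tnth M j) x -> i = j.
Proof.
move=> bi bj; apply: (tnth_inj HC); apply: contrapT => ne.
have [_ _ H _ _] := HC; have := H _ _ (mem_tnth i M) (mem_tnth j M) ne.
by move=> E; have : (box (tnth M i) `&` box (tnth M j)) x by []; rewrite E.
Qed.

Lemma broken_in (f : 'I_n -> pt -> R) i x : box (tnth M i) x -> broken_fun M f x = f i x.
Proof.
move=> bi; rewrite /broken_fun (bigD1 i) //= big1 ?addr0 => [|j ji].
  by rewrite indicE mem_set // mul1r.
rewrite indicE memNset ?mul0r // => bj.
by rewrite (mesh_box_uniq bi bj) eqxx in ji.
Qed.

Lemma broken_out (f : 'I_n -> pt -> R) x : (forall i, ~ box (tnth M i) x) -> broken_fun M f x = 0.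
Proof. by move=> h; rewrite /broken_fun big1 // => i _; rewrite indicE memNset ?mul0r. Qed.

Lemma box_cases x : (exists i, box (tnth M i) x) \/ (forall i, ~ box (tnth M i) x).
Proof. by have [h|h] := pselect (exists i, box (tnth M i) x); [left|right => i bi; apply: h; exists i]. Qed.

Lemma broken_mul (f g : 'I_n -> pt -> R) x :
  broken_fun M f x * broken_fun M g x = broken_fun M (fun i y => f i y * g i y) x.
Proof.
have [[i bi]|h] := box_cases x; first by rewrite !(broken_in _ bi).
by rewrite !broken_out // mulr0.
Qed.

Lemma broken_mulr (f : 'I_n -> pt -> R) (g : pt -> R) x :
  broken_fun M f x * g x = broken_fun M (fun i y => f i y * g y) x.
Proof.
have [[i bi]|h] := box_cases x; first by rewrite !(broken_in _ bi).
by rewrite !broken_out // mul0r.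
Qed.

Lemma mOm : measurable (Om : set mpt). Proof. exact: open_measurable2. Qed.

Lemma broken_measurable (f : 'I_n -> pt -> R) (D : set mpt) : measurable D ->
  (forall i, continuous (f i)) -> measurable_fun D (broken_fun M f : mpt -> R).
Proof.
move=> mD cf; apply: measurable_sum => i; apply: measurable_funM.
  by apply: measurable_indic; exact: measurable_box.
exact: continuous_measurable2.
Qed.

Lemma broken_integral (f : 'I_n -> pt -> R) : (forall i, continuous (f i)) ->
  (@mu2 R).-integrable Om (EFin \o broken_fun M f) /\
  \int[@mu2 R]_(x in Om) broken_fun M f x = \sum_i \int[@mu2 R]_(x in box (tnth M i)) f i x.
Proof.
move=> cf; have P i : (@mu2 R).-integrable Om (EFin \o (fun x => \1_(box (tnth M i)) x * f i x)) /\
    \int[@mu2 R]_(x in Om) (\1_(box (tnth M i)) x * f i x) = \int[@mu2 R]_(x in box (tnth M i)) f i x.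
  have E : (fun x => \1_(box (tnth M i)) x * f i x) = (f i \_ (box (tnth M i))).
    apply/funext => x; rewrite /patch indicE; case: ifP => _; by rewrite ?mul1r ?mul0r.
  have mb := measurable_box (tnth M i).
  have S : Om `&` box (tnth M i) = box (tnth M i) by apply/setIidr/box_sub.
  rewrite E; split.
    rewrite -restrict_EFin; apply/integrable_restrict => //; first exact: mOm.
    by rewrite S; exact: (box_fubini false _ (cf i)).1.
  by rewrite -Rintegral_mkcondr S.
rewrite /broken_fun; elim: (index_enum _) => [|i s [IH1 IH2]].
  rewrite big_nil; split.
    by apply: eq_integrable (integrable0 _ _); [exact: mOm|move=> x _ /=; rewrite big_nil].
  by under eq_Rintegral do rewrite big_nil; rewrite Rintegral_cst ?mul0r //; exact: mOm.
have [p1 p2] := P i.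
have E : (fun x => \sum_(i <- i :: s) \1_(box (tnth M i)) x * f i x) =
    (fun x => \1_(box (tnth M i)) x * f i x + \sum_(i <- s) \1_(box (tnth M i)) x * f i x).
  by apply/funext => x; rewrite big_cons.
rewrite E big_cons; split; first by apply: (integrableD mOm p1 IH1).
by rewrite RintegralD ?p2 ?IH2 //; exact: mOm.
Qed.

Lemma broken_L2 (f : 'I_n -> pt -> R) : (forall i, continuous (f i)) -> L2 Om (broken_fun M f).
Proof.
move=> cf; split; first by apply: broken_measurable => //; exact: mOm.
have c2 i : continuous (fun x => f i x * f i x) by move=> x; apply: cvgM; exact: cf.
have := (broken_integral c2).1; apply: eq_integrable; first exact: mOm.
by move=> x _ /=; rewrite expr2 broken_mul.
Qed.

Section Conforming.
Variable u : 'I_n -> pt -> R.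
Hypothesis conf : forall i j x, cl i x -> cl j x -> u i x = u j x.
Hypothesis uQ : exists p, forall i, Qp p (u i).

(* The end points of the chords in direction b at height s cancel pairwise in Om,
   where u is continuous. *)
Lemma side_cancel b (g : pt -> R) (s : R) : (forall x, ~ Om x -> g x = 0) ->
  \sum_i (if lo (~~ b) i <= s < hi (~~ b) i then
    u i (mk b (hi b i) s) * g (mk b (hi b i) s) - u i (mk b (lo b i) s) * g (mk b (lo b i) s) else 0) = 0.
Proof.
move=> g0; pose X := undup [seq ext ei.1 b ei.2 | ei : bool * 'I_n].
have XP e i : ext e b i \in X by rewrite mem_undup; apply/mapP; exists (e, i); rewrite ?mem_enum.
pose S e (x : R) := \sum_i (if (ext e b i == x) && (lo (~~ b) i <= s < hi (~~ b) i)
  then u i (mk b x s) * g (mk b x s) else 0).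
have SE e : \sum_i (if lo (~~ b) i <= s < hi (~~ b) i then
    u i (mk b (ext e b i) s) * g (mk b (ext e b i) s) else 0) = \sum_(x <- X) S e x.
  rewrite exchange_big /=; apply: eq_bigr => i _.
  rewrite (big_rem _ (XP e i)) /= eqxx /= big_seq big1 ?addr0 // => x.
  by rewrite mem_rem_uniq ?undup_uniq // inE eq_sym => /andP[/negbTE -> _].
suff H (x : R) : S true x = S false x.
  transitivity (\sum_(x <- X) S true x - \sum_(x <- X) S false x).
    rewrite -!SE -sumrB; apply: eq_bigr => i _; case: ifP => // _; by rewrite subrr.
  by rewrite (eq_bigr _ (fun (x : R) _ => H x)) subrr.
set y := mk b x s; have [Oy|nO] := pselect (Om y); last first.
  by rewrite /S -/y g0 // !big1 // => i _; rewrite mulr0 if_same.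
have [k1 h1] := Om_covered HC oOm (mk b false true) Oy; have [k2 h2] := Om_covered HC oOm (mk b true true) Oy.
have := h1 => /(hasqP M b)[]; rewrite !crdE /= => a1 b1.
have := h2 => /(hasqP M b)[]; rewrite !crdE /= => a2 b2.
have U e k : hasq k y (mk b (~~ e) true) -> S e x = if ext e b k == x then u k y * g y else 0.
  move=> hk; have := hk => /(hasqP M b)[_]; rewrite !crdE /= => bk.
  rewrite /S (bigD1 k) //= bk andbT big1 ?addr0 // => i ik.
  case: ifP => // /andP[/eqP ei bi]; case/negP: ik; apply/eqP; apply: (mesh_uniq HC _ hk).
  apply/(hasqP M b); rewrite !crdE -ei; split => //.
  by have := ext_lt HC b i; case: (e) => /= h; rewrite h lexx ?andbT.
rewrite (U true k1 h1) (U false k2 h2); have E : u k1 y = u k2 y by apply: conf; [apply: hasq_cl h1|apply: hasq_cl h2].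
(* Either the chord of [k1] ends and that of [k2] begins at [y], or neither happens because [y] is
   inside one element in direction [b]. *)
rewrite E; suff -> : (hi b k1 == x) = (lo b k2 == x) by [].
have /andP[c1 c2] := a1; have /andP[d1 d2] := a2.
apply/eqP/eqP => h; apply/eqP/contraT => ne; exfalso.
  have k12 : k1 = k2.
    apply: (mesh_uniq HC h1); apply/(hasqP M b); rewrite !crdE /=; split => //.
    by rewrite lt_neqAle ne d1 ltW.
  by move: d2; rewrite -k12 h ltxx.
have k12 : k1 = k2.
  apply: (mesh_uniq HC _ h2); apply/(hasqP M b); rewrite !crdE /=; split => //.
  by rewrite lt_neqAle eq_sym ne c2 ltW.
by move: c1; rewrite k12 h ltxx.
Qed.

(** Integration by parts in direction [b] on each box leaves the values at the ends of the chords,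
    as a function of the transverse height; their sum over all boxes vanishes at every height by
    [side_cancel]. *)
Lemma broken_weak_deriv b : weak_deriv Om b (broken_fun M u) (broken_fun M (fun i => pderiv b (u i))).
Proof.
move=> phi [sm _ sub]; have [p hp] := uQ.
have Cu i : C1 b (u i) by exact: Qp_C1 (hp i).
have Cphi : C1 b phi.
  by split; [have [] := sm [::]|move=> x; have [_ h] := sm [::]; exact: h|have [] := sm [:: b]].
have [cphi _ cpphi] := Cphi.
have phi0 x : ~ Om x -> phi x = 0.
  move=> nO; apply/eqP; apply: contraT => h; case: nO; apply: sub; exact: subset_closure.
have c1 i : continuous (fun x => u i x * pderiv b phi x).
  by move=> x; apply: cvgM; [case: (Cu i) => h _ _; exact: h|exact: cpphi].
have c2 i : continuous (fun x => pderiv b (u i) x * phi x).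
  by move=> x; apply: cvgM; [case: (Cu i) => _ _ h; exact: h|exact: cphi].
under eq_Rintegral do rewrite broken_mulr.
under [in RHS]eq_Rintegral do rewrite broken_mulr.
rewrite (broken_integral c1).2 (broken_integral c2).2; apply/eqP.
rewrite -addr_eq0 -big_split /=; apply/eqP.
pose G i s := u i (mk b (hi b i) s) * phi (mk b (hi b i) s) - u i (mk b (lo b i) s) * phi (mk b (lo b i) s).
have cG i : continuous (G i).
  have cs c : continuous (fun s => mk b c s : pt) by exact: mk_continuous.
  have cu : continuous (u i) by case: (Cu i).
  have H c : continuous (fun s => u i (mk b c s) * phi (mk b c s)).
    by move=> s; apply: cvgM; [apply: (@continuous_comp _ _ _ (fun s => mk b c s : pt) (u i))|apply: (@continuous_comp _ _ _ (fun s => mk b c s : pt) phi)];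
      [exact: cs|exact: cu|exact: cs|exact: cphi].
  by move=> s; apply: cvgB; exact: H.
(* Half-open as in [side_cancel], so that a height shared by two stacked elements is counted once;
   the change from open intervals does not affect the integrals. *)
pose A i : set R := `[lo (~~ b) i, hi (~~ b) i[%classic.
have iG i : mu1.-integrable setT (EFin \o (G i \_ (A i))).
  have mA : measurable (A i) by exact: measurable_itv.
  have /iffLR Z := integrable_restrict mu1 mA measurableT (EFin \o G i).
  rewrite -restrict_EFin; apply: Z; rewrite setTI.
  have ir : mu1.-integrable `[lo (~~ b) i, hi (~~ b) i] (EFin \o G i).
    apply: continuous_compact_integrable; first exact: segment_compact.
    by apply: continuous_subspaceT => x; exact: cG.
  by apply: integrableS ir => //; apply: subset_itv; rewrite bnd_simp.
have P i : \int[@mu2 R]_(x in box (tnth M i)) (u i x * pderiv b phi x) +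
    \int[@mu2 R]_(x in box (tnth M i)) (pderiv b (u i) x * phi x) = \int[mu1]_s (G i \_ (A i)) s.
  rewrite (box_ibp (mesh_rect HC i) (Cu i) Cphi) -Rintegral_mkcond /A.
  rewrite -Rintegral_itv_obnd_cbnd //.
  have ir : mu1.-integrable `[lo (~~ b) i, hi (~~ b) i] (EFin \o G i).
    apply: continuous_compact_integrable; first exact: segment_compact.
    by apply: continuous_subspaceT => x; exact: cG.
  by apply: integrableS ir => //; apply: subset_itv; rewrite bnd_simp.
rewrite (eq_bigr _ (fun i _ => P i)).
have sum_int (s : seq 'I_n) : mu1.-integrable setT (EFin \o (fun t => \sum_(i <- s) (G i \_ (A i)) t)) /\
    \sum_(i <- s) \int[mu1]_t (G i \_ (A i)) t = \int[mu1]_t (\sum_(i <- s) (G i \_ (A i)) t).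
  elim: s => [|i s [IH1 IH2]].
    rewrite big_nil; split.
      by apply: eq_integrable (integrable0 _ _) => // x _ /=; rewrite big_nil.
    by under eq_Rintegral do rewrite big_nil; rewrite Rintegral_cst ?mul0r.
  have E : (fun t => \sum_(i <- i :: s) (G i \_ (A i)) t) =
      (fun t => (G i \_ (A i)) t + \sum_(i <- s) (G i \_ (A i)) t).
    by apply/funext => t; rewrite big_cons.
  rewrite E; split; first by apply: (integrableD measurableT (iG i) IH1).
  by rewrite RintegralD // big_cons IH2.
rewrite (sum_int _).2; have -> : (fun t => \sum_i (G i \_ (A i)) t) = (fun _ => 0).
  apply/funext => s; rewrite -[RHS](side_cancel b s phi0); apply: eq_bigr => i _.
  rewrite /patch /A; case: ifPn; rewrite ?inE ?notin_setE /= in_itv /=.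
    by move=> ->.
  by move/negP/negbTE ->.
by rewrite Rintegral_cst ?mul0r.
Qed.

Lemma broken_H1 : H1_grad Om (broken_fun M u) (fun b => broken_fun M (fun i => pderiv b (u i))).
Proof.
have [p hp] := uQ; split.
  by apply: broken_L2 => i; have [] := Qp_C1 false (hp i).
move=> b; split; last exact: broken_weak_deriv.
by apply: broken_L2 => i; have [] := Qp_C1 b (hp i).
Qed.

End Conforming.
End BrokenFunctions.

(** * Zero boundary values of the interpolant *)

Section BoundaryValues.
Variables (R : realType) (Om : set (R * R)) (n : nat) (M : n.-tuple (rect R)).
Variable C : R.
Local Notation pt := (R * R)%type.
Implicit Types (i j k : 'I_n) (d e b : bool) (x y z : pt) (q c : bool * bool).
Local Notation ext := (ext M).
Local Notation lo := (ext false).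
Local Notation hi := (ext true).
Local Notation hasq := (hasq M).
Local Notation cl := (cl M).
Local Notation node := (node M).
Local Notation hang := (hang M).
Local Notation dom := (dom M).

Hypothesis HC : cartesian_mesh Om M.
Hypothesis oOm : open Om.
Hypothesis HL : lipschitz_boundary Om.
Hypothesis HG : graded M C.

Let HM : quad_mesh M := quad_mesh_of HC oOm HL.

Lemma ext_inj e e' d i : ext e d i = ext e' d i -> e = e'.
Proof. by have := qm_lt HM d i; case: e e' => [] [] // /[swap] ->; rewrite ltxx. Qed.

(* If the side of i through x is uncovered at x, a maximal chain of elements
   across this side ends at a hanging node on the boundary of Om, which the
   grading excludes. *)
Lemma uncovered_side i x d q : hasq i x q -> (forall k, ~~ hasq k x (upd d q (~~ crd d q))) ->
  crd d x = ext (~~ crd d q) d i /\ forall y b k, crd d y = ext (~~ crd d q) d i ->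
    inI b (lo (~~ d) i) (hi (~~ d) i) (crd (~~ d) y) -> ~~ hasq k y (mk d (~~ crd d q) b).
Proof.
move=> hq; have [e eE] : exists e, ~~ crd d q = e by eexists.
rewrite !eE => un; set s := crd (~~ d) q; set t := crd (~~ d) x.
have /(hasqP M d)[q1 q2] := hq; rewrite -/s -/t in q2.
have xe : crd d x = ext e d i.
  have K : ~~ inI (~~ crd d q) (lo d i) (hi d i) (crd d x).
    apply/negP => h; have := un i; case/negP; apply/(hasqP M d); rewrite /upd !crdE -eE; by split.
  by rewrite (inI_end q1 K) -eE; case: (crd d q).
split => // y b k ye yb; apply/negP => hk.
pose across j := [&& ext (~~ e) d j == ext e d i, lo (~~ d) i <= lo (~~ d) j & hi (~~ d) j <= hi (~~ d) i].
have N j : ext (~~ e) d j = ext e d i -> ~~ inI s (lo (~~ d) j) (hi (~~ d) j) t.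
  move=> ej; apply/negP => h; have := un j; case/negP; apply/(hasqP M d).
  by rewrite /upd !crdE xe -ej; split => //; have := inI_side HM (~~ e) d j; rewrite negbK.
have S j z b' : crd d z = ext e d i -> inI b' (lo (~~ d) i) (hi (~~ d) i) (crd (~~ d) z) ->
    hasq j z (mk d e b') -> across j.
  move=> ze zb hj.
  have hi' : hasq i z (mk d (~~ e) b').
    by apply/(hasqP M d); rewrite !crdE ze; split => //; exact: (inI_side HM).
  have ij : i != j.
    apply/eqP => E; subst j; have /(hasqP M d)[+ _] := hj; rewrite !crdE ze => /inI_ext h.
    by move: h; clear; case: e.
  have hj' : hasq j z (upd d (mk d (~~ e) b') (~~ crd d (mk d (~~ e) b'))) by rewrite /upd !crdE.
  have [e' [e1 e2 dd]] := adj_dom HM ij hi' hj'.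
  have ee : e' = e by apply: (@ext_inj _ _ d i); rewrite -e1.
  subst e'; case: dd => /and5P[_ /eqP E a c _]; last by rewrite /across -e2 e1 eqxx a c.
  have := N j (esym E); case/negP; move: q2; rewrite /inI; case: (s) => /andP[u v].
    by rewrite (le_trans a u) (lt_le_trans v c).
  by rewrite (le_lt_trans a u) (le_trans v c).
pose P (a : R) := if s then a <= t else a < t.
have Pmono (a c : R) : a <= c -> P c -> P a by rewrite /P; case: (s) => h; [exact: le_trans|exact: le_lt_trans].
have PI (l u : R) : inI s l u t = P l && ~~ P u by rewrite /P /inI; case: (s); rewrite -?ltNge -?leNgt.
pose Q b' j := across j && (if b' then P (hi (~~ d) j) else ~~ P (lo (~~ d) j)).
have Q0 j : across j -> Q true j \/ Q false j.
  move=> aj; rewrite /Q aj /=; have /and3P[/eqP/N + _ _] := aj; rewrite PI.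
  by case: (P (hi (~~ d) j)); [left|rewrite andbT => ->; right].
have QN b' j : ~~ Q b' j.
  apply/negP => Qj; pose F k := if b' then ext b' (~~ d) k else - ext b' (~~ d) k.
  case: (@arg_maxP _ R _ j (Q b') F Qj) => {Qj} {}j Qj jmax.
  have /andP[aj bj] := Qj; have /and3P[/eqP E a c] := aj; set T := ext b' (~~ d) j in F jmax bj *.
  pose z : pt := mk d (ext e d i) (ext b' (~~ d) j).
  have lj := qm_lt HM (~~ d) j.
  have zi : lo (~~ d) i < ext b' (~~ d) j < hi (~~ d) i.
    move: q2; rewrite PI => /andP[p1 p2]; move: bj; rewrite /T; case: (b') => bj.
      rewrite (le_lt_trans a lj) /= ltNge; apply/negP => h; case/negP: p2; exact: Pmono bj.
    rewrite (lt_le_trans lj c) andbT ltNge; apply/negP => h; case/negP: bj; exact: Pmono p1.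
  have nz : node z by rewrite /z -E; exact: node_mk.
  have hz : hang i z d by apply/hangP; exists e; rewrite /z !crdE.
  have [l hl] := gr_cover HG (mk d e b') nz hz.
  have al : across l by apply: S hl; rewrite /z !crdE //; exact: inI_strict.
  have /(hasqP M d)[_] := hl; rewrite /z !crdE => hl'.
  have Ql : Q b' l.
    have := Q0 l al; have : ~~ Q (~~ b') l.
      rewrite /Q al /=; move: bj hl'; rewrite /T; case: (b') => /= bj /andP[h1 h2].
        by rewrite negbK; exact: Pmono bj.
      by apply/negP => h; case/negP: bj; exact: Pmono h.
    by case: (b') => /negbTE -> [].
  have := jmax l Ql; rewrite /F; move: hl'; case: (b') => /= /andP[h1 h2].
    by rewrite leNgt h2.
  by rewrite lerN2 leNgt h1.
by have [h|h] := Q0 k (S _ _ _ ye yb hk); have := QN _ k; [move/(_ true)|move/(_ false)]; rewrite h.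
Qed.

Lemma uncovered_side_bd i x d q : hasq i x q -> (forall k, ~~ hasq k x (upd d q (~~ crd d q))) ->
  crd d x = ext (~~ crd d q) d i /\ forall t, lo (~~ d) i <= t <= hi (~~ d) i ->
    bd Om (mk d (ext (~~ crd d q) d i) t).
Proof.
move=> hq un; have [xe H] := uncovered_side hq un; split => // t ht.
have [b hb] := inI_ex (qm_lt HM _ _) ht.
apply/(bd_uncovered HC oOm HL).
  by exists i; apply/(clP M d); rewrite !crdE; split => //; exact: ext_le.
by exists (mk d (~~ crd d q) b) => k; apply: H; rewrite !crdE.
Qed.

Section Vanishing.
Variables (v : 'I_n -> pt -> R).
Hypothesis v0 : vanishes_on_bd Om M v.

Lemma side_vanish i x d q y : hasq i x q -> (forall k, ~~ hasq k x (upd d q (~~ crd d q))) ->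
  cl i y -> crd d y = ext (~~ crd d q) d i -> v i y = 0 /\ bd Om y.
Proof.
move=> hq un ciy ye; have [xe H] := uncovered_side_bd hq un.
have /(clP M d)[_ yt] := ciy; have l := qm_lt HM (~~ d) i; split; last by rewrite -(mkE d y) ye; exact: H.
set e := ~~ crd d q in xe H ye.
apply: (@v0 i (mk d (ext e d i) (lo (~~ d) i), mk d (ext e d i) (hi (~~ d) i))).
- by move=> /(congr1 (crd (~~ d))) /=; rewrite !crdE => E; rewrite E ltxx in l.
- move=> z /(segP _ _ _ (ltW l))[z1 z2]; rewrite -(mkE d z) z1; split; last exact: H.
  exact: (bd_side HC oOm HL).
- by apply/segP => //; exact: ltW.
Qed.

Section Targets.
Variables (Phi : R -> R) (tg : pt -> R).
Hypotheses (Phi0 : Phi 0 = 1) (Phi1 : Phi 1 = 0).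
Hypothesis tg2 : forall x, node x -> (forall i d, ~~ hang i x d) -> tg x = vref M v x.
Hypothesis bal : balanced M Phi tg v.

(** A boundary node has a missing quadrant and so does not hang, by [gr_cover]. Its target is the
    value of the reference element, which has a boundary side at the node, where [v] vanishes. *)
Lemma tgt_bd x : node x -> bd Om x -> tg x = 0.
Proof.
move=> nx bx; have [q [[k hk] un]] := bd_quadrant HC oOm HL bx.
have nh i d : ~~ hang i x d.
  by apply/negP => /(gr_cover HG (oppq q) nx)[l hl]; have := un l; rewrite hl.
rewrite tg2 // /vref /refel /hdat; case: pickP => [p /andP[_]|_]; first by rewrite (negbTE (nh _ _)).
case: pickP => [i /existsP[p /existsP[d /andP[hp /existsPn np]]] /=|/= H].
  have [xe _] := uncovered_side_bd hp np.
  by have [] := side_vanish hp np (hasq_cl hp) xe.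
(* Such an element exists: on the way from the covered quadrant [q] to its uncovered opposite, some
   covered quadrant is adjacent to an uncovered one. *)
exfalso; have [/existsP[l hl]|/existsPn h] := boolP [exists l, hasq l x (upd false q (~~ crd false q))].
  have /negbT/negP := H l; apply; apply/existsP; exists (upd false q (~~ crd false q)).
  apply/existsP; exists true; rewrite hl /=; apply/existsPn => m.
  exact: un.
have /negbT/negP := H k; apply; apply/existsP; exists q; apply/existsP; exists false.
by rewrite hk; apply/existsPn.
Qed.

(** Apart from nodes, [x] lies inside a side with no element across. This side receives no lift and
    is entirely contained in the boundary, where [v] and the targets at its two ends vanish. *)
Lemma interp_bd i x : cl i x -> bd Om x -> interp M Phi tg v i x = 0.
Proof.
move=> ci bx; have [nx|nx] := boolP (node x).
  by rewrite (interp_node HM Phi0 Phi1 bal) // tgt_bd.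
have [q un] : exists q, forall k, ~~ hasq k x q.
  by apply/(bd_uncovered HC oOm HL) => //; exists i.
have [vi|[d hd]|h] := cl_cases ci.
- by case/negP: nx; apply/existsP; exists i.
- have /hangP[e he hs] := hd.
  have I b : hasq i x (mk d (~~ e) b) by apply: (side_hasq HM he hs); rewrite crdE.
  have qe : crd d q = e.
    apply/eqP/contraT => qe; have := un i; rewrite -(mkE d q) (bool_neq qe) I //.
  rewrite (interp_side HM Phi0 Phi1 bal ci he) /lift; case: pickP => [j dj|_].
    by have := un j; rewrite (dom_hasq HM dj he hs).
  have F k : ~~ hasq k x (upd d (mk d (~~ e) (crd (~~ d) q)) (~~ crd d (mk d (~~ e) (crd (~~ d) q)))).
    by rewrite /upd !crdE -[X in mk d X _]qe mkE.
  have V y : cl i y -> crd d y = ext e d i -> v i y = 0 /\ bd Om y.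
    by move=> cy ye; apply: (side_vanish (I _) F cy); rewrite crdE negbK.
  rewrite addr0 (vc_side HM Phi0 Phi1 _ _ he) (V x ci he).1 add0r big1 // => e' _.
  set z := upd _ _ _; have zE : z = mk d (ext e d i) (ext e' (~~ d) i) by rewrite /z /upd negbK mkN he.
  have cz : cl i z by apply: (vert_cl HM); rewrite zE; exact: vert_mk.
  have [-> bz] : v i z = 0 /\ bd Om z by apply: V => //; rewrite zE crdE.
  by rewrite tgt_bd ?subrr ?mul0r // zE; exact: node_mk.
- by have := un i; rewrite h.
Qed.

End Targets.
End Vanishing.
End BoundaryValues.

(** * Smooth functions of one variable *)

Section SmoothLine.
Variable R : realType.
Implicit Types (f g : R -> R) (x t : R).

(** The factor x^(-k) makes the family stable under differentiation: by [flat_derive] derivatives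
    are combinations of members with larger index. *)
Definition flat (k : nat) x : R := if 0 < x then x^-1 ^+ k * expR (- x^-1) else 0.

Lemma flat_ge0 k x : 0 <= flat k x.
Proof. by rewrite /flat; case: ifP => // h; rewrite mulr_ge0 ?expR_ge0 // exprn_ge0 // invr_ge0 ltW. Qed.

Lemma flat_gt0 k x : 0 < x -> 0 < flat k x.
Proof. by move=> h; rewrite /flat h mulr_gt0 ?expR_gt0 // exprn_gt0 // invr_gt0. Qed.

Lemma flat_le0 k x : x <= 0 -> flat k x = 0.
Proof. by rewrite /flat ltNge => ->. Qed.

(** From one term of the exponential series; the quadratic bound yields the derivative 0 at the
    origin. *)
Lemma flat_le k x : flat k x <= (k.+2)`!%:R * x ^+ 2.
Proof.
have F0 : 0 < (k.+2)`!%:R :> R by rewrite ltr0n fact_gt0.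
rewrite /flat; case: ifP => [h|_]; last by rewrite mulr_ge0 ?sqr_ge0 // ltW.
have y0 : 0 <= x^-1 by rewrite invr_ge0 ltW.
have := expR_ge1Dxn k.+1 y0 => h1.
have h2 : x^-1 ^+ k.+2 <= (k.+2)`!%:R * expR x^-1.
  by rewrite mulrC -ler_pdivrMr //; lra.
have x2 : 0 < x ^+ 2 by rewrite exprn_gt0.
rewrite expRN ler_pdivrMr ?expR_gt0 // mulrAC -ler_pdivrMr // -exprVn.
by rewrite -exprD addn2.
Qed.

Lemma flat_derive k x : is_derive x (1 : R) (flat k) (flat k.+2 x - k%:R * flat k.+1 x).
Proof.
have [x0|x0|x0] := ltgtP 0 x.
- have dV : is_derive x (1 : R) (fun t : R => t^-1) (- x ^- 2 *: 1).
    by apply: (is_deriveV (f := id)); rewrite gt_eqF.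
  have dN : is_derive x (1 : R) (fun t : R => - t^-1) (x ^- 2).
    by apply: (is_derive_eq (is_deriveN dV)); rewrite /GRing.scale /= mulr1 opprK.
  have dE : is_derive x (1 : R) (fun t : R => expR (- t^-1)) (expR (- x^-1) * x ^- 2).
    exact: (is_derive1_comp (is_derive_expR _) dN).
  have dX : is_derive x (1 : R) (fun t : R => t^-1 ^+ k) (k%:R * x^-1 ^+ k.-1 * - x ^- 2).
    have h := is_deriveX k dV; rewrite exprfctE in h.
    by apply: (is_derive_eq h); rewrite /GRing.scale /= mulr1.
  have dM := is_deriveM dX dE.
  apply: (near_eq_is_derive (f := fun t : R => t^-1 ^+ k * expR (- t^-1))).
    by near=> t; rewrite /flat ifT //; near: t; apply: cvgr_gt x0; exact: cvg_id.
  apply: (is_derive_eq dM); rewrite /flat x0 /GRing.scale /= -!exprVn.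
  by case: (k) => [|j] /=; rewrite ?exprS; ring.
- rewrite !flat_le0 ?ltW // mulr0 subr0.
  apply: (near_eq_is_derive _ (is_derive_cst 0 x (1 : R))).
  near=> t; rewrite flat_le0 // ltW //; near: t.
  by apply: cvgr_lt x0; exact: cvg_id.
- rewrite -x0 !flat_le0 // mulr0 subr0.
  have H : h^-1 *: (flat k (h *: 1 + 0) - flat k 0) @[h --> (0 : R)^'] --> (0 : R).
    have F0 : 0 < (k.+2)`!%:R :> R by rewrite ltr0n fact_gt0.
    apply/cvgr0Pnorm_le => e e0; near=> h.
    have h0 : h != 0 by near: h; exact: nbhs_dnbhs_neq.
    rewrite [flat k 0]flat_le0 // subr0 addr0 /GRing.scale /= mulr1.
    rewrite normrM normfV ler_pdivrMl ?normr_gt0 // ger0_norm ?flat_ge0 //.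
    apply: le_trans (flat_le _ _) _; rewrite -real_normK ?num_real // expr2 mulrA mulrC ler_wpM2l //.
    rewrite -ler_pdivlMl //; near: h; apply: dnbhs0_le; by rewrite mulr_gt0 ?invr_gt0.
  apply: DeriveDef; first by apply/cvg_ex; exists 0.
  by apply/cvg_lim.
Unshelve. all: by end_near. Qed.

(** A class of expressions closed under differentiation ([Sm_derive]), hence made of smooth
    functions. *)
Inductive Sm : (R -> R) -> Prop :=
| Sm_cst c : Sm (fun=> c)
| Sm_id : Sm id
| Sm_add f g : Sm f -> Sm g -> Sm (fun x => f x + g x)
| Sm_mul f g : Sm f -> Sm g -> Sm (fun x => f x * g x)
| Sm_inv f : (forall x, f x != 0) -> Sm f -> Sm (fun x => (f x)^-1)
| Sm_flat k f : Sm f -> Sm (fun x => flat k (f x)).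

Lemma Sm_derive f : Sm f -> exists2 f', Sm f' & forall x, is_derive x (1 : R) f (f' x).
Proof.
elim=> {f} [c||f g sf [f' sf' df] sg [g' sg' dg]|f g sf [f' sf' df] sg [g' sg' dg]|f f0 sf [f' sf' df]|k f sf [f' sf' df]].
- by exists (fun=> 0) => [|x]; [exact: Sm_cst|exact: is_derive_cst].
- by exists (fun=> 1) => [|x]; [exact: Sm_cst|exact: is_derive_id].
- by exists (fun x => f' x + g' x) => [|x]; [exact: Sm_add|exact: (is_deriveD (df x) (dg x))].
- exists (fun x => f x * g' x + g x * f' x) => [|x]; first by apply: Sm_add; exact: Sm_mul.
  exact: (is_deriveM (df x) (dg x)).
- exists (fun x => -1 * ((f x)^-1 * (f x)^-1) * f' x) => [|x].
    by apply: Sm_mul => //; apply: Sm_mul; [exact: Sm_cst|apply: Sm_mul; exact: Sm_inv].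
  apply: (is_derive_eq (is_deriveV (f0 x) (df x))).
  by rewrite /GRing.scale /= expr2 invfM mulN1r.
- exists (fun x => (flat k.+2 (f x) + - k%:R * flat k.+1 (f x)) * f' x) => [|x].
    apply: Sm_mul => //; apply: Sm_add; first exact: Sm_flat.
    by apply: Sm_mul; [exact: Sm_cst|exact: Sm_flat].
  apply: (is_derive_eq (is_derive1_comp (flat_derive k (f x)) (df x))).
  by rewrite mulNr.
Qed.

Lemma Sm_continuous f : Sm f -> continuous f.
Proof.
move=> /Sm_derive[f' _ df] x; apply: differentiable_continuous; apply/derivable1_diffP.
by have [] := df x.
Qed.

Lemma Sm_horner (p : {poly R}) f : Sm f -> Sm (fun x => p.[f x]).
Proof.
move=> sf; elim/poly_ind: p => [|p c IH].
  by under eq_fun do rewrite horner0; exact: Sm_cst.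
under eq_fun do rewrite hornerMXaddC.
by apply: Sm_add; [exact: Sm_mul|exact: Sm_cst].
Qed.

(** Equal to 1 for |t| <= 1/2 and to 0 for |t| >= 1; at each point one of the two summands of the
    denominator is positive. *)
Definition bump t : R := flat 0 (1 - t * t) / (flat 0 (1 - t * t) + flat 0 (t * t - 4^-1)).

Lemma bump_den t : 0 < flat 0 (1 - t * t) + flat 0 (t * t - 4^-1).
Proof.
have [h|h] := ltP (t * t) 1; first by rewrite ltr_wpDr ?flat_ge0 // flat_gt0 // subr_gt0.
by rewrite ltr_wpDl ?flat_ge0 // flat_gt0 //; lra.
Qed.

Lemma Sm_bump : Sm bump.
Proof.
have S1 : Sm (fun t => flat 0 (1 - t * t)).
  apply: Sm_flat; have := Sm_add (Sm_cst 1) (Sm_mul (Sm_cst (-1)) (Sm_mul Sm_id Sm_id)).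
  by under eq_fun do rewrite mulN1r.
apply: Sm_mul => //; apply: Sm_inv => [t|]; first by rewrite gt_eqF // bump_den.
by apply: Sm_add => //; apply: Sm_flat; apply: (Sm_add (Sm_mul Sm_id Sm_id) (Sm_cst _)).
Qed.

Lemma bump_bound t : 0 <= bump t <= 1.
Proof.
rewrite divr_ge0 ?flat_ge0 ?(ltW (bump_den t)) //= ler_pdivrMr ?bump_den // mul1r lerDl.
exact: flat_ge0.
Qed.

Lemma bump1 t : `|t| <= 2^-1 -> bump t = 1.
Proof.
move=> h; have tt : t * t <= 4^-1.
  by rewrite -expr2 -real_normK ?num_real // (_ : 4^-1 = 2^-1 ^+ 2) ?ler_sqr ?nnegrE //; field.
by rewrite /bump [flat 0 (t * t - _)]flat_le0 ?addr0 ?divff ?gt_eqF ?flat_gt0 ?subr_le0 //; lra.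
Qed.

Lemma bump0 t : 1 <= `|t| -> bump t = 0.
Proof.
move=> h; have tt : 1 <= t * t by rewrite -expr2 -real_normK ?num_real // exprn_ege1.
by rewrite /bump flat_le0 ?mul0r ?subr_le0.
Qed.

Lemma bump_derive : exists (f : R -> R) (K : R), [/\ Sm f, 0 <= K,
  forall t, is_derive t (1 : R) bump (f t), forall t, `|f t| <= K & forall t, 1 < `|t| -> f t = 0].
Proof.
have [f sf df] := Sm_derive Sm_bump.
have f0 t : 1 < `|t| -> f t = 0.
  move=> h; have d0 : is_derive t (1 : R) bump 0.
    apply: (near_eq_is_derive _ (is_derive_cst 0 t (1 : R))).
    near=> s; rewrite bump0 // ltW //; near: s.
    by apply: cvgr_gt h; apply: cvg_norm; exact: cvg_id.
  by rewrite -(@derive_val _ _ _ _ _ _ _ (df t)) (@derive_val _ _ _ _ _ _ _ d0).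
have m1 : -1 <= 1 :> R by lra.
have cn : {within `[-1, 1], continuous (fun t => `|f t|)}.
  by apply: continuous_subspaceT => t; apply: cvg_norm; exact: (Sm_continuous sf).
have [c _ hc] := EVT_max m1 cn.
exists f, `|f c|; split => // t; have [h|h] := leP `|t| 1; last by rewrite f0 // normr0.
by apply: hc; rewrite in_itv /= -ler_norml.
Unshelve. all: by end_near. Qed.

Definition plateau (X : seq R) (e t : R) : R := t + \sum_(c <- X) (c - t) * bump ((t - c) / e).

(** [K] does not depend on [e], as dominated convergence will require: the critical term (c - t)
    f((t - c)/e) / e is bounded because [f] vanishes once |t - c| exceeds [e]. The fourth clause
    says that no point is moved across a grid value. *)
Lemma plateau_bounds (X : seq R) (g : R) : uniq X -> (forall c c', c \in X -> c' \in X -> c != c' -> g <= `|c - c'|) ->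
  exists K : R, forall e, 0 < e -> 2 * e <= g -> let S := plateau X e in Sm S /\
  exists S' : R -> R, [/\ forall t, is_derive t (1 : R) S (S' t), forall t, `|S' t| <= K,
    forall c t, c \in X -> `|t - c| <= e / 2 -> S t = c,
    forall c t, c \in X -> (c <= t -> c <= S t) /\ (t <= c -> S t <= c)
    & forall t, (forall c, c \in X -> e <= `|t - c|) -> S t = t].
Proof.
move=> uX gX; have [f [K [sf K0 df fK f0]]] := bump_derive.
exists (1 + (size X)%:R * (1 + K)) => e e0 eg S.
have Sc c : Sm (fun t => (c - t) * bump ((t - c) / e)).
  have l : Sm (fun t => c - t).
    by have := Sm_add (Sm_cst c) (Sm_mul (Sm_cst (-1)) Sm_id); under eq_fun do rewrite mulN1r.
  apply: Sm_mul => //; have r : Sm (fun t => (t - c) / e) by apply: (Sm_mul (Sm_add Sm_id (Sm_cst _)) (Sm_cst _)).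
  have r1 : Sm (fun t => 1 - (t - c) / e * ((t - c) / e)).
    have := Sm_add (Sm_cst 1) (Sm_mul (Sm_cst (-1)) (Sm_mul r r)).
    by under eq_fun do rewrite mulN1r.
  apply: (Sm_mul (Sm_flat 0 r1)); apply: Sm_inv => [t|]; first by rewrite gt_eqF // bump_den.
  by apply: Sm_add; apply: Sm_flat => //; apply: (Sm_add (Sm_mul r r) (Sm_cst _)).
have dc c t : is_derive t (1 : R) (fun t => (c - t) * bump ((t - c) / e))
    ((c - t) * (f ((t - c) / e) / e) - bump ((t - c) / e)).
  have d1 : is_derive t (1 : R) (fun t : R => c - t) (0 - 1).
    exact: (is_deriveB (is_derive_cst c t (1 : R)) (is_derive_id t (1 : R))).
  have d2 : is_derive t (1 : R) (fun t : R => (t - c) / e) e^-1.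
    have h := is_deriveM (is_deriveB (is_derive_id t (1 : R)) (is_derive_cst c t (1 : R))) (is_derive_cst e^-1 t (1 : R)).
    by apply: (is_derive_eq h); rewrite /GRing.scale /= subr0; ring.
  have d3 : is_derive t (1 : R) (fun t : R => bump ((t - c) / e)) (f ((t - c) / e) * e^-1).
    exact: (is_derive1_comp (df _) d2).
  by apply: (is_derive_eq (is_deriveM d1 d3)); rewrite /GRing.scale /=; ring.
have b0 c t : e <= `|t - c| -> bump ((t - c) / e) = 0.
  by move=> h; apply: bump0; rewrite normrM normfV (gtr0_norm e0) ler_pdivlMr // mul1r.
(* As [2 * e <= g], at most one grid value is within distance [e] of [t]. *)
have one c t : c \in X -> `|t - c| < e -> S t = t + (c - t) * bump ((t - c) / e).
  move=> cX h; rewrite /S /plateau; congr (_ + _).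
  rewrite (big_rem _ cX) /= big_seq big1 ?addr0 // => c'.
  rewrite mem_rem_uniq // inE => /andP[cc c'X]; rewrite b0 ?mulr0 //.
  have := gX _ _ c'X cX cc; have := ler_distD t c' c; rewrite (distrC c' t).
  move: h; lra.
have none t : (forall c, c \in X -> e <= `|t - c|) -> S t = t.
  by move=> h; rewrite /S /plateau big_seq big1 ?addr0 // => c /h/b0 ->; rewrite mulr0.
split.
  apply: Sm_add; first exact: Sm_id.
  elim: (X) => [|c s IH]; first by under eq_fun do rewrite big_nil; exact: Sm_cst.
  by under eq_fun do rewrite big_cons; exact: Sm_add.
exists (fun t => 1 + \sum_(c <- X) ((c - t) * (f ((t - c) / e) / e) - bump ((t - c) / e))); split => //.
- move=> t; apply: (is_deriveD (is_derive_id t (1 : R))).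
  elim: (X) => [|c s IH]; first by under eq_fun do rewrite big_nil; rewrite big_nil; exact: is_derive_cst.
  by under eq_fun do rewrite big_cons; rewrite big_cons; exact: is_deriveD.
- move=> t; apply: le_trans (ler_normD _ _) _; rewrite normr1 lerD2l.
  apply: le_trans (ler_norm_sum _ _ _) _.
  have B c : `|(c - t) * (f ((t - c) / e) / e) - bump ((t - c) / e)| <= 1 + K.
    apply: le_trans (ler_normB _ _) _; rewrite addrC; apply: lerD.
      by rewrite ger0_norm; have /andP[] := bump_bound ((t - c) / e).
    have [h|h] := leP `|(t - c) / e| 1; last by rewrite f0 // mul0r mulr0 normr0.
    have -> : (c - t) * (f ((t - c) / e) / e) = - ((t - c) / e) * f ((t - c) / e) by field; rewrite gt_eqF.
    rewrite normrM normrN; apply: le_trans (ler_piMl (normr_ge0 _) h) (fK _).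
  by elim: (X) => [|c s IH]; rewrite ?big_nil ?mul0r // big_cons /= -natr1 [leRHS]mulrDl mul1r addrC lerD.
- move=> c t cX h; rewrite (one _ _ cX); last by apply: le_lt_trans h _; lra.
  rewrite bump1; first by rewrite mulr1 addrC subrK.
  by rewrite normrM normfV (gtr0_norm e0) ler_pdivrMr // mulrC.
- move=> c t cX; have [/hasP[a aX ha]|/hasPn h] := boolP (has (fun a => `|t - a| < e) X); last first.
    by rewrite none // => a /h; rewrite -leNgt.
  rewrite (one _ _ aX ha); have /andP[] := bump_bound ((t - a) / e); set b := bump _ => l1 l2.
  have [E|ne] := eqVneq a c; first by rewrite E; split => h'; nra.
  have := gX _ _ aX cX ne; move: ha; rewrite ltr_norml => /andP[h1 h2].
  have [ac|ca] := leP a c.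
    by rewrite ler0_norm ?subr_le0 // => gg; split => h'; [lra|nra].
  by rewrite gtr0_norm ?subr_gt0 // => gg; split => h'; [nra|lra].
Qed.

End SmoothLine.

Section LocallySmooth.
Variable R : realType.
Local Notation pt := (R * R)%type.
Implicit Types (f g : pt -> R) (x y : pt) (b : bool).

Inductive Sm2 : (pt -> R) -> Prop :=
| Sm2_0 : Sm2 (fun=> 0)
| Sm2_add (a c : R -> R) f : Sm a -> Sm c -> Sm2 f -> Sm2 (fun x => a x.1 * c x.2 + f x).

Lemma Sm2_derive b f : Sm2 f -> exists2 f', Sm2 f' &
  forall x, is_derive (crd b x) (1 : R) (fun t => f (mk b t (crd (~~ b) x))) (f' x).
Proof.
elim=> {f} [|a c f sa sc _ [f' sf' df]].
  by exists (fun=> 0) => [|x]; [exact: Sm2_0|exact: is_derive_cst].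
have [a' sa' da] := Sm_derive sa; have [c' sc' dc] := Sm_derive sc.
exists (fun x => (if b then a else a') x.1 * (if b then c' else c) x.2 + f' x) => [|x].
  by apply: Sm2_add => //; case: b {df}.
have := df x; case: b {df} => /= dfx.
  have dm := is_deriveM (is_derive_cst (a x.1) x.2 (1 : R)) (dc x.2).
  by apply: (is_derive_eq (is_deriveD dm dfx)); rewrite /GRing.scale /=; ring.
have dm := is_deriveM (da x.1) (is_derive_cst (c x.2) x.1 (1 : R)).
by apply: (is_derive_eq (is_deriveD dm dfx)); rewrite /GRing.scale /=; ring.
Qed.

Lemma Sm2_continuous f : Sm2 f -> continuous f.
Proof.
elim=> {f} [x|a c f sa sc _ cf x]; first exact: cvg_cst.
apply: cvgD; last exact: cf.
apply: (@cvgM _ _ _ _ (fun x : pt => a x.1) (fun x : pt => c x.2)).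
  by apply: (@continuous_comp _ _ _ (fst : pt -> R) a); [exact: cvg_fst|exact: Sm_continuous].
by apply: (@continuous_comp _ _ _ (snd : pt -> R) c); [exact: cvg_snd|exact: Sm_continuous].
Qed.

(** The approximations are given by different formulas near different points; [Sm2] is closed under
    partial derivatives, so local agreement with its members suffices for smoothness. *)
Definition locsm f := forall x, exists2 g, Sm2 g & \forall y \near x, f y = g y.

Lemma near_eq_pderiv b f g x : (\forall y \near x, f y = g y) -> pderiv b f x = pderiv b g x.
Proof. exact: near_eq_derive. Qed.

Lemma locsm_pderiv b f : locsm f -> locsm (pderiv b f) /\ forall x, derivable f x (dir R b).
Proof.
move=> lf; split=> x; have [g sg fg] := lf x; have [g' sg' dg] := Sm2_derive b sg.
  exists g' => //; have fg' := near_join fg; apply: filterS fg' => y /(near_eq_pderiv b) ->.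
  by rewrite pderivE derive1E (@derive_val _ _ _ _ _ _ _ (dg y)).
apply: (near_eq_derivable (f := g)); last by rewrite pderivableE; have [] := dg x.
by apply: filterS fg => y ->.
Qed.

Lemma locsm_continuous f : locsm f -> continuous f.
Proof.
move=> lf x; have [g sg fg] := lf x.
rewrite /continuous_at (nbhs_singleton fg).
apply: cvg_trans (Sm2_continuous sg (x := x)); apply: near_eq_cvg.
by apply: filterS fg => y ->.
Qed.

Lemma locsm_smooth f : locsm f -> smooth f.
Proof.
move=> lf s; have : locsm (foldr (@pderiv R) f s).
  by elim: s => //= b s IH; have [] := locsm_pderiv b IH.
by move=> lg /=; split; [exact: locsm_continuous|move=> x b; have [_] := locsm_pderiv b lg].
Qed.

Lemma Sm2_sum (s : seq ({poly R} * {poly R})) (S : R -> R) : Sm S ->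
  Sm2 (fun x => \sum_(g <- s) g.1.[S x.1] * g.2.[S x.2]).
Proof.
move=> sS; elim: s => [|g s IH]; first by under eq_fun do rewrite big_nil; exact: Sm2_0.
under eq_fun do rewrite big_cons.
by apply: (Sm2_add (Sm_horner g.1 sS) (Sm_horner g.2 sS)).
Qed.

End LocallySmooth.

(** * Approximation by test functions *)

Section Approximation.
Variables (R : realType) (Om : set (R * R)) (n : nat) (M : n.-tuple (rect R)).
Local Notation pt := (R * R)%type.
Local Notation mpt := (measurableTypeR R * measurableTypeR R)%type.
Local Notation mu1 := (@lebesgue_measure R).
Implicit Types (i j : 'I_n) (d e b : bool) (x y z : pt) (q : bool * bool).
Local Notation ext := (ext M).
Local Notation lo := (ext false).
Local Notation hi := (ext true).
Local Notation hasq := (hasq M).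
Local Notation cl := (cl M).

Hypothesis HC : cartesian_mesh Om M.
Hypothesis oOm : open Om.
Hypothesis HL : lipschitz_boundary Om.
Let HM : quad_mesh M := quad_mesh_of HC oOm HL.

Definition grid : seq R := undup [seq ext p.1.1 p.1.2 p.2 | p : bool * bool * 'I_n].

Lemma grid_ext e d i : ext e d i \in grid.
Proof. by rewrite mem_undup; apply/mapP; exists (e, d, i); rewrite ?mem_enum. Qed.

Lemma seq_separated (s : seq R) : exists2 g : R, 0 < g &
  forall c c', c \in s -> c' \in s -> c != c' -> g <= `|c - c'|.
Proof.
elim: s => [|a s [g g0 hg]]; first by exists 1.
have [e e0 he] := seq_gap s a.
exists (Num.min g e) => [|c c']; first by rewrite lt_min g0.
rewrite !inE ge_min => /predU1P[->|cs] /predU1P[->|cs'] ne.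
- by rewrite eqxx in ne.
- by rewrite distrC (ltW (he _ cs' _)) ?orbT // eq_sym.
- by rewrite (ltW (he _ cs _)) ?orbT.
- by rewrite hg.
Qed.

Lemma box_bound : exists2 B : R, 0 < B & forall i x d, cl i x -> `|crd d x| <= B.
Proof.
exists (1 + \sum_i \sum_d (`|lo d i| + `|hi d i|)) => [|i x d /forallP/(_ d) /andP[h1 h2]].
  by rewrite ltr_wpDr // sumr_ge0 // => i _; rewrite sumr_ge0 // => d _; rewrite addr_ge0.
rewrite (bigD1 i) //= (bigD1 d) //=.
have : `|crd d x| <= `|lo d i| + `|hi d i|.
  have := ler_norm (hi d i); have := ler_norm (- lo d i); rewrite normrN => a b.
  by rewrite ler_norml; have := normr_ge0 (lo d i); have := normr_ge0 (hi d i); move=> ? ?; apply/andP; split; lra.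
move=> h; have p1 : 0 <= \sum_(k | k != d) (`|lo k i| + `|hi k i|) by rewrite sumr_ge0 // => ? _; rewrite addr_ge0.
have p2 : 0 <= \sum_(k < n | k != i) \sum_d (`|lo d k| + `|hi d k|).
  by rewrite sumr_ge0 // => ? _; rewrite sumr_ge0 // => ? _; rewrite addr_ge0.
lra.
Qed.

Lemma Om_finite : (@mu2 R Om < +oo)%E.
Proof.
have [B B0 hB] := box_bound; pose K : rect R := ((- (B + 1), - (B + 1)), (B + 1, B + 1)).
apply: le_lt_trans (box_finite K); apply: le_measure; rewrite ?inE.
- exact: (mOm oOm).
- exact: measurable_box.
move=> x /subset_closure/(closureOmP HC)[i ci].
have := hB _ _ false ci; have := hB _ _ true ci; rewrite /= !ler_norml => /andP[a1 a2] /andP[b1 b2].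
by split => /=; apply/andP; split; lra.
Qed.

Lemma grid_negligible : (@mu2 R).-negligible [set x : mpt | x.1 \in grid \/ x.2 \in grid].
Proof.
pose F k : set mpt := [set (nth 0 grid k : measurableTypeR R)] `*` setT `|` setT `*` [set (nth 0 grid k : measurableTypeR R)].
apply: (@negligibleS _ _ _ _ (\bigcup_k F k)).
  by move=> x [h|h]; [exists (index x.1 grid)|exists (index x.2 grid)] => //; [left|right]; split => //=; rewrite nth_index.
apply: negligible_bigcup => k; apply: negligibleU.
  apply/negligibleP; first by apply: measurableX.
  have := product_measure1E mu1 mu1 (measurable_set1 (nth 0 grid k)) measurableT.
  move=> E; apply: (eq_trans E).
  by apply: (eq_trans (congr1 (fun a => a * _)%E (lebesgue_measure_set1 (nth 0 grid k)))); rewrite mul0e.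
apply/negligibleP; first by apply: measurableX.
have := product_measure1E mu1 mu1 measurableT (measurable_set1 (nth 0 grid k)).
move=> E; apply: (eq_trans E).
by apply: (eq_trans (congr1 (fun a => _ * a)%E (lebesgue_measure_set1 (nth 0 grid k)))); rewrite mule0.
Qed.

(** Dominated convergence on the set [Om] of finite measure; the grid lines, where nothing is
    assumed about the limit, form a null set. *)
Lemma L2norm_cvg0 (h : nat -> pt -> R) (B : R) :
  (forall k, measurable_fun (Om : set mpt) (h k : mpt -> R)) ->
  (forall k x, Om x -> `|h k x| <= B) ->
  (forall x, Om x -> x.1 \notin grid -> x.2 \notin grid -> \forall k \near \oo, h k x = 0) ->
  L2norm Om (h k) @[k --> \oo] --> (0 : R).
Proof.
move=> mh hB h0; have mO := mOm oOm.
have mf k : measurable_fun (Om : set mpt) (fun x => (h k x ^+ 2)%:E).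
  by apply/measurable_EFinP; exact: measurable_funX.
have ig : (@mu2 R).-integrable Om (EFin \o cst (B ^+ 2)).
  apply: measurable_bounded_integrable => //; first exact: Om_finite.
  by exists (B ^+ 2); split; [exact: num_real|move=> M' /ltW ? x _ /=; rewrite ger0_norm ?sqr_ge0].
have [] := @dominated_convergence _ _ _ (@mu2 R) Om mO (fun k x => (h k x ^+ 2)%:E) (cst 0%E) _ mf _ _ ig.
- exact: measurable_cst.
- have := grid_negligible; rewrite -[X in _.-negligible X]setCK => aeG.
  have : \forall x \ae @mu2 R, (~` [set x : mpt | x.1 \in grid \/ x.2 \in grid]) x by exact: aeG.
  apply: filterS => x nG Ox; apply: near_fcvg_to_cst_eq || idtac.
  have n1 : x.1 \notin grid by apply/negP => H; apply: nG; left.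
  have n2 : x.2 \notin grid by apply/negP => H; apply: nG; right.
  apply: cvg_near_cst; apply: filterS (h0 x Ox n1 n2) => k ->; by rewrite expr0n.
- apply: aeW => x k Ox; rewrite gee0_abs ?lee_fin ?sqr_ge0 //.
  by rewrite -real_normK ?num_real // ler_sqr ?nnegrE ?(le_trans _ (hB k x Ox)) ?hB.
move=> _ _; rewrite integral0 => H.
have H2 : \int[@mu2 R]_(x in Om) (h k x ^+ 2) @[k --> \oo] --> (0 : R).
  by apply: (fine_cvg (a := 0)); exact: H.
rewrite -[0]sqrtr0; apply: (@continuous_cvg _ _ _ _ _ _ Num.sqrt); last exact: H2.
exact: sqrt_continuous.
Qed.

(* z lies in the closure of the open grid cell, edge or node which contains x. *)
Definition below x z := forall d e i, (ext e d i <= crd d x -> ext e d i <= crd d z) /\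
  (crd d x <= ext e d i -> crd d z <= ext e d i).

Lemma below_cl i x z : below x z -> cl i x -> cl i z.
Proof.
move=> xz /forallP h; apply/forallP => d; have /andP[a c] := h d.
by rewrite (xz d false i).1 //= (xz d true i).2.
Qed.

(** If [z] were in [Om], the element covering the germ at [z] that points to [x] would also cover
    the given germ at [x]. All quadrants at [x] would be covered, and [x] would be in [Om]. *)
Lemma below_out x z : ~ Om x -> below x z -> ~ Om z.
Proof.
move=> nO xz Oz; apply: nO.
have H q : exists k, hasq k x q.
  pose q' : bool * bool := mk false (if crd false z == crd false x then q.1 else crd false z < crd false x)
    (if crd true z == crd true x then q.2 else crd true z < crd true x).
  have [k /forallP hk] := Om_covered HC oOm q' Oz; exists k; apply/forallP => d.
  have := hk d; have -> : crd d q' = if crd d z == crd d x then crd d q else crd d z < crd d x.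
    by rewrite /q'; case: (d).
  case: ltgtP => [zx|xz'|<- //]; rewrite {1}/inI => /andP[a c].
    have n1 : crd d x < hi d k.
      by rewrite ltNge; apply/negP => /(xz d true k).1; rewrite leNgt c.
    have n2 : lo d k < crd d x by apply: le_lt_trans zx.
    by rewrite /inI n1 n2 !ltW //; case: (crd d q).
  have n1 : lo d k < crd d x.
    by rewrite ltNge; apply/negP => /(xz d false k).2; rewrite leNgt a.
  have n2 : crd d x < hi d k by apply: lt_le_trans c.
  by rewrite /inI n1 n2 !ltW //; case: (crd d q).
apply: contrapT => nO; have [k hk] := H (true, true).
have hx : exists k, cl k x by exists k; exact: hasq_cl hk.
have /(bd_uncovered HC oOm HL hx)[q hq] : bd Om x by apply/(not_Om_bd HC oOm).
by have [l hl] := H q; have := hq l; rewrite hl.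
Qed.

Section Function.
Variable u : 'I_n -> pt -> R.
Hypothesis conf : forall i j x, cl i x -> cl j x -> u i x = u j x.
Hypothesis uQ : exists p, forall i, Qp p (u i).
Hypothesis u0 : forall i x, cl i x -> bd Om x -> u i x = 0.

Definition glue x := if [pick i | cl i x] is Some i then u i x else 0.

Lemma glue_in i x : cl i x -> glue x = u i x.
Proof. by move=> ci; rewrite /glue; case: pickP => [j cj|/(_ i)]; [exact: conf|rewrite ci]. Qed.

Lemma glue_out x : ~ Om x -> glue x = 0.
Proof.
move=> nO; rewrite /glue; case: pickP => // i ci; apply: u0 => //.
by apply/(not_Om_bd HC oOm) => //; exists i.
Qed.

Section Plateau.
Variables (S S' : R -> R) (e K : R).
Hypotheses (e0 : 0 < e) (sS : Sm S) (dS : forall t, is_derive t (1 : R) S (S' t)).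
Hypothesis SK : forall t, `|S' t| <= K.
Hypothesis Sc : forall c t, c \in grid -> `|t - c| <= e / 2 -> S t = c.
Hypothesis Sm : forall c t, c \in grid -> (c <= t -> c <= S t) /\ (t <= c -> S t <= c).
Hypothesis Si : forall t, (forall c, c \in grid -> e <= `|t - c|) -> S t = t.

Definition SS y : pt := (S y.1, S y.2).
Definition approx y := glue (SS y).

Lemma SS_crd d y : crd d (SS y) = S (crd d y). Proof. by case: d. Qed.

Lemma crd_cont d : continuous (crd d : pt -> R).
Proof. by case: d => x; [exact: cvg_snd|exact: cvg_fst]. Qed.

(** Points close to a grid line through [x] are sent onto it by [Sc], and [Sm] prevents the crossing
    of any other line. *)
Lemma near_below x : \forall y \near x, below x (SS y).
Proof.
have H d b i : \forall y \near x, (ext b d i <= crd d x -> ext b d i <= crd d (SS y)) /\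
    (crd d x <= ext b d i -> crd d (SS y) <= ext b d i).
  have cX := grid_ext b d i; set c := ext b d i in cX *.
  have [xc|cx|E] := ltgtP (crd d x) c.
  - near=> y; have h : crd d y < c by near: y; apply: cvgr_lt xc; exact: crd_cont.
    by rewrite SS_crd; split => // _; apply: (Sm _ cX).2; exact: ltW.
  - near=> y; have h : c < crd d y by near: y; apply: cvgr_gt cx; exact: crd_cont.
    by rewrite SS_crd; split => // _; apply: (Sm _ cX).1; exact: ltW.
  - near=> y; rewrite SS_crd (Sc cX) //; rewrite -E distrC; near: y.
    by apply: cvgr_dist_le; [exact: crd_cont|rewrite divr_gt0].
have := @filter_forall _ _ _ _ (nbhs_filter x) (fun p : bool * bool * 'I_n => H p.1.1 p.1.2 p.2).
by apply: filterS => y h d b i; exact: (h (d, b, i)).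
Unshelve. all: by end_near. Qed.

Lemma below_SS x : below x (SS x).
Proof. exact: nbhs_singleton (near_below x). Qed.

Lemma approx_in i x : cl i x -> \forall y \near x, approx y = u i (SS y).
Proof. by move=> ci; apply: filterS (near_below x) => y h; apply: glue_in; exact: below_cl h ci. Qed.

Lemma approx_out x : ~ Om x -> \forall y \near x, approx y = 0.
Proof. by move=> nO; apply: filterS (near_below x) => y h; apply: glue_out; exact: below_out h. Qed.

Lemma Om_cl x : Om x -> exists i, cl i x.
Proof. by move=> /subset_closure/(closureOmP HC). Qed.

Lemma approx_locsm : locsm approx.
Proof.
move=> x; have [/Om_cl[i ci]|nO] := pselect (Om x).
  have [p /(_ i)/Qp_tensor_sum[s hs]] := uQ.
  exists (fun y => \sum_(g <- s) g.1.[S y.1] * g.2.[S y.2]); first exact: Sm2_sum.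
  by apply: filterS (approx_in ci) => y ->; rewrite hs.
by exists (fun=> 0); [exact: Sm2_0|exact: approx_out].
Qed.

(** Near a point outside [Om], boundary points included, [SS] takes its values outside [Om], where
    the glued function is 0; so the closed support lies in [Om]. *)
Lemma approx_test : test_function Om approx.
Proof.
have sub : closure [set x | approx x != 0] `<=` Om.
  move=> x cx; apply: contrapT => nO.
  by have [y [/= /negP ny /eqP]] := cx _ (approx_out nO).
split => //; first exact: locsm_smooth approx_locsm.
have [B _ hB] := box_bound.
apply: (@subclosed_compact _ _ ((`[- B, B] : set R) `*` (`[- B, B] : set R))).
- exact: closed_closure.
- by apply: compact_setX; exact: segment_compact.
- move=> x /sub/Om_cl[i ci]; have := hB _ _ false ci; have := hB _ _ true ci.
  by rewrite !ler_norml => h1 h2; split; rewrite /= in_itv.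
Qed.

Lemma approx_pderiv b i x : cl i x -> pderiv b approx x = pderiv b (u i) (SS x) * S' (crd b x).
Proof.
move=> ci; rewrite (near_eq_pderiv b (approx_in ci)) pderivE derive1E.
have [p /(_ i)/(Qp_C1 b) Cu] := uQ.
have [_ du _] := section_C1 (S (crd (~~ b) x)) Cu.
have dc := is_derive1_comp (du (S (crd b x))) (dS (crd b x)).
have -> : (fun t => u i (SS (mk b t (crd (~~ b) x)))) = (fun t => u i (mk b t (S (crd (~~ b) x)))) \o S.
  by apply/funext => t /=; congr (u i _); case: (b).
rewrite (@derive_val _ _ _ _ _ _ _ dc); congr (pderiv b _ _ * _).
by rewrite -[RHS](mkE b) !SS_crd.
Qed.

End Plateau.

Lemma glue_bound : exists B : R, forall i x, cl i x -> `|u i x| <= B /\ forall b, `|pderiv b (u i) x| <= B.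
Proof.
have [p hp] := uQ.
have H i : exists B, forall x, cl i x -> `|u i x| <= B /\ forall b, `|pderiv b (u i) x| <= B.
  have [c1 _ d1] := Qp_C1 false (hp i); have [_ _ d2] := Qp_C1 true (hp i).
  have [B1 h1] := continuous_box_bound (tnth M i) c1.
  have [B2 h2] := continuous_box_bound (tnth M i) d1.
  have [B3 h3] := continuous_box_bound (tnth M i) d2.
  exists (Num.max B1 (Num.max B2 B3)) => x /(crectP M)[a c].
  split; first by rewrite le_max h1.
  by move=> []; rewrite !le_max; [rewrite (h3 _ a c)|rewrite (h2 _ a c)]; rewrite ?orbT.
have [B hB] := choice H.
exists (\sum_i `|B i|) => i x /hB[h1 h2].
have S : B i <= \sum_j `|B j|.
  by rewrite (bigD1 i) //= (le_trans (ler_norm _)) // lerDl sumr_ge0.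
by split => [|b]; [exact: le_trans h1 S|exact: le_trans (h2 b) S].
Qed.

Lemma interior_box x i : cl i x -> x.1 \notin grid -> x.2 \notin grid -> box (tnth M i) x.
Proof.
move=> /(clP M false)[/= /andP[a1 a2] /andP[c1 c2]] n1 n2; apply/(boxP M false); rewrite /= !lt_neqAle a1 a2 c1 c2 !andbT.
have N e d : ext e d i != crd d x.
  by apply/negP => /eqP E; have := grid_ext e d i; rewrite E; apply/negP; case: (d).
by split; apply/andP; split; rewrite 1?eq_sym; [have := N false false|have := N true false|have := N false true|have := N true true]; rewrite // eq_sym.
Qed.

(** Plateaus of width tending to 0. Near a point off the grid lines the approximations eventually
    coincide with the function, derivatives included, and the uniform bound on [S'] provides the
    domination. *)
Lemma broken_H10 : H10 Om (broken_fun M u).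
Proof.
exists (fun b => broken_fun M (fun i => pderiv b (u i))); split; first exact: broken_H1.
have [g g0 hg] := seq_separated grid.
have [K hK] := plateau_bounds (undup_uniq _ : uniq grid) hg.
pose e (k : nat) : R := g / 2 / k.+1%:R.
have e0 k : 0 < e k by rewrite !divr_gt0.
have eg k : 2 * e k <= g.
  rewrite /e mulrA [2 * _]mulrC divfK ?gt_eqF // ler_pdivrMr // ler_peMr ?(ltW g0) //.
  by rewrite ler1n.
have sS k := (hK (e k) (e0 k) (eg k)).1.
have [S' hS'] := choice (fun k => (hK (e k) (e0 k) (eg k)).2).
pose S k := plateau grid (e k).
have [B hB] := glue_bound.
have test k : test_function Om (approx (S k)) by case: (hS' k) => h1 h2 h3 h4 h5; apply: (approx_test (e0 k) (sS k)).
have near_id x : Om x -> x.1 \notin grid -> x.2 \notin grid ->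
    \forall k \near \oo, exists2 i, box (tnth M i) x & \forall y \near x, approx (S k) y = u i y.
  move=> Ox n1 n2; have [i ci] := Om_cl Ox.
  have bi := interior_box ci n1 n2.
  have [g1 g10 h1] := seq_gap grid x.1; have [g2 g20 h2] := seq_gap grid x.2.
  near=> k; exists i => //; have ek : e k < Num.min g1 g2.
    near: k; have := @cvg_harmonic R => /cvgrPdist_lt/(_ (Num.min g1 g2 / (g / 2))).
    have m0 : 0 < Num.min g1 g2 by rewrite lt_min g10.
    have gg : 0 < g / 2 by rewrite divr_gt0.
    move=> /(_ (divr_gt0 m0 gg)); apply: filterS => k; rewrite sub0r normrN ger0_norm ?invr_ge0 //.
    by rewrite ltr_pdivlMr // mulrC.
  move: ek; rewrite lt_min => /andP[ek1 ek2].
  have [dS SK Sc Sm Si] := hS' k.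
  have N (t a : R) (ga : R) : e k < ga -> (forall y : R, y \in grid -> y != a -> ga < `|y - a|) -> a \notin grid ->
      `|t - a| < ga - e k -> S k t = t.
    move=> lt hga na h; apply: Si => c cX.
    have := hga c cX; have -> : c != a by apply: contraNneq na => <-.
    move=> /(_ isT) h3; have := ler_distD t c a; rewrite (distrC c t); lra.
  near=> y.
  have E1 : S k y.1 = y.1.
    apply: (N y.1 _ _ ek1 h1 n1); rewrite distrC; near: y.
    by apply: cvgr_dist_lt; [exact: cvg_fst|rewrite subr_gt0].
  have E2 : S k y.2 = y.2.
    apply: (N y.2 _ _ ek2 h2 n2); rewrite distrC; near: y.
    by apply: cvgr_dist_lt; [exact: cvg_snd|rewrite subr_gt0].
  rewrite /approx (_ : SS (S k) y = y); last by rewrite /SS E1 E2 -surjective_pairing.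
  apply: glue_in; near: y.
  have : nbhs x (box (tnth M i)) by apply: open_nbhs_nbhs; split => //; exact: box_open.
  apply: filterS => y /(boxP M false)[/andP[a1 a2] /andP[c1 c2]].
  by apply/(clP M false); rewrite !ltW.
have mO := mOm oOm.
have [p hp] := uQ.
have cu i : continuous (u i) by have [] := Qp_C1 false (hp i).
have cdu b i : continuous (pderiv b (u i)) by have [] := Qp_C1 b (hp i).
have Bbr (f : 'I_n -> pt -> R) (x : pt) (C : R) : 0 <= C -> (forall i, cl i x -> `|f i x| <= C) -> `|broken_fun M f x| <= C.
  move=> C0 hf; have [[i bi]|h] := box_cases M x; last by rewrite broken_out // normr0.
  rewrite (broken_in HC _ bi) hf //; apply/(closureP HC); exact: subset_closure.
have B0 x : Om x -> 0 <= B by move=> /Om_cl[i /hB[h _]]; exact: le_trans h.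
exists (fun k => approx (S k)); split => // [|b].
- apply: (@L2norm_cvg0 _ (B + B)) => [k|k x Ox|x Ox n1 n2].
  + apply: measurable_funB; last exact: broken_measurable.
    by apply: continuous_measurable2 => //; have [/(_ [::])[]] := test k.
  + apply: le_trans (ler_normB _ _) _; apply: lerD.
      have [i ci] := Om_cl Ox; have [dS SK Sc Sm Si] := hS' k.
      have ci' := below_cl (below_SS (e0 k) Sc Sm x) ci.
      by rewrite /approx (glue_in ci'); exact: (hB _ _ ci').1.
    by apply: Bbr; [exact: B0 Ox|move=> i /hB[]].
  + apply: filterS (near_id x Ox n1 n2) => k [i bi /nbhs_singleton ->].
    by rewrite (broken_in HC _ bi) subrr.
- apply: (@L2norm_cvg0 _ (B * K + B)) => [k|k x Ox|x Ox n1 n2].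
  + apply: measurable_funB; last exact: broken_measurable.
    by apply: continuous_measurable2 => //; have [/(_ [:: b])[]] := test k.
  + apply: le_trans (ler_normB _ _) _; apply: lerD.
      have [i ci] := Om_cl Ox; have [dS SK Sc Sm Si] := hS' k.
      have ci' := below_cl (below_SS (e0 k) Sc Sm x) ci.
      rewrite (approx_pderiv (e0 k) dS Sc Sm b ci) normrM ler_pM //.
      exact: (hB _ _ ci').2.
    by apply: Bbr; [exact: B0 Ox|move=> i /hB[]].
  + apply: filterS (near_id x Ox n1 n2) => k [i bi /(near_eq_pderiv b) ->].
    by rewrite (broken_in HC _ bi) subrr.
Unshelve. all: by end_near. Qed.

End Function.
End Approximation.

Section Linearity.
Variables (R : realType) (n : nat) (M : n.-tuple (rect R)) (Phi : R -> R).
Variable tgt : ('I_n -> R * R -> R) -> R * R -> R.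
Hypothesis tgt_lin : forall (a : R) v w x, tgt (fun i y => a * v i y + w i y) x = a * tgt v x + tgt w x.

Lemma vc_linear (a : R) v w i x : vc M Phi (tgt (fun i y => a * v i y + w i y)) (fun i y => a * v i y + w i y) i x =
  a * vc M Phi (tgt v) v i x + vc M Phi (tgt w) w i x.
Proof.
rewrite /vc mulrDr addrACA; congr (_ + _); rewrite mulr_sumr -big_split /=.
by apply: eq_bigr => c _; rewrite tgt_lin; ring.
Qed.

Lemma interp_linear (a : R) v w i x :
  interp M Phi (tgt (fun i y => a * v i y + w i y)) (fun i y => a * v i y + w i y) i x =
  a * interp M Phi (tgt v) v i x + interp M Phi (tgt w) w i x.
Proof.
have lin (F G H : bool -> bool -> R) : (forall d e, F d e = a * G d e + H d e) ->
    \sum_d \sum_e F d e = a * (\sum_d \sum_e G d e) + \sum_d \sum_e H d e.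
  by move=> h; rewrite !big_bool /= !h; ring.
rewrite /interp vc_linear (lin _ (fun d e => lift M Phi (tgt v) v i d e x) (fun d e => lift M Phi (tgt w) w i d e x)); first by ring.
by move=> d e; rewrite /lift; case: pickP => [j _|_] /=; rewrite ?vc_linear; ring.
Qed.

End Linearity.

Theorem lemma3p2 (R : realType) (Om Om1 : set (R * R)) (delta0 C0 CK : R)
    (T0 : seq (rect R))
    (hOm : rectangular_domain Om) (hOm1 : interface_setting Om Om1)
    (hdelta0 : 0 < delta0 < 2^-1)
    (hT0 : cartesian_mesh Om T0) (hT0c : conforming T0) :
  exists2 C : R, 0 < C &
  forall (T : seq (rect R)) (n : nat) (M : n.-tuple (rect R)),
    refinement T0 T ->
    interface_resolved (interface Om Om1) T ->
    induced_mesh Om Om1 delta0 C0 T M ->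
    k_mesh Om M CK ->
  exists omega : 'I_n -> {set 'I_n},
    (forall i, i \in omega i /\
       diam (union_of M (omega i)) <= C * hK (tnth M i)) /\
    forall p : nat, (1 <= p)%N ->
    exists pi_h : ('I_n -> R * R -> R) -> ('I_n -> R * R -> R),
      [/\ forall (a : R) v w, Vp p v -> Vp p w ->
            forall i x, pi_h (fun j y => a * v j y + w j y) i x
                        = a * pi_h v i x + pi_h w i x,
          forall v, Vp p v -> Vp p (pi_h v) /\ H1 Om (broken_fun M (pi_h v)),
          forall v, Vp p v -> forall i,
            L2norm (box (tnth M i)) (fun x => v i x - pi_h v i x)
            <= C * jump_norm M (omega i)
                     (fun h => p%:R^-1 * Num.sqrt h) v
            /\
            L2norm_grad (box (tnth M i)) (fun x => v i x - pi_h v i x)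
            <= C * jump_norm M (omega i)
                     (fun h => p%:R * (Num.sqrt h)^-1) v
        & forall v, Vp p v -> vanishes_on_bd Om M v ->
            H10 Om (broken_fun M (pi_h v))].
Proof.
have [[oOm _ _ HL] _] := hOm.
have [k k0 hk] := @shape_exists R T0 (fun K hK => let: And5 _ h _ _ _ := hT0 in (h K hK).1).
(* The aspect ratios of [T0] together with [C0] and [CK] fix all constants, before [T], [M] and [p]
   are introduced. *)
pose kap := k + `|C0| * (1 + k); pose C := `|CK| * (1 + kap).
have kap0 : 0 <= kap by rewrite addr_ge0 // mulr_ge0 // addr_ge0.
have C00 : 0 <= C by rewrite mulr_ge0 // addr_ge0.
have S0 := sqrtr_ge0 (Kerr C * Kh C kap); have CS0 := mulr_ge0 C00 S0.
have K0 : 0 <= Kfin C kap by rewrite /Kfin; have := sqr_ge0 C; lra.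
(* The summand 1 makes the constant positive, as [Kfin C kap] is only shown to be nonnegative. *)
exists (Kfin C kap + 1); first by rewrite ltr_wpDl.
move=> T n M hT _ [HC hm _] HK.
have Hs i : shape kap (tnth M i).
  apply: (merged_shape k0 _ HC hm) (mem_tnth i M).
  apply: (refinement_shape _ hT) => K KT; split; last exact: hk.
  by case: hT0 => _ h _ _ _; exact: (h K KT).1.
have [C' HG CE] := graded_kmesh HC oOm HL Hs HK; rewrite -/C in CE; subst C'.
have Hh := hK_width HC oOm HL Hs; have HM := quad_mesh_of HC oOm HL.
exists (patch_of M C); split => [i|p p1].
  split; first exact: (near_patch HC oOm HL HG (near_self HC oOm HL i)).
  apply: le_trans (patch_diam HC oOm HL HG Hh i) _; apply: ler_wpM2r.
    exact: le_trans (ltW (width_gt0 HM false i)) (Hh i false).2.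
  by rewrite /Kfin; lra.
pose Phi := horner (layer R p).
have Phi0 : Phi 0 = 1 by exact: layer0.
have Phi1 : Phi 1 = 0 by exact: layer1.
have [tgt [tg1 tg2 tgL]] := targets_exist HM HG (fun t => @layer_bound R p t p1).
have bal v : balanced M Phi (tgt v) v.
  move=> i x d nx hx; rewrite (tg1 v i x d nx hx); have /hangP[e he _] := hx.
  by rewrite (vc_side HM Phi0 Phi1 _ _ he).
have conf v := interp_conform HM Phi0 Phi1 (bal v).
have uQ v : Vp p v -> Vp p (interp M Phi (tgt v) v) by move=> hv i; exact: interp_Qp.
exists (fun v => interp M Phi (tgt v) v); split.
- by move=> a v w _ _ i x; rewrite (interp_linear _ _ tgL).
- move=> v hv; split; first exact: uQ.
  eexists; apply: (broken_H1 HC oOm (conf v)); exists p; exact: uQ.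
- move=> v hv i.
  have [h1 h2] := interp_bounds HC oOm HL HG Hh i p1 hv (tg1 v) (tg2 v).
  have W J : 0 <= J -> Kfin C kap * J <= (Kfin C kap + 1) * J by move=> J0; rewrite ler_wpM2r // lerDl.
  by split; [apply: le_trans h1 (W _ _)|apply: le_trans h2 (W _ _)]; exact: sqrtr_ge0.
- move=> v hv v0; apply: (broken_H10 HC oOm HL (conf v)); first by exists p; exact: uQ.
  by move=> i x; exact: (interp_bd HC oOm HL HG v0 Phi0 Phi1 (tg2 v) (bal v)).
Qed.
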